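(* Let $V$ be a Hilbert module over the Clifford algebra $\mathbb{R}_d$, let $T\in\mathcal{K}(V)$ be densely defined, and let $K\subseteq\rho_S(T)$ be compact and axially symmetric. Then for every $f\in\mathcal{SH}_L(\mathbb{R}^{d+1}\setminus K)$ or $f\in\mathcal{SH}_R(\mathbb{R}^{d+1}\setminus K)$ for which the limit $\lim_{|s|\to\infty}f(s)$ exists in $\mathbb{R}_d$, the unbounded $S$-functional calculi of $T^*$ and $T$ are connected via $$f(T^* )=f^\#(T)^*,\qquad f^\#(s):=\overline{f(\overline{s})}.$$ Here, if $f\in\mathcal{SH}_L(\mathbb{R}^{d+1}\setminus K)$, then $f(T^* )$ is the left and $f^\#(T)$ the right unbounded $S$-functional calculus; if $f\in\mathcal{SH}_R(\mathbb{R}^{d+1}\setminus K)$, then $f(T^* )$ is the right and $f^\#(T)$ the left unbounded $S$-functional calculus. If moreover $f\in\mathcal{N}(\mathbb{R}^{d+1}\setminus K)$ is intrinsic, then $f(T^* )=f(T)^*$.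
   Context: Clifford algebra: for $d\in\mathbb{N}$, $d\ge1$, $\mathbb{R}_d$ is the real Clifford algebra generated by $e_1,\dots,e_d$ with $e_i^2=-1$, $e_ie_j=-e_je_i$ for $i\neq j$, with real basis $e_A=e_{i_1}\cdots e_{i_r}$, $A=(i_1,\dots,i_r)$, $1\le i_1<\dots<i_r\le d$, $e_\emptyset=1$. For $s=\sum_As_Ae_A$: $\overline{s}=\sum_A(-1)^{|A|(|A|+1)/2}s_Ae_A$, $|s|^2=\sum_As_A^2$. Paravectors: $\mathbb{R}^{d+1}=\{s_0+s_1e_1+\dots+s_de_d\}$, $\operatorname{Im}(s)=s_1e_1+\dots+s_de_d$. $\mathbb{S}=\{J\in\mathbb{R}^{d+1}\mid J_0=0,|J|=1\}$, $\mathbb{C}_J=\{x+Jy\mid x,y\in\mathbb{R}\}$, $[s]=\{s_0+J|\operatorname{Im}(s)|\mid J\in\mathbb{S}\}$; $U\subseteq\mathbb{R}^{d+1}$ is axially symmetric if $[s]\subseteq U$ for all $s\in U$. Slice hyperholomorphic functions: for $U$ open, axially symmetric, let $\mathcal{U}=\{(x,y)\in\mathbb{R}^2\mid x+\mathbb{S}y\subseteq U\}$. $f:U\to\mathbb{R}_d$ is in $\mathcal{SH}_L(U)$ (resp. $\mathcal{SH}_R(U)$) if there are $C^1$ functions $f_0,f_1:\mathcal{U}\to\mathbb{R}_d$ with $f(x+Jy)=f_0(x,y)+Jf_1(x,y)$ (resp. $f(x+Jy)=f_0(x,y)+f_1(x,y)J$) for all $J\in\mathbb{S}$, $f_0(x,-y)=f_0(x,y)$,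 $f_1(x,-y)=-f_1(x,y)$, $\partial_xf_0=\partial_yf_1$, $\partial_yf_0=-\partial_xf_1$. If $f_0,f_1$ are real valued, $f$ is intrinsic, $f\in\mathcal{N}(U)$. Hilbert module: for a real Hilbert space $V_\mathbb{R}$, $V=\{\sum_Av_A\otimes e_A\mid v_A\in V_\mathbb{R}\}$ with $\|v\|^2=\sum_A\|v_A\|_\mathbb{R}^2$, $sv=\sum_{A,B}(s_Bv_A)\otimes(e_Be_A)$, $vs=\sum_{A,B}(v_As_B)\otimes(e_Ae_B)$, $\langle v,w\rangle=\sum_{A,B}\langle v_A,w_B\rangle_\mathbb{R}\overline{e_A}e_B$. $\mathcal{B}(V)$: bounded everywhere defined right-linear operators; $\mathcal{K}(V)$: closed right-linear operators $T:\operatorname{dom}(T)\subseteq V\to V$ (domain a right submodule). The adjoint of a densely defined right-linear $T$ has $\operatorname{dom}(T^* )=\{w\in V\mid\exists v_w\in V:\langle v_w,v\rangle=\langle w,Tv\rangle\ \forall v\in\operatorname{dom}(T)\}$, $T^*w=v_w$. Clifford numbers act on operators by left multiplication: $(sT)v=s(Tv)$, $(Ts)v=T(sv)$. $S$-spectrum: $Q_s[T]=T^2-2s_0T+|s|^2$ on $\operatorname{dom}(T^2)$, $\rho_S(T)=\{s\in\mathbb{R}^{d+1}\mid Q_s[T]^{-1}\in\mathcal{B}(V)\}$, $\sigma_S(T)=\mathbb{R}^{d+1}\setminus\rho_S(T)$ (one has $\rho_S(T^* )=\rho_S(T)$); $S_L^{-1}(s,T)=Q_s[T]^{-1}\overline{s}-TQ_s[T]^{-1}$,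 $S_R^{-1}(s,T)=(\overline{s}-T)Q_s[T]^{-1}$ for $s\in\rho_S(T)$. Unbounded $S$-functional calculus: let $T\in\mathcal{K}(V)$, $K\subseteq\rho_S(T)$ compact and axially symmetric, $f\in\mathcal{SH}_L(\mathbb{R}^{d+1}\setminus K)$ (resp. $\mathcal{SH}_R$) such that $f_\infty:=\lim_{|s|\to\infty}f(s)\in\mathbb{R}_d$ exists. Then $$f(T):=f_\infty-\frac{1}{2\pi}\int_{\partial U\cap\mathbb{C}_J}S_L^{-1}(s,T)\,ds_J\,f(s)\qquad\Big(\text{resp. }f(T):=f_\infty-\frac{1}{2\pi}\int_{\partial U\cap\mathbb{C}_J}f(s)\,ds_J\,S_R^{-1}(s,T)\Big),$$ where $f_\infty$ acts as the left multiplication $v\mapsto f_\infty v$, $J\in\mathbb{S}$ is arbitrary, and $U$ is a bounded, axially symmetric open set with $K\subseteq U\subseteq\overline{U}\subseteq\rho_S(T)$ whose boundary is regular enough (e.g. $\partial U\cap\mathbb{C}_J$ is a finite union of piecewise $C^1$ Jordan curves), positively oriented (with respect to $U$) in $\mathbb{C}_J$. Here $ds_J:=-J\,ds$, i.e. for a parametrization $\gamma$ in $\mathbb{C}_J$ the integrand is $S_L^{-1}(\gamma(t),T)(-J\gamma'(t))f(\gamma(t))\,dt$ (resp. $f(\gamma(t))(-J\gamma'(t))S_R^{-1}(\gamma(t),T)\,dt$). The value does not depend on $J$ and $U$, and for intrinsic $f$ the left and right versions coincide. *)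

(* Defs.v *)
From HB Require Import structures.
From mathcomp Require Import all_boot all_order all_algebra.
From mathcomp Require Import all_classical all_reals all_analysis.

Set Implicit Arguments.
Unset Strict Implicit.
Unset Printing Implicit Defensive.

Import Order.TTheory GRing.Theory Num.Theory.
Import numFieldNormedType.Exports.

Local Open Scope ring_scope.
Local Open Scope classical_set_scope.

Section Clifford.
Context {R : realType} {d : nat}.

(* Elements of R_d are given by their coordinates in the basis e_A, with the
   subset A of {0, ..., d-1} standing for the increasing multi-index of the
   same elements shifted by one. *)
Definition clifford (R : realType) (d : nat) := {ffun {set 'I_d} -> R}.

Definition symdiff (A B : {set 'I_d}) : {set 'I_d} := (A :\: B) :|: (B :\: A).

(* e_A e_B = cl_sign A B * e_(symdiff A B): sorting the word e_A e_B costs one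
   transposition for each pair i in A, j in B with j < i, and each repeated
   generator contributes e_i^2 = -1. *)
Definition cl_sign (A B : {set 'I_d}) : R :=
  (-1) ^+ (#|[pred p : 'I_d * 'I_d |
              [&& p.1 \in A, p.2 \in B & (p.2 < p.1)%N]]| + #|A :&: B|).

Definition cl_basis (A : {set 'I_d}) : clifford R d := [ffun B => (B == A)%:R].

Definition cl_mul (a b : clifford R d) : clifford R d :=
  \sum_(A : {set 'I_d}) \sum_(B : {set 'I_d})
    (a A * b B * cl_sign A B) *: cl_basis (symdiff A B).

Definition cl_conj (a : clifford R d) : clifford R d :=
  [ffun A : {set 'I_d} => (-1) ^+ (#|A| * #|A|.+1)./2 * a A].

Definition cl_norm (a : clifford R d) : R := Num.sqrt (\sum_A a A ^+ 2).

(* A paravector s_0 + s_1 e_1 + ... + s_d e_d is the row (s_0, ..., s_d). The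
   canonical norm of 'rV[R]_d.+1 is the sup norm: it is only used through the
   topology and the bounded sets it defines, |s| is pv_norm s. *)
Definition pv_val (s : 'rV[R]_d.+1) : clifford R d :=
  s 0 0 *: cl_basis finset.set0 +
  \sum_(i < d) s 0 (lift ord0 i) *: cl_basis [set i]%SET.

Definition pv_norm (s : 'rV[R]_d.+1) : R := Num.sqrt (\sum_i s 0 i ^+ 2).

Definition pv_im_norm (s : 'rV[R]_d.+1) : R :=
  Num.sqrt (\sum_(i < d) s 0 (lift ord0 i) ^+ 2).

Definition pv_conj (s : 'rV[R]_d.+1) : 'rV[R]_d.+1 :=
  \row_i (if i == ord0 then s 0 i else - s 0 i).

Definition imag_unit : set 'rV[R]_d.+1 :=
  [set J : 'rV[R]_d.+1 | J 0 0 = 0 /\ pv_norm J = 1].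

(* The paravector x + J y. *)
Definition slice (J : 'rV[R]_d.+1) (x y : R) : 'rV[R]_d.+1 :=
  x *: delta_mx 0 0 + y *: J.

Definition axially_symmetric (U : set 'rV[R]_d.+1) : Prop :=
  forall s, U s -> forall J, imag_unit J -> U (slice J (s 0 0) (pv_im_norm s)).

(* The planar set of all (x, y) with x + S y contained in U. *)
Definition plane_set (U : set 'rV[R]_d.+1) : set (R * R) :=
  [set p | forall J, imag_unit J -> U (slice J p.1 p.2)].

Definition partial_x (g : R -> R -> clifford R d) (A : {set 'I_d}) (x y : R) :=
  derive1 (fun u => g u y A) x.

Definition partial_y (g : R -> R -> clifford R d) (A : {set 'I_d}) (x y : R) :=
  derive1 (fun u => g x u A) y.

Definition C1_on (D : set (R * R)) (g : R -> R -> clifford R d) : Prop :=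
  forall (A : {set 'I_d}) (x y : R), D (x, y) ->
  [/\ derivable (fun u => g u y A) x 1,
      derivable (fun u => g x u A) y 1,
      {for (x, y), continuous (fun p : R * R => partial_x g A p.1 p.2)} &
      {for (x, y), continuous (fun p : R * R => partial_y g A p.1 p.2)}].

Definition slice_pair (U : set 'rV[R]_d.+1) (f0 f1 : R -> R -> clifford R d)
    : Prop :=
  [/\ C1_on (plane_set U) f0,
      C1_on (plane_set U) f1,
      forall x y, plane_set U (x, y) -> f0 x (- y) = f0 x y,
      forall x y, plane_set U (x, y) -> f1 x (- y) = - f1 x y &
      forall A x y, plane_set U (x, y) ->
        partial_x f0 A x y = partial_y f1 A x y /\
        partial_y f0 A x y = - partial_x f1 A x y].

(* Functions on U are total functions of which only the values on U matter. *)
Definition SH_L (U : set 'rV[R]_d.+1) (f : 'rV[R]_d.+1 -> clifford R d) : Prop :=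
  exists f0 f1, slice_pair U f0 f1 /\
  forall x y J, plane_set U (x, y) -> imag_unit J ->
    f (slice J x y) = f0 x y + cl_mul (pv_val J) (f1 x y).

Definition SH_R (U : set 'rV[R]_d.+1) (f : 'rV[R]_d.+1 -> clifford R d) : Prop :=
  exists f0 f1, slice_pair U f0 f1 /\
  forall x y J, plane_set U (x, y) -> imag_unit J ->
    f (slice J x y) = f0 x y + cl_mul (f1 x y) (pv_val J).

Definition cl_real (a : clifford R d) : Prop :=
  forall A, A != finset.set0 -> a A = 0.

Definition SH_N (U : set 'rV[R]_d.+1) (f : 'rV[R]_d.+1 -> clifford R d) : Prop :=
  exists f0 f1, [/\ slice_pair U f0 f1,
    forall x y, plane_set U (x, y) -> cl_real (f0 x y) /\ cl_real (f1 x y) &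
    forall x y J, plane_set U (x, y) -> imag_unit J ->
      f (slice J x y) = f0 x y + cl_mul (pv_val J) (f1 x y)].

Definition lim_infty (f : 'rV[R]_d.+1 -> clifford R d) (c : clifford R d) : Prop :=
  forall eps : R, 0 < eps -> exists M : R,
    forall s, M < pv_norm s -> cl_norm (f s - c) < eps.

Definition sharp (f : 'rV[R]_d.+1 -> clifford R d) : 'rV[R]_d.+1 -> clifford R d :=
  fun s => cl_conj (f (pv_conj s)).

End Clifford.

Section Contours.
Context {R : realType}.

(* A piecewise C^1 closed curve in the plane is the list of its C^1 arcs, each
   parametrized by [0, 1]; every C^1 function on [0, 1] extends to a C^1
   function on R, so that asking for C^1 on R is no restriction. *)
Definition C1_arc (c : R -> R * R) : Prop :=
  (forall t, derivable c t 1) /\ continuous (derive1 c).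

Definition jordan_curve (g : seq (R -> R * R)) : Prop :=
  let arc i := nth (cst 0) g i in
  [/\ (0 < size g)%N,
      forall i, (i < size g)%N -> C1_arc (arc i),
      forall i, (i < size g)%N -> arc i 1 = arc (i.+1 %% size g)%N 0 &
      forall i j s t, (i < size g)%N -> (j < size g)%N ->
        0 <= s < 1 -> 0 <= t < 1 -> arc i s = arc j t -> i = j /\ s = t].

(* Winding number of the cycle G around p: the real form of
   (2 pi i)^-1 times the integral of dz / (z - p). *)
Definition winding (G : seq (seq (R -> R * R))) (p : R * R) : R :=
  (2 * pi)^-1 * \sum_(c <- flatten G)
    \int[lebesgue_measure]_(t in `[0%R, 1%R])
      ((((c t).1 - p.1) * (derive1 c t).2 - ((c t).2 - p.2) * (derive1 c t).1)
       / (((c t).1 - p.1) ^+ 2 + ((c t).2 - p.2) ^+ 2)).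

(* The boundary of U in C_J, identified with the plane by (x, y) |-> x + J y,
   is the union of the curves of G, positively oriented with respect to U: the
   cycle G winds once around the points of U and does not wind around the
   points outside of the closure of U. *)
Definition boundary_cycle {d : nat} (U : set 'rV[R]_d.+1) (J : 'rV[R]_d.+1)
    (G : seq (seq (R -> R * R))) : Prop :=
  [/\ forall i, (i < size G)%N -> jordan_curve (nth [::] G i),
      forall x y, (closure U `\` interior U) (slice J x y) <->
        exists (i : nat) (t : R), [/\ (i < size (flatten G))%N, 0 <= t <= 1 &
                        nth (cst 0) (flatten G) i t = (x, y)],
      forall x y, U (slice J x y) -> winding G (x, y) = 1 &
      forall x y, ~ closure U (slice J x y) -> winding G (x, y) = 0].

End Contours.

Section HilbertModule.
Context {R : realType} {d : nat} {H : completeNormedModType R}.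

(* H is a Hilbert space for the inner product ip. *)
Definition hilbert_inner (ip : H -> H -> R) : Prop :=
  [/\ forall u v, ip u v = ip v u,
      forall a u v w, ip (a *: u + v) w = a * ip u w + ip v w &
      forall u, ip u u = `|u| ^+ 2].

(* The vector with components v_A, i.e. the sum of the v_A (x) e_A. *)
Definition hmod (H : Type) (d : nat) := {ffun {set 'I_d} -> H}.

Definition hm_tensor (h : H) (A : {set 'I_d}) : hmod H d :=
  [ffun B => if B == A then h else 0].

Definition hm_norm (v : hmod H d) : R := Num.sqrt (\sum_A `|v A| ^+ 2).

Definition hm_lmul (s : clifford R d) (v : hmod H d) : hmod H d :=
  \sum_(A : {set 'I_d}) \sum_(B : {set 'I_d})
    hm_tensor ((s B * cl_sign B A) *: v A) (symdiff B A).

Definition hm_rmul (v : hmod H d) (s : clifford R d) : hmod H d :=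
  \sum_(A : {set 'I_d}) \sum_(B : {set 'I_d})
    hm_tensor ((s B * cl_sign A B) *: v A) (symdiff A B).

Definition hm_ip (ip : H -> H -> R) (v w : hmod H d) : clifford R d :=
  \sum_(A : {set 'I_d}) \sum_(B : {set 'I_d})
    ip (v A) (w B) *: cl_mul (cl_conj (cl_basis A)) (cl_basis B).

(* A possibly not everywhere defined operator: the values of op_fun outside of
   op_dom are irrelevant. *)
Record operator := Operator {
  op_dom : set (hmod H d);
  op_fun : hmod H d -> hmod H d }.

Definition op_total (A : hmod H d -> hmod H d) : operator := Operator setT A.

Definition op_eq (S T : operator) : Prop :=
  op_dom S = op_dom T /\ forall v, op_dom S v -> op_fun S v = op_fun T v.

Definition op_rlinear (T : operator) : Prop :=
  [/\ op_dom T 0,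
      forall u v, op_dom T u -> op_dom T v ->
        op_dom T (u + v) /\ op_fun T (u + v) = op_fun T u + op_fun T v &
      forall v s, op_dom T v ->
        op_dom T (hm_rmul v s) /\ op_fun T (hm_rmul v s) = hm_rmul (op_fun T v) s].

Definition op_bounded (T : operator) : Prop :=
  [/\ op_rlinear T, op_dom T = setT &
      exists M : R, forall v, hm_norm (op_fun T v) <= M * hm_norm v].

Definition op_closed (T : operator) : Prop :=
  op_rlinear T /\
  forall (u : nat -> hmod H d) (v w : hmod H d),
    (forall n, op_dom T (u n)) ->
    (fun n => hm_norm (u n - v)) @ \oo --> (0 : R) ->
    (fun n => hm_norm (op_fun T (u n) - w)) @ \oo --> (0 : R) ->
    op_dom T v /\ op_fun T v = w.

Definition densely_defined (T : operator) : Prop :=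
  forall v (eps : R), 0 < eps -> exists2 u, op_dom T u & hm_norm (v - u) < eps.

Definition adj_at (ip : H -> H -> R) (T : operator) (w u : hmod H d) : Prop :=
  forall v, op_dom T v -> hm_ip ip u v = hm_ip ip w (op_fun T v).

Definition adjoint (ip : H -> H -> R) (T : operator) : operator :=
  Operator [set w | exists u, adj_at ip T w u]
           (fun w => xget 0 [set u | adj_at ip T w u]).

Definition op_inv (T : operator) : operator :=
  Operator [set op_fun T v | v in op_dom T]
           (fun w => xget 0 [set v | op_dom T v /\ op_fun T v = w]).

Definition op_injective (T : operator) : Prop :=
  forall u v, op_dom T u -> op_dom T v -> op_fun T u = op_fun T v -> u = v.

Definition Q_op (s : 'rV[R]_d.+1) (T : operator) : operator :=
  Operator [set v | op_dom T v /\ op_dom T (op_fun T v)]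
           (fun v => op_fun T (op_fun T v) - (2 * s 0 0) *: op_fun T v
                     + (pv_norm s ^+ 2) *: v).

Definition rho_S (T : operator) : set 'rV[R]_d.+1 :=
  [set s | op_injective (Q_op s T) /\ op_bounded (op_inv (Q_op s T))].

(* The S-resolvents are meant for s in rho_S T only, where all the vectors
   involved are in the relevant domains. *)
Definition SL_res (s : 'rV[R]_d.+1) (T : operator) (v : hmod H d) : hmod H d :=
  op_fun (op_inv (Q_op s T)) (hm_lmul (pv_val (pv_conj s)) v)
  - op_fun T (op_fun (op_inv (Q_op s T)) v).

Definition SR_res (s : 'rV[R]_d.+1) (T : operator) (v : hmod H d) : hmod H d :=
  hm_lmul (pv_val (pv_conj s)) (op_fun (op_inv (Q_op s T)) v)
  - op_fun T (op_fun (op_inv (Q_op s T)) v).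

(* A is the Riemann integral of F over [0, 1] in the operator norm. *)
Definition is_op_integral (F : R -> hmod H d -> hmod H d)
    (A : hmod H d -> hmod H d) : Prop :=
  forall eps : R, 0 < eps -> exists2 delta : R, 0 < delta &
  forall (n : nat) (t xi : nat -> R), t 0%N = 0 -> t n = 1 ->
    (forall i, (i < n)%N -> t i <= xi i <= t i.+1 /\ t i.+1 - t i < delta) ->
    forall v, hm_norm (\sum_(i < n) (t i.+1 - t i) *: F (xi i) v - A v)
              <= eps * hm_norm v.

(* The integral along a cycle, where F c is the integrand along the arc c. *)
Definition is_cycle_integral (F : (R -> R * R) -> R -> hmod H d -> hmod H d)
    (G : seq (seq (R -> R * R))) (A : hmod H d -> hmod H d) : Prop :=
  exists I : nat -> hmod H d -> hmod H d,
    (forall k, (k < size (flatten G))%N ->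
      is_op_integral (F (nth (cst 0) (flatten G) k)) (I k)) /\
    forall v, A v = \sum_(k < size (flatten G)) I k v.

(* For the arc c of the plane, the point and the factor - J gamma'(t) along
   the curve gamma = c.1 + J c.2 of C_J. *)
Definition arc_point (J : 'rV[R]_d.+1) (c : R -> R * R) (t : R) : 'rV[R]_d.+1 :=
  slice J (c t).1 (c t).2.

Definition arc_dsJ (J : 'rV[R]_d.+1) (c : R -> R * R) (t : R) : clifford R d :=
  cl_mul (- pv_val J) (pv_val (slice J (derive1 c t).1 (derive1 c t).2)).

Definition SL_integrand (J : 'rV[R]_d.+1) (T : operator)
    (f : 'rV[R]_d.+1 -> clifford R d) (c : R -> R * R) (t : R) (v : hmod H d) :=
  SL_res (arc_point J c t) T
    (hm_lmul (cl_mul (arc_dsJ J c t) (f (arc_point J c t))) v).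

Definition SR_integrand (J : 'rV[R]_d.+1) (T : operator)
    (f : 'rV[R]_d.+1 -> clifford R d) (c : R -> R * R) (t : R) (v : hmod H d) :=
  hm_lmul (cl_mul (f (arc_point J c t)) (arc_dsJ J c t))
    (SR_res (arc_point J c t) T v).

(* The choices J, U and G (a parametrization of the boundary of U in C_J) that
   are allowed in the definition of f(T), for f defined outside of K. *)
Definition admissible (T : operator) (K : set 'rV[R]_d.+1)
    (J : 'rV[R]_d.+1) (U : set 'rV[R]_d.+1) (G : seq (seq (R -> R * R))) : Prop :=
  [/\ imag_unit J,
      [/\ open U, bounded_set U & axially_symmetric U],
      K `<=` U, closure U `<=` rho_S T & boundary_cycle U J G].

(* A is the operator f(T) of the left (resp. right) unbounded S-functional
   calculus, computed with the imaginary unit J and the cycle G. *)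
Definition calculus_L (T : operator) (f : 'rV[R]_d.+1 -> clifford R d)
    (J : 'rV[R]_d.+1) (G : seq (seq (R -> R * R))) (A : hmod H d -> hmod H d)
    : Prop :=
  exists finf I, [/\ lim_infty f finf,
    is_cycle_integral (SL_integrand J T f) G I &
    forall v, A v = hm_lmul finf v - (2 * pi)^-1 *: I v].

Definition calculus_R (T : operator) (f : 'rV[R]_d.+1 -> clifford R d)
    (J : 'rV[R]_d.+1) (G : seq (seq (R -> R * R))) (A : hmod H d -> hmod H d)
    : Prop :=
  exists finf I, [/\ lim_infty f finf,
    is_cycle_integral (SR_integrand J T f) G I &
    forall v, A v = hm_lmul finf v - (2 * pi)^-1 *: I v].

End HilbertModule.

Arguments operator {R} d H.

(* Main.v *)
Require Import Defs.
From HB Require Import structures.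
From mathcomp Require Import all_boot all_order all_algebra.
From mathcomp Require Import all_classical all_reals all_analysis.
From mathcomp Require Import ring lra zify.

(** Left and right calculus exchange roles under the adjoint because
      << S_L^-1(s, T^* ) u, w >> = << u, S_R^-1(conj s, T) w >>  and
    conj (- J gamma' f) = conj f conj gamma' J,
    so that formally the integral for T^* is the adjoint of the integral for T
    of the conjugate integrand. The two sides may however be computed with
    unrelated imaginary units J, J' and unrelated cycles G, G'. Hence the proof
    contains the independence of these choices, and for this the integrals are
    paired with vectors, which turns them into integrals of real closed
    one-forms on open sets of the plane.

    In the plane of x + j y, where j is a formal imaginary unit commuting with
    T, the resolvent (x + j y - T)^-1 is a - j b with a = (x - T) Q_s[T]^-1 and
    b = y Q_s[T]^-1; both S-resolvents are a - b J and a - J b at s = x + J y.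
    The resolvent identity [res_identity] makes a - j b holomorphic, and so is
    f0 + j f1 by the Cauchy-Riemann equations. Expanding the integrand of f(T),
    one part is a closed form without any J ([form_x], [form_y]), the other part
    is the analogous form for j (f0 + j f1), composed with J. Under the
    reflection (x, y) |-> (x, - y) the pairs a, b and f0, f1 are even and odd,
    so that the first form is odd and the second even, while the cycle is
    mapped to a cycle with the opposite winding numbers. By Cauchy's theorem
    in its homology form ([cauchy_homology]) the second part integrates to 0 and
    the first part has the same integral for all admissible cycles
    ([twisted_integral], [contour_independence]).

    It then remains to compare two integrals without J over the same cycle,
    which holds pointwise: with the real inner product, the resolvent pair of
    T^* is adjoint to the pair of T ([res_adjoint]), and left multiplication by
    e_A is adjoint to left multiplication by the conjugate of e_A ([rip_lmul]).
    That the set where the resolvent of T exists is contained in the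
    corresponding set of T^*, is part of the same computation
    ([rho_plane_adjoint]).

    The analysis behind this: the cycles are only known through their winding
    numbers, and Cauchy's theorem is proved for them by deformation to a fine
    lattice ([cycle_lattice]); T Q_s[T]^-1 is bounded by the closed graph
    theorem, the domain of the resolvent is open by Neumann's series, and the
    operator-valued integrals are defined weakly by Riesz' theorem and shown to
    be limits of Riemann sums in norm ([op_integral_exists]). *)

Import Order.TTheory GRing.Theory Num.Theory.
Import numFieldNormedType.Exports.

Set Implicit Arguments.
Unset Strict Implicit.
Unset Printing Implicit Defensive.

Local Open Scope ring_scope.
Local Open Scope classical_set_scope.

(** * Oriented integrals of continuous functions on a segment *)

Section OrientedIntegral.
Context {R : realType}.
Implicit Types (phi psi F : R -> R) (a b c m M x : R).

(** One of the two segments is empty or a point, so that this is the integral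
    oriented from a to b. *)
Definition oint phi a b : R :=
  \int[lebesgue_measure]_(t in `[a, b]) phi t
  - \int[lebesgue_measure]_(t in `[b, a]) phi t.

Definition between a b x := (Num.min a b <= x <= Num.max a b).

Lemma betweenP a b x : reflect (a <= x <= b \/ b <= x <= a) (between a b x).
Proof.
rewrite /between; apply: (iffP idP) => [|]; case: (leP a b) => ab.
- by left.
- by right.
- by case=> /andP[? ?]; apply/andP; split; lra.
- by case=> /andP[? ?]; apply/andP; split; lra.
Qed.

Lemma between_sub m M a b x : m <= a <= M -> m <= b <= M ->
  between a b x -> m <= x <= M.
Proof. by move=> ? ? /betweenP[]; lra. Qed.

Lemma betweenl a b : between a b a.
Proof. by apply/betweenP; case: (leP a b) => ?; [left|right]; lra. Qed.

Lemma betweenr a b : between a b b.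
Proof. by apply/betweenP; case: (leP a b) => ?; [left|right]; lra. Qed.

Definition clamp m M x := Num.max m (Num.min M x).

Lemma clamp_in m M x : m <= M -> m <= clamp m M x <= M.
Proof.
by move=> mM; rewrite /clamp le_max lexx ge_max mM ge_min lexx.
Qed.

Lemma clamp_id m M x : m <= x <= M -> clamp m M x = x.
Proof.
by case/andP=> mx xM; rewrite /clamp min_r// max_r.
Qed.

Lemma continuous_clamp m M : continuous (clamp m M).
Proof.
move=> x; rewrite /clamp.
apply: (@continuous_max R R (cst m)); first exact: cvg_cst.
by apply: (@continuous_min R R (cst M)); [exact: cvg_cst|exact: cvg_id].
Qed.

Lemma continuous_comp_clamp phi m M : m <= M ->
  (forall x, m <= x <= M -> {for x, continuous phi}) ->
  continuous (phi \o clamp m M).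
Proof.
move=> mM cphi x; apply: continuous_comp; first exact: continuous_clamp.
exact/cphi/clamp_in.
Qed.

Lemma Rintegral_primitive phi F a b : a <= b ->
  (forall x, a <= x <= b -> {for x, continuous phi}) ->
  (forall x, a <= x <= b -> is_derive x 1 F (phi x)) ->
  \int[lebesgue_measure]_(t in `[a, b]) phi t = F b - F a.
Proof.
rewrite le_eqVlt => /predU1P[<- _ _|ab cphi dF].
  by rewrite set_itv1 Rintegral_set1 subrr.
rewrite /Rintegral (@continuous_FTC2 _ phi F) //.
- apply/continuous_in_subspaceT => x /set_mem /=.
  by rewrite in_itv/= => xab; apply: cphi.
- have cF x : a <= x <= b -> {for x, continuous F}.
    move=> /dF dFx; apply/differentiable_continuous/derivable1_diffP.
    exact: ex_derive.
  split.
  + move=> x /[!in_itv]/= /andP[xa xb].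
    have dx : is_derive x 1 F (phi x) by apply: dF; rewrite !ltW.
    exact: ex_derive.
  + apply: cvg_at_right_filter; apply: cF; lra.
  + apply: cvg_at_left_filter; apply: cF; lra.
- move=> x /[!in_itv]/= /andP[xa xb].
  have dx : is_derive x 1 F (phi x) by apply: dF; rewrite !ltW.
  by rewrite derive1E; apply: derive_val.
Qed.

Lemma oint_ftc phi F a b :
  (forall x, between a b x -> {for x, continuous phi}) ->
  (forall x, between a b x -> is_derive x 1 F (phi x)) ->
  oint phi a b = F b - F a.
Proof.
rewrite /oint /between; case: (ltgtP a b) => [ab|ba|->] cphi dF.
- rewrite (@Rintegral_primitive phi F a b (ltW ab) cphi dF).
  by rewrite set_itv_ge -?leNgt ?bnd_simp// Rintegral_set0 subr0.
- rewrite (@Rintegral_primitive phi F b a (ltW ba) cphi dF).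
  by rewrite set_itv_ge -?leNgt ?bnd_simp// Rintegral_set0 sub0r opprB.
- by rewrite !subrr.
Qed.

(** Extending by constants makes the primitive two-sidedly differentiable at
    the end points of the segment, so that no one-sided derivative is needed
    afterwards. *)
Lemma primitive_exists phi m M : m <= M ->
  (forall x, m <= x <= M -> {for x, continuous phi}) ->
  exists F, forall x, m <= x <= M -> is_derive x 1 F (phi x).
Proof.
move=> mM cphi; pose psi := phi \o clamp m M.
have cpsi : continuous psi by exact: continuous_comp_clamp.
exists (fun x => \int[lebesgue_measure]_(t in `[m - 1, x]) psi t).
move=> x /andP[mx xM].
have [||||dF F'] := @continuous_FTC1_closed R psi (m - 1) x (M + 1).
- lra.
- apply: continuous_compact_integrable; first exact: segment_compact.
  exact: continuous_subspaceT.
- lra.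
- exact: cpsi.
have -> : phi x = psi x by rewrite /psi /= clamp_id// mx.
by rewrite derive1E in F'; exact: DeriveDef dF F'.
Qed.

Lemma oint_primitive phi m M : m <= M ->
  (forall x, m <= x <= M -> {for x, continuous phi}) ->
  exists F, (forall x, m <= x <= M -> is_derive x 1 F (phi x)) /\
    forall a b, m <= a <= M -> m <= b <= M -> oint phi a b = F b - F a.
Proof.
move=> mM cphi; have [F dF] := primitive_exists mM cphi.
exists F; split => // a b am bm; apply: oint_ftc => x /(between_sub am bm) ?.
  exact: cphi.
exact: dF.
Qed.

Lemma ointaa phi a : oint phi a a = 0.
Proof. by rewrite /oint subrr. Qed.

Lemma ointC phi a b : oint phi a b = - oint phi b a.
Proof. by rewrite /oint opprB. Qed.

Lemma oint01 phi :
  \int[lebesgue_measure]_(t in `[0, 1]) phi t = oint phi 0 1.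
Proof.
rewrite /oint [X in _ - X](_ : _ = 0) ?subr0//.
by rewrite set_itv_ge -?leNgt ?bnd_simp// Rintegral_set0.
Qed.

Lemma eq_oint phi psi a b : (forall x, between a b x -> phi x = psi x) ->
  oint phi a b = oint psi a b.
Proof.
move=> e; rewrite /oint; congr (_ - _); apply: eq_Rintegral => x;
  rewrite inE/= in_itv/= => xab; apply: e; apply/betweenP; tauto.
Qed.

Lemma oint_chasles phi m M b a c : m <= M ->
  (forall x, m <= x <= M -> {for x, continuous phi}) ->
  m <= a <= M -> m <= b <= M -> m <= c <= M ->
  oint phi a b + oint phi b c = oint phi a c.
Proof.
move=> mM cphi ha hb hc; have [F [_ FE]] := oint_primitive mM cphi.
by rewrite !FE//; lra.
Qed.

Lemma oint_mean phi a b :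
  (forall x, between a b x -> {for x, continuous phi}) ->
  exists2 x, between a b x & oint phi a b = phi x * (b - a).
Proof.
rewrite /between; wlog: a b / a <= b => [wl|ab].
  case: (leP a b) => ab cphi.
    have := wl a b ab; rewrite min_l// max_r//; exact.
  have := wl b a (ltW ab); rewrite min_l ?ltW// max_r ?ltW//.
  move=> /(_ cphi)[x xab e].
  by exists x => //; rewrite ointC e -mulrN opprB.
rewrite min_l// max_r// => cphi; have [F [dF FE]] := oint_primitive ab cphi.
rewrite FE ?lexx ?ab//.
have [||x xab e] := @MVT_segment R F phi a b ab.
- move=> x /[!in_itv]/= /andP[? ?]; apply: dF; lra.
- apply/continuous_in_subspaceT => x /set_mem /=; rewrite in_itv/= => xab.
  apply/differentiable_continuous/derivable1_diffP.
  have ? := dF x xab; exact: ex_derive.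
by exists x => //; rewrite in_itv/= in xab.
Qed.

Lemma oint_lin phi psi k a b :
  (forall x, between a b x -> {for x, continuous phi}) ->
  (forall x, between a b x -> {for x, continuous psi}) ->
  oint (fun x => phi x + k * psi x) a b = oint phi a b + k * oint psi a b.
Proof.
move=> c1 c2; have ab : Num.min a b <= Num.max a b by case: (leP a b); lra.
have [F [dF FE]] := oint_primitive ab c1.
have [G [dG GE]] := oint_primitive ab c2.
rewrite (FE a b (betweenl a b) (betweenr a b)) (GE a b (betweenl a b) (betweenr a b)).
apply: etrans (@oint_ftc _ (fun x => F x + k * G x) _ _ _ _) _ => [x xab|x xab|].
- apply: continuousD; first exact: c1.
  by apply: continuousM; [exact: cvg_cst|exact: c2].
- have ? := dF x xab; have ? := dG x xab.
  by apply: is_deriveD; apply: is_deriveZ.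
- by ring.
Qed.

Lemma ointD phi psi a b :
  (forall x, between a b x -> {for x, continuous phi}) ->
  (forall x, between a b x -> {for x, continuous psi}) ->
  oint (fun x => phi x + psi x) a b = oint phi a b + oint psi a b.
Proof.
move=> c1 c2; rewrite -[oint psi a b]mul1r -oint_lin//.
by apply: eq_oint => x _; rewrite mul1r.
Qed.

Lemma ointB phi psi a b :
  (forall x, between a b x -> {for x, continuous phi}) ->
  (forall x, between a b x -> {for x, continuous psi}) ->
  oint (fun x => phi x - psi x) a b = oint phi a b - oint psi a b.
Proof.
move=> c1 c2; rewrite -[oint psi a b]mul1r -mulNr -oint_lin//.
by apply: eq_oint => x _; rewrite mulN1r.
Qed.

Lemma ointZ phi k a b :
  (forall x, between a b x -> {for x, continuous phi}) ->
  oint (fun x => k * phi x) a b = k * oint phi a b.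
Proof.
move=> c1; transitivity (oint phi a b + (k - 1) * oint phi a b); last by ring.
by rewrite -oint_lin//; apply: eq_oint => x _; ring.
Qed.

End OrientedIntegral.

(** * Closed one-forms in the plane *)

Section ClosedForms.
Context {R : realType}.
Implicit Types (P Q D : R * R -> R) (O : set (R * R)) (p q z : R * R).

Lemma is_derive_eps (g : R -> R) t l :
  (forall e : R, 0 < e ->
     \forall h \near (0:R), `|g (t + h) - g t - l * h| <= e * `|h|) ->
  is_derive t 1 g l.
Proof.
move=> H.
have C : (fun h : R => h^-1 *: ((g \o shift t) (h *: 1) - g t)) @ 0^' --> l.
  apply/cvgrPdist_le => e e0; near=> h.
  have h0 : h != 0 by near: h; exact: nbhs_dnbhs_neq.
  have : `|g (t + h) - g t - l * h| <= e * `|h|.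
    by near: h; apply: nbhs_dnbhs; exact: H.
  rewrite /= [h *: 1]mulr1 [h + t]addrC /GRing.scale/= => Hh.
  rewrite -(@ler_pM2r _ `|h|) ?normr_gt0// -normrM -normrN.
  by apply: le_trans Hh; rewrite le_eqVlt; apply/orP; left; apply/eqP;
    congr (`|_|); field.
have dg : derivable g t 1 by apply/cvg_ex; exists l.
by apply: (DeriveDef dg); apply/cvg_lim.
Unshelve. all: by end_near. Qed.

Definition box z (r : R) : set (R * R) :=
  [set q | `|q.1 - z.1| < r /\ `|q.2 - z.2| < r].

Lemma box_nbhs z r : 0 < r -> nbhs z (box z r).
Proof.
move=> r0; apply/nbhs_ballP; exists r => //= q [].
by rewrite /ball/= => ? ?; split; rewrite distrC.
Qed.

Lemma nbhs_box z (A : set (R * R)) : nbhs z A ->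
  exists2 r, 0 < r & box z r `<=` A.
Proof.
move=> /nbhs_ballP[r /= r0 H]; exists r => // q [q1 q2]; apply: H.
by split; rewrite /ball/= distrC.
Qed.

(** Continuity together with the vanishing of the integrals along the
    boundaries of rectangles is the form in which closedness is used; for C^1
    forms it is Green's formula. *)
Definition closed_form O P Q : Prop :=
  [/\ forall z, O z -> {for z, continuous P},
      forall z, O z -> {for z, continuous Q} &
      forall p q, (forall x y, between p.1 q.1 x -> between p.2 q.2 y -> O (x, y)) ->
        oint (fun u => P (u, p.2)) p.1 q.1 + oint (fun v => Q (q.1, v)) p.2 q.2 =
        oint (fun v => Q (p.1, v)) p.2 q.2 + oint (fun u => P (u, q.2)) p.1 q.1].

Lemma continuous_horizontal P (x y : R) : {for (x, y), continuous P} ->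
  {for x, continuous (fun u => P (u, y))}.
Proof.
move=> cP; apply: (@continuous_comp _ _ _ (fun u => (u, y)) P) => //.
exact: (cvg_pair cvg_id (cvg_cst y)).
Qed.

Lemma continuous_vertical Q (x y : R) : {for (x, y), continuous Q} ->
  {for y, continuous (fun v => Q (x, v))}.
Proof.
move=> cP; apply: (@continuous_comp _ _ _ (fun u => (x, u)) Q) => //.
exact: (cvg_pair (cvg_cst x) cvg_id).
Qed.

Lemma eps_continuous P z : {for z, continuous P} -> forall e : R, 0 < e ->
  exists2 r, 0 < r & forall q, box z r q -> `|P q - P z| < e.
Proof.
move=> /cvgrPdist_lt cP e /cP/nbhs_box[r r0 H]; exists r => // q /H /=.
by rewrite distrC.
Qed.

(** A derivative under the integral sign: a continuous y-derivative is
    uniformly continuous in the other variable, which ranges over a segment. *)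
Lemma derive_oint_param O P D a b (y : R) : open O ->
  (forall x, between a b x -> O (x, y)) ->
  (forall z, O z -> {for z, continuous P}) ->
  (forall z, O z -> {for z, continuous D}) ->
  (forall z, O z -> is_derive z.2 1 (fun v => P (z.1, v)) (D z)) ->
  is_derive y 1 (fun v => oint (fun u => P (u, v)) a b)
    (oint (fun u => D (u, y)) a b).
Proof.
move=> oO abO cP cD dP; apply: is_derive_eps => e e0.
pose e' := e / (`|b - a| + 1).
have ba0 : 0 < `|b - a| + 1 by have := normr_ge0 (b - a); lra.
have e'0 : 0 < e' by rewrite divr_gt0.
have : \forall h \near (0:R), `[Num.min a b, Num.max a b] `<=`
    (fun u => forall v, between y (y + h) v -> O (u, v) /\
       `|D (u, v) - D (u, y)| < e').
  have /compact_near_coveringP cov := @segment_compact R (Num.min a b) (Num.max a b).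
  apply: (cov R (nbhs (0:R)) (fun h u => forall v, between y (y + h) v ->
    O (u, v) /\ `|D (u, v) - D (u, y)| < e')) => u0 /=.
  rewrite in_itv/= => uab.
  have Ou0 := abO u0 uab.
  have [r1 r10 H1] := nbhs_box (open_nbhs_nbhs (conj oO Ou0)).
  have [r2 r20 H2] := eps_continuous (cD _ Ou0) (divr_gt0 e'0 (ltr0Sn _ 1)).
  pose r := Num.min r1 r2.
  have r0 : 0 < r by rewrite lt_min r10 r20.
  exists (ball u0 r, ball (0:R) r); first by split; exact: nbhsx_ballx.
  case=> u h /=; rewrite /ball/= sub0r normrN lt_min lt_min.
  move=> [/andP[ur1 ur2] /andP[hr1 hr2]] v vy.
  have vy' : `|v - y| <= `|h|.
    by move: vy => /betweenP[] /andP[];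
      case: (ger0P h) => ?; case: (ger0P (v - y)); lra.
  have B1 : box (u0, y) r1 (u, v).
    by split; rewrite /= ?[`|u - _|]distrC// (le_lt_trans vy').
  have B2 : box (u0, y) r2 (u, v).
    by split; rewrite /= ?[`|u - _|]distrC// (le_lt_trans vy').
  have B3 : box (u0, y) r2 (u, y).
    by split; rewrite /= ?[`|u - _|]distrC// subrr normr0.
  split; first exact: H1.
  have := H2 _ B2; have := H2 _ B3.
  have -> : D (u, v) - D (u, y) =
    (D (u, v) - D (u0, y)) - (D (u, y) - D (u0, y)) by ring.
  move=> A1 A2; apply: le_lt_trans (ler_normB _ _) _; lra.
apply: filterS => h Hh.
have bet v : between y (y + h) v -> forall u, between a b u ->
    O (u, v) /\ `|D (u, v) - D (u, y)| < e'.
  by move=> vy u uab; apply: Hh => //=; rewrite in_itv.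
have step u : between a b u -> exists2 v, between y (y + h) v &
    P (u, y + h) - P (u, y) = D (u, v) * h.
  move=> uab.
  have E : oint (fun v => D (u, v)) y (y + h) = P (u, y + h) - P (u, y).
    apply: (@oint_ftc _ _ (fun v => P (u, v))) => v vy.
      by apply: continuous_vertical; apply: cD; case: (bet _ vy _ uab).
    by have [Ouv _] := bet _ vy _ uab; exact: (dP (u, v)).
  have [v vy Ev] := @oint_mean _ (fun v => D (u, v)) y (y + h) (fun v vy =>
     continuous_vertical (cD _ (proj1 (bet _ vy _ uab)))).
  by exists v => //; rewrite -E Ev addrAC subrr add0r.
have c1 u : between a b u -> {for u, continuous (fun u => P (u, y + h))}.
  move=> uab; apply: continuous_horizontal; apply: cP.
  by case: (bet (y + h) (betweenr _ _) _ uab).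
have c2 u : between a b u -> {for u, continuous (fun u => P (u, y))}.
  by move=> uab; apply: continuous_horizontal; apply: cP; exact: abO.
have c3 u : between a b u -> {for u, continuous (fun u => D (u, y))}.
  by move=> uab; apply: continuous_horizontal; apply: cD; exact: abO.
have c3h u : between a b u -> {for u, continuous (fun u => h * D (u, y))}.
  by move=> uab; apply: continuousM; [exact: cvg_cst|exact: c3].
have c12 u : between a b u -> {for u, continuous (fun u => P (u, y + h) - P (u, y))}.
  by move=> uab; apply: continuousB; [exact: c1|exact: c2].
have c123 u : between a b u ->
    {for u, continuous (fun u => P (u, y + h) - P (u, y) - h * D (u, y))}.
  by move=> uab; apply: continuousB; [exact: c12|exact: c3h].
have -> : oint (fun u => P (u, y + h)) a b - oint (fun u => P (u, y)) a b
   - oint (fun u => D (u, y)) a b * h =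
   oint (fun u => P (u, y + h) - P (u, y) - h * D (u, y)) a b.
  by rewrite ointB// ointB// ointZ// [_ * h]mulrC.
have [u uab ->] := oint_mean c123.
have [v vy Ev] := step u uab.
rewrite Ev [h * _]mulrC -mulrBl mulrAC -mulrA !normrM mulrA.
apply: ler_wpM2r => //.
have [_ /ltW le'] := bet v vy u uab.
apply: le_trans (ler_wpM2r (normr_ge0 _) le') _.
rewrite /e' -mulrA ger_pMr// mulrC ler_pdivrMr// mul1r.
lra.
Qed.

(** The derivative in y of the integral of P along the side at height y is the
    integral of D, that is the difference of Q at the two other sides. *)
Lemma green O P Q D : open O ->
  (forall z, O z -> {for z, continuous P}) ->
  (forall z, O z -> {for z, continuous Q}) ->
  (forall z, O z -> {for z, continuous D}) ->
  (forall z, O z -> is_derive z.2 1 (fun v => P (z.1, v)) (D z)) ->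
  (forall z, O z -> is_derive z.1 1 (fun u => Q (u, z.2)) (D z)) ->
  closed_form O P Q.
Proof.
move=> oO cP cQ cD dP dQ; split => // -[x0 y0] [x1 y1] /= HO.
have Ey y : between y0 y1 y ->
    oint (fun u => D (u, y)) x0 x1 = Q (x1, y) - Q (x0, y).
  move=> yb; apply: (@oint_ftc _ _ (fun u => Q (u, y))) => u ub.
    by apply/continuous_horizontal/cD/HO.
  by apply: (dQ (u, y)); exact: HO.
have cv x y : between x0 x1 x -> between y0 y1 y ->
    {for y, continuous (fun v => Q (x, v))}.
  by move=> xb yb; apply/continuous_vertical/cQ/HO.
have c1 y : between y0 y1 y -> {for y, continuous (fun v => Q (x1, v))}.
  by apply: cv; exact: betweenr.
have c0 y : between y0 y1 y -> {for y, continuous (fun v => Q (x0, v))}.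
  by apply: cv; exact: betweenl.
have := @oint_ftc _ (fun y => Q (x1, y) - Q (x0, y))
   (fun v => oint (fun u => P (u, v)) x0 x1) y0 y1 _ _.
rewrite ointB// => E.
suff : oint (fun v => Q (x1, v)) y0 y1 - oint (fun v => Q (x0, v)) y0 y1 =
    oint (fun u => P (u, y1)) x0 x1 - oint (fun u => P (u, y0)) x0 x1 by lra.
apply: E => y yb; first by apply: continuousB; [exact: c1|exact: c0].
by rewrite -Ey//; apply: (derive_oint_param oO) => // x xb; exact: HO.
Qed.

End ClosedForms.

(** * Integrals along arcs *)

Section ArcIntegrals.
Context {R : realType}.
Implicit Types (P Q D : R * R -> R) (O : set (R * R)) (p q z : R * R).
Implicit Types (c : R -> R * R).

(** The integral of P dx + Q dy along the path from p to q that is first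
    horizontal, then vertical. *)
Definition lpath P Q p q : R :=
  oint (fun u => P (u, p.2)) p.1 q.1 + oint (fun v => Q (q.1, v)) p.2 q.2.

Definition arcint P Q c (a b : R) : R :=
  oint (fun t => P (c t) * (derive1 c t).1 + Q (c t) * (derive1 c t).2) a b.

Lemma between_dist (a b x z r : R) :
  `|a - z| < r -> `|b - z| < r -> between a b x -> `|x - z| < r.
Proof.
rewrite !ltr_norml => /andP[? ?] /andP[? ?] /betweenP[] /andP[? ?];
  apply/andP; split; lra.
Qed.

Lemma box_convex z (r : R) p q (x y : R) : box z r p -> box z r q ->
  between p.1 q.1 x -> between p.2 q.2 y -> box z r (x, y).
Proof.
by move=> [p1 p2] [q1 q2] bx by_; split => /=;
  [exact: between_dist bx|exact: between_dist by_].
Qed.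

Lemma box_center z (r : R) : 0 < r -> box z r z.
Proof. by move=> r0; split; rewrite subrr normr0. Qed.

(** The paths differ by the boundary of a rectangle inside the box. *)
Lemma lpath_add O P Q z (r : R) p q s : closed_form O P Q -> box z r `<=` O ->
  box z r p -> box z r q -> box z r s ->
  lpath P Q p q + lpath P Q q s = lpath P Q p s.
Proof.
move=> [cP cQ rect] BO Bp Bq Bs; rewrite /lpath.
have B x y : `|x - z.1| < r -> `|y - z.2| < r -> O (x, y).
  by move=> ? ?; apply: BO.
have /= := rect q (s.1, p.2) _.
rewrite [oint (fun v => Q (s.1, v)) q.2 p.2]ointC.
rewrite [oint (fun v => Q (q.1, v)) q.2 p.2]ointC.
move=> E.
have {}E : oint (fun v => Q (q.1, v)) p.2 q.2 + oint (fun u => P (u, q.2)) q.1 s.1 =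
  oint (fun u => P (u, p.2)) q.1 s.1 + oint (fun v => Q (s.1, v)) p.2 q.2.
  suff : forall x y, between q.1 s.1 x -> between q.2 p.2 y -> O (x, y).
    by move=> /E; lra.
  move=> x y bx by_; apply/BO/(box_convex Bq (q := (s.1, p.2))) => //.
  by case: Bp Bs => _ ? [].
have chas phi a b d w : `|a - w| < r -> `|b - w| < r -> `|d - w| < r ->
   (forall x, `|x - w| < r -> {for x, continuous phi}) ->
   oint phi a b + oint phi b d = oint phi a d :> R.
  move=> aw bw dw cphi.
  pose m := Num.min a (Num.min b d); pose M := Num.max a (Num.max b d).
  have [am bm dm] : [/\ m <= a <= M, m <= b <= M & m <= d <= M].
    by rewrite /m /M !ge_min !le_max !lexx !orbT.
  apply: (@oint_chasles _ _ m M) => //; first by lra.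
  move=> x /andP[mx xM]; apply: cphi; move: mx xM.
  rewrite /m /M !ge_min !le_max; move: aw bw dw; rewrite !ltr_norml.
  by move=> /andP[? ?] /andP[? ?] /andP[? ?] /or3P[] ? /or3P[] ?;
     apply/andP; split; lra.
have -> : oint (fun u => P (u, p.2)) p.1 s.1 =
    oint (fun u => P (u, p.2)) p.1 q.1 + oint (fun u => P (u, p.2)) q.1 s.1.
  rewrite (chas _ _ _ _ z.1)//; try by case: Bp Bq Bs => [? ?] [? ?] [? ?].
  move=> x xz; apply/continuous_horizontal/cP/B => //; by case: Bp.
have -> : oint (fun u => Q (s.1, u)) p.2 s.2 =
    oint (fun u => Q (s.1, u)) p.2 q.2 + oint (fun u => Q (s.1, u)) q.2 s.2.
  rewrite (chas _ _ _ _ z.2)//; try by case: Bp Bq Bs => [? ?] [? ?] [? ?].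
  move=> x xz; apply/continuous_vertical/cQ/B => //; by case: Bs.
move: E; lra.
Qed.

Lemma lpath_pp P Q p : lpath P Q p p = 0.
Proof. by rewrite /lpath !ointaa addr0. Qed.

Lemma lpath_mean O P Q z (r : R) p q : closed_form O P Q -> box z r `<=` O ->
  box z r p -> box z r q ->
  exists x y, [/\ between p.1 q.1 x, between p.2 q.2 y &
    lpath P Q p q = P (x, p.2) * (q.1 - p.1) + Q (q.1, y) * (q.2 - p.2)].
Proof.
move=> [cP cQ _] BO Bp Bq.
have [|x bx Ex] := @oint_mean _ (fun u => P (u, p.2)) p.1 q.1.
  move=> x bx; apply/continuous_horizontal/cP/BO/(box_convex Bp Bq) => //.
  exact: betweenl.
have [|y by_ Ey] := @oint_mean _ (fun u => Q (q.1, u)) p.2 q.2.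
  move=> y by_; apply/continuous_vertical/cQ/BO/(box_convex Bp Bq) => //.
  exact: betweenr.
by exists x, y; split=> //; rewrite /lpath Ex Ey.
Qed.

Lemma is_derive_cvg (f : R -> R) (t l : R) : is_derive t 1 f l ->
  h^-1 * (f (t + h) - f t) @[h --> 0^'] --> l.
Proof.
case=> df <-; have : (fun h => h^-1 *: ((f \o shift t) (h *: 1) - f t)) @ 0^'
  --> 'D_1 f t by exact: df.
apply: cvg_trans; apply: near_eq_cvg; near=> h.
by rewrite /= [h *: 1]mulr1 [h + t]addrC.
Unshelve. all: by end_near. Qed.

Lemma cvg_fst_comp {T : Type} {F : set_system T} {FF : Filter F}
  (f : T -> R * R) (l : R * R) : f @ F --> l -> (f t).1 @[t --> F] --> l.1.
Proof.
move=> fl; apply: (@cvg_comp _ _ _ f fst F (nbhs l)) => //; exact: cvg_fst.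
Qed.

Lemma cvg_snd_comp {T : Type} {F : set_system T} {FF : Filter F}
  (f : T -> R * R) (l : R * R) : f @ F --> l -> (f t).2 @[t --> F] --> l.2.
Proof.
move=> fl; apply: (@cvg_comp _ _ _ f snd F (nbhs l)) => //; exact: cvg_snd.
Qed.

Lemma cvg_pair_comp {T : Type} {F : set_system T} {FF : Filter F}
  (f g : T -> R) (l : R * R) : f @ F --> l.1 -> g @ F --> l.2 ->
  (f t, g t) @[t --> F] --> l.
Proof. by case: l => a b /=; exact: cvg_pair. Qed.

Lemma is_derive_fst c t : derivable c t 1 ->
  is_derive t 1 (fun s => (c s).1) (derive1 c t).1.
Proof.
move=> dc; have C : (fun h => h^-1 *: ((c \o shift t) (h *: 1) - c t)) @ 0^'
    --> derive1 c t by rewrite derive1E; exact: dc.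
have {}C := cvg_fst_comp C; have {}C := C _.
have d : derivable (fun s => (c s).1) t 1 by apply/cvg_ex; exists (derive1 c t).1; exact: C.
apply: (DeriveDef d); apply: cvg_lim; [exact: norm_hausdorff|exact: C].
Qed.

Lemma is_derive_snd c t : derivable c t 1 ->
  is_derive t 1 (fun s => (c s).2) (derive1 c t).2.
Proof.
move=> dc; have C : (fun h => h^-1 *: ((c \o shift t) (h *: 1) - c t)) @ 0^'
    --> derive1 c t by rewrite derive1E; exact: dc.
have {}C := cvg_snd_comp C; have {}C := C _.
have d : derivable (fun s => (c s).2) t 1 by apply/cvg_ex; exists (derive1 c t).2; exact: C.
apply: (DeriveDef d); apply: cvg_lim; [exact: norm_hausdorff|exact: C].
Qed.

Lemma C1_arc_continuous c : C1_arc c -> continuous c.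
Proof.
move=> [dc _] t; apply/differentiable_continuous/derivable1_diffP.
exact: dc.
Qed.

Lemma arc_integrand_continuous O P Q c t :
  closed_form O P Q -> C1_arc c -> O (c t) ->
  {for t, continuous
     (fun t => P (c t) * (derive1 c t).1 + Q (c t) * (derive1 c t).2)}.
Proof.
move=> [cP cQ _] cc Oct; have cct := C1_arc_continuous cc (x := t).
have [_ /(_ t) cdc] := cc.
apply: continuousD; apply: continuousM.
- by apply: continuous_comp => //; exact: cP.
- exact: (cvg_fst_comp (cdc : _ --> derive1 c t)).
- by apply: continuous_comp => //; exact: cQ.
- exact: (cvg_snd_comp (cdc : _ --> derive1 c t)).
Qed.

Lemma cvg_between {T : Type} {F : set_system T} {FF : Filter F} (f g : T -> R) l :
  f @ F --> l -> (forall t, between l (f t) (g t)) -> g @ F --> l.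
Proof.
move=> /cvgrPdist_lt fl bg; apply/cvgrPdist_lt => e /fl; apply: filterS => t.
rewrite !ltr_norml => /andP[? ?]; have /betweenP[] := bg t; move=> /andP[? ?];
  apply/andP; split; lra.
Qed.

(** A closed form has a primitive on a box, so that inside the box an arc may
    be replaced by an axis-parallel path. *)
Lemma arcint_lpath O P Q z (r : R) c (a b : R) : closed_form O P Q ->
  box z r `<=` O -> C1_arc c ->
  (forall t, between a b t -> box z r (c t)) ->
  arcint P Q c a b = lpath P Q (c a) (c b).
Proof.
move=> cf BO cc Bc.
have Ba : box z r (c a) by apply: Bc; exact: betweenl.
rewrite -[RHS]subr0 -(lpath_pp P Q (c a)).
apply: (@oint_ftc _ _ (fun t => lpath P Q (c a) (c t))) => t tab.
  by apply: (arc_integrand_continuous cf) => //; apply/BO/Bc.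
have [cP cQ _] := cf; have Bt := Bc _ tab.
have cct := C1_arc_continuous cc (x := t).
have nB : \forall h \near 0^', box z r (c (t + h)).
  pose d1 := r - `|(c t).1 - z.1|; pose d2 := r - `|(c t).2 - z.2|.
  have d0 : 0 < Num.min d1 d2 by rewrite lt_min !subr_gt0; case: Bt => -> ->.
  have : \forall h \near 0^', box (c t) (Num.min d1 d2) (c (t + h)).
    apply: nbhs_dnbhs.
    have cth : {for (0:R), continuous (fun h => c (t + h))}.
      apply: continuous_comp; last by rewrite addr0.
      by apply: continuousD; [exact: cvg_cst|exact: cvg_id].
    have := cth _ (box_nbhs _ d0) => /=.
    by rewrite addr0.
  apply: filterS => h [/= h1 h2]; move: h1 h2.
  rewrite !lt_min => /andP[h1 _] /andP[_ h2]; split.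
    have -> : (c (t + h)).1 - z.1 = ((c (t + h)).1 - (c t).1) + ((c t).1 - z.1)
      by ring.
    rewrite (le_lt_trans (ler_normD _ _))//; rewrite /d1 in h1; lra.
  have -> : (c (t + h)).2 - z.2 = ((c (t + h)).2 - (c t).2) + ((c t).2 - z.2)
    by ring.
  rewrite (le_lt_trans (ler_normD _ _))//; rewrite /d2 in h2; lra.
(* the mean value theorem on both sides of the path from c t to c (t + h) *)
have : forall h, exists xy : R * R,
   [/\ between (c t).1 (c (t + h)).1 xy.1, between (c t).2 (c (t + h)).2 xy.2 &
     box z r (c (t + h)) ->
     lpath P Q (c a) (c (t + h)) - lpath P Q (c a) (c t) =
     P (xy.1, (c t).2) * ((c (t + h)).1 - (c t).1) +
     Q ((c (t + h)).1, xy.2) * ((c (t + h)).2 - (c t).2)].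
  move=> h; have [Bth|nBth] := pselect (box z r (c (t + h))); last first.
    by exists (c t); split => //; exact: betweenl.
  have [x [y [bx by_ E]]] := lpath_mean cf BO Bt Bth.
  exists (x, y); split => // _.
  by rewrite -E -(lpath_add cf BO Ba Bt Bth) addrAC subrr add0r.
move=> /choice[xy xyP].
have cct0 : c (t + h) @[h --> 0^'] --> c t.
  have cth : {for (0:R), continuous (fun h => c (t + h))}.
    apply: continuous_comp; last by rewrite addr0.
    by apply: continuousD; [exact: cvg_cst|exact: cvg_id].
  rewrite /prop_for /continuous_at addr0 in cth.
  by apply: cvg_trans cth; apply: cvg_app; exact: nbhs_dnbhs.
have c1 : (c (t + h)).1 @[h --> 0^'] --> (c t).1.
  exact: cvg_fst_comp cct0.
have c2 : (c (t + h)).2 @[h --> 0^'] --> (c t).2.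
  exact: cvg_snd_comp cct0.
have x1 : (xy h).1 @[h --> 0^'] --> (c t).1.
  by apply: cvg_between c1 _ => h; case: (xyP h).
have x2 : (xy h).2 @[h --> 0^'] --> (c t).2.
  by apply: cvg_between c2 _ => h; case: (xyP h).
have Oct : O (c t) by exact: BO.
have P1 : P ((xy h).1, (c t).2) @[h --> 0^'] --> P (c t).
  apply: (@cvg_comp _ _ _ (fun h => ((xy h).1, (c t).2)) P); last exact: cP Oct.
  exact: cvg_pair_comp x1 (cvg_cst _).
have Q1 : Q ((c (t + h)).1, (xy h).2) @[h --> 0^'] --> Q (c t).
  apply: (@cvg_comp _ _ _ (fun h => ((c (t + h)).1, (xy h).2)) Q);
    last exact: cQ Oct.
  exact: cvg_pair_comp c1 x2.
have [dc _] := cc.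
have d1 := is_derive_fst (dc t); have d2 := is_derive_snd (dc t).
have D1 : h^-1 * ((c (t + h)).1 - (c t).1) @[h --> 0^'] --> (derive1 c t).1.
  exact: is_derive_cvg d1.
have D2 : h^-1 * ((c (t + h)).2 - (c t).2) @[h --> 0^'] --> (derive1 c t).2.
  exact: is_derive_cvg d2.
have C : h^-1 *: (((fun t => lpath P Q (c a) (c t)) \o shift t) (h *: 1)
     - lpath P Q (c a) (c t)) @[h --> 0^'] -->
     P (c t) * (derive1 c t).1 + Q (c t) * (derive1 c t).2.
  apply: cvg_trans (cvgD (cvgM P1 D1) (cvgM Q1 D2)); apply: near_eq_cvg.
  apply: filterS nB => h Bth; rewrite /= [h *: 1]mulr1 [h + t]addrC.
  have [_ _ ->//] := xyP h; rewrite /GRing.scale/=.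
  transitivity (P ((xy h).1, (c t).2) * (h^-1 * ((c (t + h)).1 - (c t).1)) +
    Q ((c (t + h)).1, (xy h).2) * (h^-1 * ((c (t + h)).2 - (c t).2))) => //.
  by ring.
have d : derivable (fun t => lpath P Q (c a) (c t)) t 1.
  by apply/cvg_ex; eexists; exact: C.
by apply: (DeriveDef d); exact: (cvg_lim (@norm_hausdorff _ _) C).
Qed.

Lemma arcint_chasles O P Q c (m M a b d : R) : closed_form O P Q -> C1_arc c ->
  m <= M -> (forall t, m <= t <= M -> O (c t)) ->
  m <= a <= M -> m <= b <= M -> m <= d <= M ->
  arcint P Q c a b + arcint P Q c b d = arcint P Q c a d.
Proof.
move=> cf cc mM Oc; apply: oint_chasles mM _ => t /Oc.
exact: arc_integrand_continuous.
Qed.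

End ArcIntegrals.

(** * Winding numbers *)

Section Angle.
Context {R : realType}.
Implicit Types (f g : R -> R) (p q z : R * R) (c : R -> R * R).

Lemma is_derive_add f g (x df dg : R) : is_derive x 1 f df ->
  is_derive x 1 g dg -> is_derive x 1 (fun t => f t + g t) (df + dg).
Proof. by move=> ? ?; exact: is_deriveD. Qed.

Lemma is_derive_sub f g (x df dg : R) : is_derive x 1 f df ->
  is_derive x 1 g dg -> is_derive x 1 (fun t => f t - g t) (df - dg).
Proof. by move=> ? ?; exact: is_deriveB. Qed.

Lemma is_derive_mul f g (x df dg : R) : is_derive x 1 f df ->
  is_derive x 1 g dg -> is_derive x 1 (fun t => f t * g t) (df * g x + f x * dg).
Proof.
move=> d1 d2; apply: is_derive_eq (is_deriveM d1 d2) _.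
by rewrite /GRing.scale/= addrC [df * _]mulrC.
Qed.

Lemma is_derive_div f g (x df dg : R) : is_derive x 1 f df ->
  is_derive x 1 g dg -> g x != 0 ->
  is_derive x 1 (fun t => f t / g t) ((df * g x - f x * dg) / g x ^+ 2).
Proof.
move=> d1 d2 g0; have d3 := is_deriveV g0 d2.
apply: is_derive_eq (is_derive_mul d1 d3) _.
by rewrite /GRing.scale/=; field.
Qed.

(** The components of the angular form around p, whose integral along a
    closed curve is 2 pi times the winding number around p. *)
Definition theta_x p z := - (z.2 - p.2) / ((z.1 - p.1) ^+ 2 + (z.2 - p.2) ^+ 2).
Definition theta_y p z := (z.1 - p.1) / ((z.1 - p.1) ^+ 2 + (z.2 - p.2) ^+ 2).

Lemma sqr_dist_gt0 p z : z <> p -> 0 < (z.1 - p.1) ^+ 2 + (z.2 - p.2) ^+ 2.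
Proof.
move=> zp; rewrite lt_def addr_ge0 ?sqr_ge0// andbT paddr_eq0 ?sqr_ge0//.
rewrite !sqrf_eq0 !subr_eq0; apply/negP => /andP[/eqP e1 /eqP e2]; apply: zp.
by rewrite [z]surjective_pairing e1 e2 -surjective_pairing.
Qed.

Lemma open_punctured p : open [set z | z <> p].
Proof.
rewrite (_ : mkset _ = ~` [set p]); last by apply/seteqP; split.
by rewrite openC; apply: accessible_closed_set1; apply: hausdorff_accessible; exact: norm_hausdorff.
Qed.

Lemma continuous_fst_sub p z : {for z, continuous (fun z => z.1 - p.1)}.
Proof. by apply: continuousB; [exact: cvg_fst|exact: cvg_cst]. Qed.

Lemma continuous_snd_sub p z : {for z, continuous (fun z => z.2 - p.2)}.
Proof. by apply: continuousB; [exact: cvg_snd|exact: cvg_cst]. Qed.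

Lemma continuous_sqr_dist p z :
  {for z, continuous (fun z => (z.1 - p.1) ^+ 2 + (z.2 - p.2) ^+ 2)}.
Proof.
apply: continuousD.
  by apply: (@continuousM _ _ (fun z => z.1 - p.1) (fun z => z.1 - p.1));
    exact: continuous_fst_sub.
by apply: (@continuousM _ _ (fun z => z.2 - p.2) (fun z => z.2 - p.2));
    exact: continuous_snd_sub.
Qed.

Lemma closed_theta p : closed_form [set z | z <> p] (theta_x p) (theta_y p).
Proof.
pose rho z := (z.1 - p.1) ^+ 2 + (z.2 - p.2) ^+ 2 : R.
have rho0 z : z <> p -> rho z != 0 by move=> /sqr_dist_gt0/lt0r_neq0.
(* the mixed second derivative of the polar angle around p *)
pose D z := ((z.2 - p.2) ^+ 2 - (z.1 - p.1) ^+ 2) / rho z ^+ 2.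
have crho z : {for z, continuous rho} by exact: continuous_sqr_dist.
have cN z : {for z, continuous (fun z => - (z.2 - p.2))}.
  by apply: continuousN; exact: continuous_snd_sub.
apply: (@green _ _ _ _ D) => [|z zp|z zp|z zp|[x y] /= zp|[x y] /= zp].
- exact: open_punctured.
- by apply: continuousM; [exact: cN|apply: continuousV; [exact: rho0|exact: crho]].
- by apply: continuousM;
    [exact: continuous_fst_sub|apply: continuousV; [exact: rho0|exact: crho]].
- apply: continuousM.
    apply: continuousB.
      by apply: (@continuousM _ _ (fun z => z.2 - p.2) (fun z => z.2 - p.2));
        exact: continuous_snd_sub.
    by apply: (@continuousM _ _ (fun z => z.1 - p.1) (fun z => z.1 - p.1));
      exact: continuous_fst_sub.
  apply: continuousV; first by rewrite expf_neq0// rho0.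
  by apply: (@continuousM _ _ rho rho); exact: crho.
- have d1 : is_derive y 1 (fun v => v - p.2) 1.
    by apply: is_derive_eq (is_derive_sub (is_derive_id _ _) (is_derive_cst _ _ _)) _;
      rewrite subr0.
  have dn : is_derive y 1 (fun v => - (v - p.2)) (- 1) by exact: is_deriveN.
  have dr : is_derive y 1 (fun v => (x - p.1) ^+ 2 + (v - p.2) * (v - p.2))
      (0 + (1 * (y - p.2) + (y - p.2) * 1)).
    exact: is_derive_add (is_derive_cst _ _ _) (is_derive_mul d1 d1).
  have := rho0 _ zp; rewrite /rho/= => r0.
  apply: is_derive_eq (is_derive_div dn dr r0) _.
  by rewrite /D /rho /=; field.
- have d1 : is_derive x 1 (fun v => v - p.1) 1.
    by apply: is_derive_eq (is_derive_sub (is_derive_id _ _) (is_derive_cst _ _ _)) _;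
      rewrite subr0.
  have dr : is_derive x 1 (fun v => (v - p.1) * (v - p.1) + (y - p.2) ^+ 2)
      (1 * (x - p.1) + (x - p.1) * 1 + 0).
    exact: is_derive_add (is_derive_mul d1 d1) (is_derive_cst _ _ _).
  have := rho0 _ zp; rewrite /rho/= => r0.
  apply: is_derive_eq (is_derive_div d1 dr r0) _.
  by rewrite /D /rho /=; field.
Qed.

(** The oriented angle from z - p to z - q, when it is acute. *)
Definition angle p q z : R :=
  atan (((z.1 - p.1) * (z.2 - q.2) - (z.2 - p.2) * (z.1 - q.1)) /
    ((z.1 - p.1) * (z.1 - q.1) + (z.2 - p.2) * (z.2 - q.2))).

(** As long as c t - p and c t - q make an acute angle, the angle between them
    is a primitive of the difference of the two angular forms: no branch of the
    argument has to be chosen. *)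
Lemma theta_difference c p q : C1_arc c ->
  (forall t : R, 0 <= t <= 1 ->
     0 < ((c t).1 - p.1) * ((c t).1 - q.1) + ((c t).2 - p.2) * ((c t).2 - q.2)) ->
  arcint (theta_x q) (theta_y q) c 0 1 - arcint (theta_x p) (theta_y p) c 0 1 =
  angle p q (c 1) - angle p q (c 0).
Proof.
move=> cc acute.
have c01 (x : R) : between 0 1 x -> 0 <= x <= 1.
  by rewrite /between min_l// max_r.
have ne p' t : (forall t, 0 <= t <= 1 ->
     0 < ((c t).1 - p'.1) ^+ 2 + ((c t).2 - p'.2) ^+ 2) -> between 0 1 t -> c t <> p'.
  by move=> H /c01/H + e; rewrite e !subrr expr0n/= addr0 ltxx.
have pos t : 0 <= t <= 1 -> 0 < ((c t).1 - p.1) ^+ 2 + ((c t).2 - p.2) ^+ 2.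
  by move=> /acute; case: (pselect (c t = p)) => [->|/sqr_dist_gt0//];
    rewrite !subrr !mul0r addr0 ltxx.
have pos' t : 0 <= t <= 1 -> 0 < ((c t).1 - q.1) ^+ 2 + ((c t).2 - q.2) ^+ 2.
  by move=> /acute; case: (pselect (c t = q)) => [->|/sqr_dist_gt0//];
    rewrite !subrr !mulr0 addr0 ltxx.
have cq t : between 0 1 t -> {for t, continuous (fun t =>
    theta_x q (c t) * (derive1 c t).1 + theta_y q (c t) * (derive1 c t).2)}.
  by move=> t01; apply: (arc_integrand_continuous (closed_theta q)) => //; exact: ne pos' t01.
have cp t : between 0 1 t -> {for t, continuous (fun t =>
    theta_x p (c t) * (derive1 c t).1 + theta_y p (c t) * (derive1 c t).2)}.
  by move=> t01; apply: (arc_integrand_continuous (closed_theta p)) => //; exact: ne pos t01.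
rewrite /arcint -ointB//.
apply: (@oint_ftc _ _ (fun t => angle p q (c t))) => t t01.
  by apply: continuousB; [exact: cq|exact: cp].
have [dc _] := cc.
have d1 := is_derive_fst (dc t); have d2 := is_derive_snd (dc t).
have s1 a : is_derive t 1 (fun s => (c s).1 - a) (derive1 c t).1.
  by apply: is_derive_eq (is_derive_sub d1 (is_derive_cst _ _ _)) _; rewrite subr0.
have s2 a : is_derive t 1 (fun s => (c s).2 - a) (derive1 c t).2.
  by apply: is_derive_eq (is_derive_sub d2 (is_derive_cst _ _ _)) _; rewrite subr0.
have t01' := c01 _ t01; have A := acute t t01'.
have dX := is_derive_sub (is_derive_mul (s1 p.1) (s2 q.2)) (is_derive_mul (s2 p.2) (s1 q.1)).
have dY := is_derive_add (is_derive_mul (s1 p.1) (s1 q.1)) (is_derive_mul (s2 p.2) (s2 q.2)).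
have dXY := is_derive_div dX dY (lt0r_neq0 A).
apply: is_derive_eq (is_derive1_comp (is_derive1_atan _) dXY) _.
have := lt0r_neq0 A; have := lt0r_neq0 (pos t t01'); have := lt0r_neq0 (pos' t t01').
rewrite /theta_x /theta_y.
move: ((c t).1 - p.1) ((c t).1 - q.1) ((c t).2 - p.2) ((c t).2 - q.2)
  (derive1 c t).1 (derive1 c t).2 => u1 w1 u2 w2 a b W U Y.
have S : (u1 * w1 + u2 * w2) ^+ 2 + (u1 * w2 - u2 * w1) ^+ 2 =
  (u1 ^+ 2 + u2 ^+ 2) * (w1 ^+ 2 + w2 ^+ 2) by ring.
have S0 : (u1 * w1 + u2 * w2) ^+ 2 + (u1 * w2 - u2 * w1) ^+ 2 != 0.
  by rewrite S mulf_neq0.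
have -> : 1 + ((u1 * w2 - u2 * w1) / (u1 * w1 + u2 * w2)) ^+ 2 =
  (u1 ^+ 2 + u2 ^+ 2) * (w1 ^+ 2 + w2 ^+ 2) / (u1 * w1 + u2 * w2) ^+ 2.
  by rewrite -S; field.
rewrite /GRing.scale/=.
by field; rewrite W U Y.
Qed.

Lemma winding_arcint (G : seq (seq (R -> R * R))) p :
  winding G p = (2 * pi)^-1 *
    \sum_(c <- flatten G) arcint (theta_x p) (theta_y p) c 0 1.
Proof.
rewrite /winding; congr (_ * _); apply: eq_bigr => c _.
rewrite oint01; apply: eq_oint => t _; rewrite /theta_x /theta_y.
by ring.
Qed.

End Angle.

(** * The homology form of Cauchy's theorem *)

Section Lattice.
Context {R : realType}.
Implicit Types (P Q : R * R -> R) (O : set (R * R)) (p q z : R * R).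
Implicit Types (c : R -> R * R) (G : seq (R -> R * R)) (E F : nat -> nat -> R).

(** The end points of the arcs cancel with their multiplicities, that is the
    boundary of the chain is 0. In this form the arcs need not be grouped into
    closed curves. *)
Definition closed_chain G := forall g : R * R -> R, \sum_(c <- G) (g (c 1) - g (c 0)) = 0.

Lemma sum_ltn (M m : nat) (X : nat -> R) : (m <= M)%N ->
  \sum_(i < M) (i < m)%:R * X i = \sum_(i < m) X i.
Proof.
move=> mM; rewrite (big_ord_widen M)// [RHS]big_mkcond/=.
by apply: eq_bigr => i _; case: ifP; rewrite ?mul1r ?mul0r.
Qed.

Definition row_sum E m n : R := \sum_(i < m) E i n.
Definition col_sum F m n : R := \sum_(j < n) F m j.

(** Summation by parts for one step from the node (m, n) to the node (m', n'):
    the last bracket telescopes along a closed path of nodes. *)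
Lemma lattice_step (M m n m' n' : nat) E F :
  (m' <= M)%N -> (n <= M)%N -> (n' <= M)%N ->
  \sum_(i < M) \sum_(j < M) (i < m')%:R * ((j < n')%:R - (j < n)%:R) *
     (E i j + F i.+1 j - F i j - E i j.+1) =
  (row_sum E m' n - row_sum E m n) + (col_sum F m' n' - col_sum F m' n)
  - ((row_sum E m' n' + col_sum F 0 n') - (row_sum E m n + col_sum F 0 n)).
Proof.
move=> m'M nM n'M.
have row i : \sum_(j < M) ((j < n')%:R - (j < n)%:R) *
     (E i j + F i.+1 j - F i j - E i j.+1) =
     (E i n - E i n') + ((col_sum F i.+1 n' - col_sum F i n')
         - (col_sum F i.+1 n - col_sum F i n)).
  have part k : (k <= M)%N -> \sum_(j < M) (j < k)%:R *
      (E i j + F i.+1 j - F i j - E i j.+1) =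
      (E i 0%N - E i k) + (col_sum F i.+1 k - col_sum F i k).
    move=> kM; rewrite (sum_ltn (fun j => E i j + F i.+1 j - F i j - E i j.+1) kM).
    elim: k {kM} => [|k IHk]; first by rewrite /col_sum !big_ord0; ring.
    by rewrite big_ord_recr/= IHk /col_sum !big_ord_recr/=; ring.
  transitivity (\sum_(j < M) (j < n')%:R * (E i j + F i.+1 j - F i j - E i j.+1)
    - \sum_(j < M) (j < n)%:R * (E i j + F i.+1 j - F i j - E i j.+1)).
    by rewrite -sumrB; apply: eq_bigr => j _; rewrite mulrBl.
  by rewrite !part//; ring.
transitivity (\sum_(i < M) (i < m')%:R * ((E i n - E i n') +
   ((col_sum F i.+1 n' - col_sum F i n') - (col_sum F i.+1 n - col_sum F i n)))).
  apply: eq_bigr => i _; rewrite -row mulr_sumr.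
  by apply: eq_bigr => j _; rewrite mulrA.
rewrite (sum_ltn (fun i => (E i n - E i n') + ((col_sum F i.+1 n' - col_sum F i n')
   - (col_sum F i.+1 n - col_sum F i n))) m'M).
have -> : \sum_(i < m') ((E i n - E i n') + ((col_sum F i.+1 n' - col_sum F i n')
   - (col_sum F i.+1 n - col_sum F i n))) = (row_sum E m' n - row_sum E m' n') +
   ((col_sum F m' n' - col_sum F 0 n') - (col_sum F m' n - col_sum F 0 n)).
  elim: (m') {m'M} => [|k IHk]; first by rewrite /row_sum !big_ord0; ring.
  by rewrite big_ord_recr/= IHk /row_sum !big_ord_recr/=; ring.
ring.
Qed.

Variables (L delta : R).
Hypothesis delta0 : 0 < delta.

Definition node (i : nat) : R := - L + delta * i%:R.

Definition snap1 (x : R) : nat := Num.truncn ((x + L) / delta).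

Definition snap z : R * R := (node (snap1 z.1), node (snap1 z.2)).

Lemma nodeE i : node i = - L + delta * i%:R. Proof. by []. Qed.

Lemma node_le i j : (i <= j)%N -> node i <= node j.
Proof. by move=> ij; rewrite /node lerD2l ler_pM2l// ler_nat. Qed.

Lemma snap1_dist (x : R) : - L <= x -> `|node (snap1 x) - x| <= delta.
Proof.
move=> Lx; have /truncn_itv : 0 <= (x + L) / delta
  by apply: divr_ge0; [lra|exact: ltW].
rewrite -/(snap1 x) ler_pdivlMr// ltr_pdivrMr// /node -natr1 => /andP[h1 h2].
rewrite ler_norml; apply/andP; split; lra.
Qed.

Lemma oint_nodes (phi : R -> R) m n :
  (forall x, between (node m) (node n) x -> {for x, continuous phi}) ->
  oint phi (node m) (node n) = \sum_(i < n) oint phi (node i) (node i.+1)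
    - \sum_(i < m) oint phi (node i) (node i.+1).
Proof.
wlog mn : m n / (m <= n)%N => [wl|].
  have [mn|/ltnW nm] := leqP m n; first exact: wl.
  move=> cphi; rewrite ointC wl ?opprB// => x xmn; apply: cphi.
  by apply/betweenP; have /betweenP[] := xmn; tauto.
have le1 := node_le mn; rewrite /between (min_l le1) (max_r le1) => cphi.
rewrite -(subnKC mn) in cphi *.
elim: (n - m)%N cphi => [|k IHk] cphi; first by rewrite addn0 ointaa subrr.
have lek : node m <= node (m + k) <= node (m + k.+1).
  by rewrite !node_le// ?leq_addr// addnS.
rewrite addnS in lek cphi *; rewrite big_ord_recr/= addrAC -IHk.
  by rewrite (oint_chasles (m := node m) (M := node (m + k).+1))//; lra.
by move=> x ?; apply: cphi; lra.
Qed.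

Lemma lpath_nodes O P Q z (r : R) m n m' n' : closed_form O P Q ->
  box z r `<=` O -> box z r (node m, node n) -> box z r (node m', node n') ->
  let E i j := oint (fun u => P (u, node j)) (node i) (node i.+1) in
  let F i j := oint (fun v => Q (node i, v)) (node j) (node j.+1) in
  lpath P Q (node m, node n) (node m', node n') =
  (row_sum E m' n - row_sum E m n) + (col_sum F m' n' - col_sum F m' n).
Proof.
move=> [cP cQ _] BO B1 B2 E F; rewrite /lpath /=; congr (_ + _).
  apply: (@oint_nodes (fun u => P (u, node n))) => x bx.
  by apply/continuous_horizontal/cP/BO/(box_convex B1 B2) => //; exact: betweenl.
apply: (@oint_nodes (fun v => Q (node m', v))) => y by_.
by apply/continuous_vertical/cQ/BO/(box_convex B1 B2) => //; exact: betweenr.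
Qed.

Variables (N M : nat) (r : R).
Hypotheses (N0 : (0 < N)%N) (r0 : 0 < r) (delta_r : 2 * delta < r).

Definition subd (k : nat) : R := k%:R / N%:R.

Lemma subd_in k : (k <= N)%N -> 0 <= subd k <= 1.
Proof.
move=> kN; have N0' : 0 < N%:R :> R by rewrite ltr0n.
by rewrite divr_ge0//= ler_pdivrMr// mul1r ler_nat.
Qed.

Lemma subd0 : subd 0 = 0.
Proof. by rewrite /subd mul0r. Qed.

Lemma subdN : subd N = 1.
Proof. by rewrite /subd divff// pnatr_eq0 -lt0n. Qed.

Lemma subd_le k : subd k <= subd k.+1.
Proof. by rewrite /subd ler_pM2r ?invr_gt0 ?ltr0n// ler_nat. Qed.

(** Curves to which the lattice is adapted: they stay in its range, and each
    of their N pieces moves by less than r / 2. *)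
Definition adapted c :=
  [/\ C1_arc c,
      forall t : R, 0 <= t <= 1 -> - L <= (c t).1 /\ - L <= (c t).2,
      forall t : R, 0 <= t <= 1 -> (snap1 (c t).1 <= M)%N /\ (snap1 (c t).2 <= M)%N &
      forall k t, (k < N)%N -> subd k <= t <= subd k.+1 ->
         box (c (subd k)) (r / 2) (c t)].

(** The multiplicity of the square (i, j) in the lattice cycle obtained by
    moving the points of the curves to the lattice. *)
Definition multiplicity G (i j : nat) : R :=
  \sum_(c <- G) \sum_(k < N) (i < snap1 (c (subd k.+1)).1)%:R *
     ((j < snap1 (c (subd k.+1)).2)%:R - (j < snap1 (c (subd k)).2)%:R).

Definition square_int P Q (i j : nat) : R :=
  oint (fun u => P (u, node j)) (node i) (node i.+1) +
  oint (fun v => Q (node i.+1, v)) (node j) (node j.+1) -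
  oint (fun v => Q (node i, v)) (node j) (node j.+1) -
  oint (fun u => P (u, node j.+1)) (node i) (node i.+1).

Lemma snap_box c k t : adapted c -> (k < N)%N -> subd k <= t <= subd k.+1 ->
  box (c (subd k)) r (snap (c t)).
Proof.
move=> [_ cL _ cN] kN tk; have [b1 b2] := cN _ _ kN tk.
have t01 : 0 <= t <= 1.
  by have := subd_in kN; have := subd_in (ltnW kN); lra.
have [L1 L2] := cL _ t01; have s1 := snap1_dist L1; have s2 := snap1_dist L2.
have half (u v : R) : u <= delta -> v < r / 2 -> u + v < r.
  by move: delta_r; lra.
split; rewrite /snap/=.
  by apply: le_lt_trans (ler_distD (c t).1 _ _) _; exact: half.
by apply: le_lt_trans (ler_distD (c t).2 _ _) _; exact: half.
Qed.

(** Each piece of c stays in a box inside O, in which it may be replaced by a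
    path to the lattice, a path in the lattice and a path back; the connecting
    paths of consecutive pieces cancel. *)
Lemma arcint_lattice O P Q c : closed_form O P Q -> adapted c ->
  (forall t : R, 0 <= t <= 1 -> box (c t) r `<=` O) ->
  arcint P Q c 0 1 =
  \sum_(k < N) lpath P Q (snap (c (subd k))) (snap (c (subd k.+1)))
  - (lpath P Q (c 1) (snap (c 1)) - lpath P Q (c 0) (snap (c 0))).
Proof.
move=> cf ac BO; have [cc _ _ cN] := ac.
suff H n : (n <= N)%N -> arcint P Q c 0 (subd n) =
    \sum_(k < n) lpath P Q (snap (c (subd k))) (snap (c (subd k.+1)))
    - (lpath P Q (c (subd n)) (snap (c (subd n))) - lpath P Q (c 0) (snap (c 0))).
  by have := H N (leqnn N); rewrite subdN.
elim: n => [_|n IHn nN].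
  by rewrite subd0 /arcint ointaa big_ord0 !subrr.
have n01 := subd_in (ltnW nN); have n01' := subd_in nN; have le_n := subd_le n.
have B := BO _ n01.
rewrite -(arcint_chasles (m := 0) (M := 1) (b := subd n) cf cc)//; last 2 first.
- by move=> t /BO; apply; exact: box_center.
- by rewrite lexx/=.
have Bc t : subd n <= t <= subd n.+1 -> box (c (subd n)) r (c t).
  by move=> tn; have [] := cN _ _ nN tn; split; move: r0; lra.
rewrite (IHn (ltnW nN)) (arcint_lpath (z := c (subd n)) (r := r) cf B cc); last first.
  by move=> t /betweenP[] tn; apply: Bc; lra.
have Bn : box (c (subd n)) r (c (subd n)) by exact: box_center.
have Bn' : box (c (subd n)) r (c (subd n.+1)) by apply: Bc; lra.
have Sn : box (c (subd n)) r (snap (c (subd n))) by apply: snap_box => //; lra.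
have Sn' : box (c (subd n)) r (snap (c (subd n.+1))) by apply: snap_box => //; lra.
have a1 := lpath_add cf B Bn Sn Sn'.
have a2 := lpath_add cf B Bn Bn' Sn'.
by rewrite big_ord_recr/=; lra.
Qed.

(** On a closed chain the connecting paths and the telescoping brackets of
    [lattice_step] sum up to 0; what remains are the boundaries of the lattice
    squares. *)
Lemma cycle_lattice O P Q G : closed_form O P Q -> closed_chain G ->
  (forall c, c \in G -> adapted c) ->
  (forall c (t : R), c \in G -> 0 <= t <= 1 -> box (c t) r `<=` O) ->
  \sum_(c <- G) arcint P Q c 0 1 =
  \sum_(i < M) \sum_(j < M) multiplicity G i j * square_int P Q i j.
Proof.
move=> cf cG aG BO.
pose E i j := oint (fun u => P (u, node j)) (node i) (node i.+1).
pose F i j := oint (fun v => Q (node i, v)) (node j) (node j.+1).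
pose h z := row_sum E (snap1 z.1) (snap1 z.2) + col_sum F 0 (snap1 z.2).
pose e z := lpath P Q z (snap z).
have arcE c : c \in G -> arcint P Q c 0 1 + (e (c 1) - e (c 0)) =
    \sum_(k < N) \sum_(i < M) \sum_(j < M) (i < snap1 (c (subd k.+1)).1)%:R *
     ((j < snap1 (c (subd k.+1)).2)%:R - (j < snap1 (c (subd k)).2)%:R)
     * square_int P Q i j + (h (c 1) - h (c 0)).
  move=> cG'; have [cc cL cM cN] := aG _ cG'.
  rewrite (arcint_lattice cf (aG _ cG') (fun t => BO c t cG')) subrK.
  have -> : h (c 1) - h (c 0) =
      \sum_(k < N) (h (c (subd k.+1)) - h (c (subd k))).
    rewrite -(big_mkord xpredT (fun k => h (c (subd k.+1)) - h (c (subd k)))).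
    by rewrite telescope_sumr// subdN subd0.
  rewrite -big_split/=; apply: eq_bigr => k _.
  have k1 : 0 <= subd k <= 1 by apply: subd_in; exact: ltnW.
  have k2 : 0 <= subd k.+1 <= 1 by apply: subd_in; exact: ltn_ord.
  have [m1 m2] := cM _ k1; have [m1' m2'] := cM _ k2.
  have := lattice_step (snap1 (c (subd k)).1) E F m1' m2 m2'.
  have le_k := subd_le k.
  rewrite (lpath_nodes (z := c (subd k)) (r := r) cf).
  - rewrite -/E -/F => S; rewrite -[LHS](subrK (h (c (subd k.+1)) - h (c (subd k)))) -S.
    by congr (_ + _).
  - exact: BO.
  - by apply: (snap_box (aG _ cG') (ltn_ord k)); lra.
  - by apply: (snap_box (aG _ cG') (ltn_ord k)); lra.
transitivity (\sum_(c <- G) (arcint P Q c 0 1 + (e (c 1) - e (c 0)))).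
  by rewrite [RHS]big_split/= [X in _ = _ + X](cG e) addr0.
rewrite big_seq (eq_bigr _ (fun c cG' => arcE c cG')) -big_seq [LHS]big_split/=.
rewrite [X in _ + X](cG h) addr0.
under eq_bigr do rewrite exchange_big/=.
rewrite exchange_big/=; apply: eq_bigr => i _.
transitivity (\sum_(c <- G) \sum_(j < M) \sum_(k < N)
    (i < snap1 (c (subd k.+1)).1)%:R *
     ((j < snap1 (c (subd k.+1)).2)%:R - (j < snap1 (c (subd k)).2)%:R)
     * square_int P Q i j).
  by apply: eq_bigr => c _; rewrite exchange_big.
rewrite exchange_big/=; apply: eq_bigr => j _.
by rewrite mulr_suml; apply: eq_bigr => c _; rewrite mulr_suml.
Qed.

End Lattice.

Section Homology.
Context {R : realType}.
Implicit Types (P Q : R * R -> R) (O : set (R * R)) (p q z : R * R).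
Implicit Types (c : R -> R * R) (G : seq (R -> R * R)).

(** Compactness of the unit segment, in the form that provides radii, moduli of
    continuity and bounds. *)
Lemma near_unit_segment {I : Type} (F : set_system I) {FF : Filter F}
    (A : I -> R -> Prop) :
  (forall t : R, 0 <= t <= 1 -> \forall s \near t & i \near F, A i s) ->
  \forall i \near F, forall t : R, 0 <= t <= 1 -> A i t.
Proof.
have /compact_near_coveringP cov := @segment_compact R 0 1.
move=> H; have : \forall i \near F, `[0, 1] `<=` A i.
  by apply: cov => t /=; rewrite in_itv/=; exact: H.
by apply: filterS => i Ai t t01; apply: Ai => /=; rewrite in_itv.
Qed.

Lemma near_seq {I : Type} {T : eqType} (F : set_system I) {FF : Filter F}
    (s : seq T) (A : T -> I -> Prop) :
  (forall x, x \in s -> \forall i \near F, A x i) ->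
  \forall i \near F, forall x, x \in s -> A x i.
Proof.
elim: s => [|a s IHs] H; first by apply: filterE.
have Ha := H a (mem_head _ _).
have Hs : \forall i \near F, forall x, x \in s -> A x i.
  by apply: IHs => x xs; apply: H; rewrite inE xs orbT.
apply: filterS2 Ha Hs => i Hai Hsi x; rewrite inE => /predU1P[->//|]; exact: Hsi.
Qed.

Lemma box_trans z p q (r s : R) : box z r p -> box p s q -> box z (r + s) q.
Proof.
move=> [r1 r2] [s1 s2]; split.
  by apply: le_lt_trans (ler_distD p.1 _ _) _; rewrite addrC ltrD.
by apply: le_lt_trans (ler_distD p.2 _ _) _; rewrite addrC ltrD.
Qed.

Lemma box_sym z p (r : R) : box z r p -> box p r z.
Proof. by move=> [? ?]; split; rewrite distrC. Qed.

Lemma box_le z (r s : R) : r <= s -> box z r `<=` box z s.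
Proof. by move=> rs q [? ?]; split; apply: lt_le_trans rs. Qed.

Lemma near_box c t (r : R) : {for t, continuous c} -> 0 < r ->
  \forall s \near t, box (c t) r (c s).
Proof. by move=> ct r0; apply: ct; exact: box_nbhs. Qed.

Lemma tube_around_arc O c : open O -> continuous c ->
  (forall t : R, 0 <= t <= 1 -> O (c t)) ->
  \forall r \near 0^'+, forall t : R, 0 <= t <= 1 -> box (c t) r `<=` O.
Proof.
move=> oO cc Oc; apply: near_unit_segment => t t01.
have [r r0 H] := nbhs_box (open_nbhs_nbhs (conj oO (Oc t t01))).
have r20 : 0 < r / 2 by rewrite divr_gt0.
near=> s e.
have Bs : box (c t) (r / 2) (c s) by near: s; exact: near_box (cc t) r20.
have er : e <= r / 2 by near: e; exact: nbhs_right_le.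
apply: subset_trans H => q Bq.
by rewrite [r]splitr; apply: box_trans Bs _; exact: box_le er _ Bq.
Unshelve. all: by end_near. Qed.

Lemma arc_uniform_continuity c (r : R) : continuous c -> 0 < r ->
  \forall d \near 0^'+, forall t : R, 0 <= t <= 1 ->
    forall s, `|s - t| <= d -> box (c t) r (c s).
Proof.
move=> cc r0; apply: near_unit_segment => t t01.
have r20 : 0 < r / 2 by rewrite divr_gt0.
have /nbhs_ballP[d /= d0 H] := near_box (cc t) r20.
have d20 : 0 < d / 2 by rewrite divr_gt0.
near=> s e => u us.
have st : `|t - s| < d / 2 by near: s; exact: nbhsx_ballx.
have Bs : box (c t) (r / 2) (c s) by apply: H; apply: lt_le_trans st _; move: d0; lra.
have Bu : box (c t) (r / 2) (c u).
  apply: H; rewrite /ball/=; apply: le_lt_trans (ler_distD s _ _) _.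
  have : e <= d / 2 by near: e; exact: nbhs_right_le.
  rewrite (distrC s u) => ed; rewrite [d]splitr.
  by apply: ltr_leD st _; exact: le_trans us ed.
by rewrite [r]splitr; apply: box_trans Bu; exact: box_sym.
Unshelve. all: by end_near. Qed.

Lemma arc_bounded c : continuous c ->
  \forall A \near +oo, forall t : R, 0 <= t <= 1 -> `|(c t).1| <= A /\ `|(c t).2| <= A.
Proof.
move=> cc; apply: near_unit_segment => t t01.
near=> s A.
have [b1 b2] : box (c t) 1 (c s) by near: s; exact: near_box (cc t) ltr01.
have A1 : `|(c t).1| + 1 <= A by near: A; exact: nbhs_pinfty_ge.
have A2 : `|(c t).2| + 1 <= A by near: A; exact: nbhs_pinfty_ge.
have h1 := lerB_dist (c s).1 (c t).1; have h2 := lerB_dist (c s).2 (c t).2.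
split.
  by apply: le_trans A1; rewrite -lerBlDl; apply: le_trans h1 (ltW b1).
by apply: le_trans A2; rewrite -lerBlDl; apply: le_trans h2 (ltW b2).
Unshelve. all: by end_near. Qed.

(** The scalar product of u and u + v is |u + v / 2|^2 - |v / 2|^2. *)
Lemma acute_angle (u1 u2 a b d : R) : 0 < d -> `|a| <= d -> `|b| <= d ->
  (4 * d <= `|u1|) || (4 * d <= `|u2|) ->
  0 < u1 * (u1 + a) + u2 * (u2 + b).
Proof.
move=> d0; rewrite !ler_norml => /andP[a1 a2] /andP[b1 b2] u.
have sq (x : R) : `|x| <= d -> x ^+ 2 <= d ^+ 2.
  by move=> xd; rewrite -real_normK ?num_real// ler_sqr ?nnegrE// ltW.
have a2' : a ^+ 2 <= d ^+ 2 by apply: sq; rewrite ler_norml a1.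
have b2' : b ^+ 2 <= d ^+ 2 by apply: sq; rewrite ler_norml b1.
have big (x e : R) : - d <= e -> e <= d -> 4 * d <= `|x| -> d ^+ 2 < (x + e / 2) ^+ 2.
  move=> e1 e2 dx; rewrite -[X in _ < X]real_normK ?num_real//.
  rewrite ltr_sqr ?nnegrE ?(ltW d0)//.
  have := lerB_normD x (e / 2); have : `|e / 2| <= d by rewrite ler_norml; apply/andP; split; lra.
  lra.
have -> : u1 * (u1 + a) + u2 * (u2 + b) = (u1 + a / 2) ^+ 2 + (u2 + b / 2) ^+ 2
  - a ^+ 2 / 4 - b ^+ 2 / 4 by field.
have d20 : 0 < d ^+ 2 by rewrite exprn_gt0.
have s1 := sqr_ge0 (u1 + a / 2); have s2 := sqr_ge0 (u2 + b / 2).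
by case/orP: u => [/(big u1 a a1 a2)|/(big u2 b b1 b2)]; lra.
Qed.

Section Squares.
Variables (L delta : R).
Hypothesis delta0 : 0 < delta.
Local Notation node := (node L delta).
Local Notation square_int := (square_int L delta).

Definition center i j : R * R := (node i + delta / 2, node j + delta / 2).

Lemma nodeS i : node i.+1 = node i + delta.
Proof. by rewrite !nodeE -natr1 mulrDr mulr1 addrA. Qed.

Lemma square_int_closed O P Q i j : closed_form O P Q ->
  (forall x y, node i <= x <= node i.+1 -> node j <= y <= node j.+1 -> O (x, y)) ->
  square_int P Q i j = 0.
Proof.
move=> [_ _ rect] HO.
rewrite /square_int; have /= -> := rect (node i, node j) (node i.+1, node j.+1).
  by ring.
by move=> x y /betweenP bx /betweenP by_; apply: HO; move: bx by_ delta0;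
  rewrite !nodeS; lra.
Qed.

(** Seen from the center, each of the four sides is traversed
    counterclockwise. *)
Lemma theta_square_gt0 i j :
  0 < square_int (theta_x (center i j)) (theta_y (center i j)) i j.
Proof.
have [cP cQ _] := closed_theta (center i j).
have pos z : z <> center i j -> 0 < ((z.1 - (center i j).1) ^+ 2
    + (z.2 - (center i j).2) ^+ 2)^-1.
  by move=> /sqr_dist_gt0; rewrite invr_gt0.
have neh u (y : R) : (y = node j) \/ (y = node j.+1) -> (u, y) <> center i j.
  move=> hy [] _; rewrite nodeS in hy; move: delta0; lra.
have nev (x v : R) : (x = node i) \/ (x = node i.+1) -> (x, v) <> center i j.
  move=> hx [] + _; rewrite nodeS in hx; move: delta0; lra.
have horiz (y : R) : (y = node j) \/ (y = node j.+1) ->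
   exists2 k, 0 < k & oint (fun u => theta_x (center i j) (u, y)) (node i) (node i.+1)
     = - (y - (node j + delta / 2)) * k.
  move=> hy; have [|u _ ->] := @oint_mean _ (fun u => theta_x (center i j) (u, y)) (node i) (node i.+1).
    by move=> u _; apply/continuous_horizontal/cP/neh.
  have := pos (u, y) (neh _ _ hy); rewrite /theta_x /=.
  set k := _^-1 => k0; exists (k * delta); first exact: mulr_gt0.
  by rewrite nodeS mulrA; congr (_ * _); ring.
have verti (x : R) : (x = node i) \/ (x = node i.+1) ->
   exists2 k, 0 < k & oint (fun v => theta_y (center i j) (x, v)) (node j) (node j.+1)
     = (x - (node i + delta / 2)) * k.
  move=> hx; have [|v _ ->] := @oint_mean _ (fun v => theta_y (center i j) (x, v)) (node j) (node j.+1).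
    by move=> v _; apply/continuous_vertical/cQ/nev.
  have := pos (x, v) (nev _ _ hx); rewrite /theta_y /=.
  set k := _^-1 => k0; exists (k * delta); first exact: mulr_gt0.
  by rewrite nodeS mulrA; congr (_ * _); ring.
rewrite /square_int.
have [k1 k10 ->] := horiz _ (or_introl erefl).
have [k2 k20 ->] := horiz _ (or_intror erefl).
have [k3 k30 ->] := verti _ (or_introl erefl).
have [k4 k40 ->] := verti _ (or_intror erefl).
rewrite !nodeS.
have -> : - (node j - (node j + delta / 2)) * k1 +
   (node i + delta - (node i + delta / 2)) * k4
   - (node i - (node i + delta / 2)) * k3
   - - (node j + delta - (node j + delta / 2)) * k2 = delta / 2 * (k1 + k2 + k3 + k4).
  by field.
by rewrite mulr_gt0 ?divr_gt0// !addr_gt0.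
Qed.

Lemma center_in_square i j i' j' :
  node i' <= (center i j).1 <= node i'.+1 ->
  node j' <= (center i j).2 <= node j'.+1 -> (i', j') = (i, j).
Proof.
have one k l : node k <= node l + delta / 2 <= node k.+1 -> k = l.
  rewrite nodeS !nodeE => /andP[h1 h2].
  have lt_of (u v : nat) : delta * u%:R < delta * v%:R + delta -> (u <= v)%N.
    by rewrite -ltnS -(ltr_nat R) -natr1 -(ltr_pM2l delta0) mulrDr mulr1.
  by apply/eqP; rewrite eqn_leq; apply/andP; split; apply: lt_of;
    move: h1 h2 delta0; lra.
by rewrite /center/= => /one -> /one ->.
Qed.

End Squares.

(** By [cycle_lattice] the integral is a sum over the squares of a fine lattice.
    A square inside O contributes 0 because the form is closed. A square that
    meets the complement of O is close to a point around which the winding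
    number is 0, and then it is 0 around the center of the square as well; but
    by [cycle_lattice], applied to the angular form around that center, this
    winding number is a positive multiple of the multiplicity of the square,
    which therefore vanishes. *)
Theorem cauchy_homology O P Q G : open O -> closed_form O P Q -> closed_chain G ->
  (forall c, c \in G -> C1_arc c) ->
  (forall c (t : R), c \in G -> 0 <= t <= 1 -> O (c t)) ->
  (forall p, ~ O p -> \sum_(c <- G) arcint (theta_x p) (theta_y p) c 0 1 = 0) ->
  \sum_(c <- G) arcint P Q c 0 1 = 0.
Proof.
move=> oO cf cG CG OG WG.
have ctG c : c \in G -> continuous c by move=> /CG; exact: C1_arc_continuous.
(* the chain stays at distance 2 r from the complement of O *)
have [r [r0 BO]] : exists r, 0 < r /\
    forall c (t : R), c \in G -> 0 <= t <= 1 -> box (c t) (2 * r) `<=` O.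
  have H : \forall r \near 0^'+,
      forall c, c \in G -> forall t : R, 0 <= t <= 1 -> box (c t) r `<=` O.
    by apply: near_seq => c cG'; apply: tube_around_arc => // [|t]; [exact: ctG|exact: OG].
  have [r [r0 Hr]] := filter_ex (filterI (nbhs_right_gt (0 : R)) H).
  exists (r / 2); split; first by rewrite divr_gt0.
  by move=> c t cG'; rewrite mulrC divfK//; exact: Hr.
(* the pieces of length 1 / N move by less than r / 2 *)
have [N [N0 HN]] : exists N, (0 < N)%N /\ forall c, c \in G -> forall t : R, 0 <= t <= 1 ->
    forall s, `|s - t| <= N%:R^-1 -> box (c t) (r / 2) (c s).
  have H : \forall d \near 0^'+, forall c, c \in G -> forall t : R, 0 <= t <= 1 ->
      forall s, `|s - t| <= d -> box (c t) (r / 2) (c s).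
    apply: near_seq => c cG'.
    by apply: arc_uniform_continuity; [exact: ctG|rewrite divr_gt0].
  have [d [d0 Hd]] := filter_ex (filterI (nbhs_right_gt (0 : R)) H).
  exists (Num.truncn d^-1).+1; split => // c cG' t t01 s st.
  apply: (Hd c cG' t t01); apply: le_trans st _.
  rewrite -[leRHS]invrK lef_pV2 ?posrE ?invr_gt0//.
  by have /truncn_itv/andP[_ /ltW] : 0 <= d^-1 by rewrite invr_ge0 ltW.
have [L [L0 HL]] : exists L : R, 0 < L /\ forall c, c \in G -> forall t : R, 0 <= t <= 1 ->
    `|(c t).1| <= L /\ `|(c t).2| <= L.
  have H : \forall A \near +oo, forall c, c \in G -> forall t : R, 0 <= t <= 1 ->
    `|(c t).1| <= A /\ `|(c t).2| <= A.
    by apply: near_seq => c cG'; apply: arc_bounded; exact: ctG.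
  have [L [L0 HL]] := filter_ex (filterI (nbhs_pinfty_gt (num_real (0 : R))) H).
  by exists L.
pose delta := r / 3.
have delta0 : 0 < delta by rewrite divr_gt0.
have delta_r : 2 * delta < r by rewrite /delta; lra.
pose M := Num.truncn ((L + L) / delta).
have aG c : c \in G -> adapted L delta N M r c.
  move=> cG'; split; first exact: CG.
  - by move=> t /(HL c cG')[]; rewrite !ler_norml => /andP[? _] /andP[? _].
  - move=> t /(HL c cG')[]; rewrite !ler_norml => /andP[_ h1] /andP[_ h2].
    by split; apply: le_truncn; rewrite ler_pM2r ?invr_gt0//; lra.
  - move=> k t kN /andP[t1 t2]; apply: HN => //; first by apply: subd_in => //; exact: ltnW.
    move: t2; rewrite /subd -natr1 mulrDl mul1r => t2.
    by rewrite ger0_norm; move: t1 t2; rewrite /subd; lra.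
have BO' c t : c \in G -> 0 <= t <= 1 -> box (c t) r `<=` O.
  by move=> cG' t01; apply: subset_trans (BO c t cG' t01); apply: box_le; lra.
rewrite (cycle_lattice delta0 N0 r0 delta_r cf cG aG BO').
apply: big1 => i _; apply: big1 => j _.
(* either the square (i, j) is in O, or it contains a point (x, y) outside *)
have [sq|] := pselect (forall x y, node L delta i <= x <= node L delta i.+1 ->
    node L delta j <= y <= node L delta j.+1 -> O (x, y)).
  by rewrite (square_int_closed delta0 cf sq) mulr0.
move=> /existsNP[x] /existsNP[y] /not_implyP[xi] /not_implyP[yj nO].
suff -> : multiplicity L delta N G i j = 0 by rewrite mul0r.
pose q := center L delta i j.
have far c t : c \in G -> 0 <= t <= 1 -> ~ box (c t) (2 * r) (x, y).
  by move=> cG' t01 /(BO c t cG' t01).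
have qx : `|x - q.1| <= delta / 2.
  by move: xi; rewrite /q/= nodeS ler_norml => ?; apply/andP; split; lra.
have qy : `|y - q.2| <= delta / 2.
  by move: yj; rewrite /q/= nodeS ler_norml => ?; apply/andP; split; lra.
have BOq c t : c \in G -> 0 <= t <= 1 -> box (c t) r `<=` [set z | z <> q].
  move=> cG' t01 z [z1 z2] zq; apply: (far c t cG' t01); rewrite zq in z1 z2.
  split => /=.
    apply: le_lt_trans (ler_distD q.1 _ _) _; move: qx z1 delta_r r0; lra.
  apply: le_lt_trans (ler_distD q.2 _ _) _; move: qy z2 delta_r r0; lra.
(* from (x, y) to q the winding number changes by a telescoping sum of angles *)
have W0 : \sum_(c <- G) arcint (theta_x q) (theta_y q) c 0 1 = 0.
  apply: etrans (WG (x, y) nO); apply/eqP; rewrite -subr_eq0 -sumrB; apply/eqP.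
  have acute c : c \in G -> forall t : R, 0 <= t <= 1 ->
      0 < ((c t).1 - x) * ((c t).1 - q.1) + ((c t).2 - y) * ((c t).2 - q.2).
    move=> cG' t t01.
    have -> : (c t).1 - q.1 = ((c t).1 - x) + (x - q.1) by ring.
    have -> : (c t).2 - q.2 = ((c t).2 - y) + (y - q.2) by ring.
    apply: (acute_angle (d := delta / 2)) => //; first by rewrite divr_gt0.
    rewrite -[_ || _]negbK negb_or -!ltNge; apply/negP => /andP[h1 h2].
    apply: (far c t cG' t01).
    by split; rewrite /= distrC; move: h1 h2 delta_r r0; lra.
  rewrite big_seq (eq_bigr _ (fun c cG' =>
    theta_difference (p := (x, y)) (q := q) (CG c cG') (acute c cG'))).
  by rewrite -big_seq; exact: (cG (angle (x, y) q)).
(* only the square (i, j) contains the singularity q *)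
have := cycle_lattice delta0 N0 r0 delta_r (closed_theta q) cG aG BOq.
rewrite W0 (bigD1 i)//= (bigD1 j)//= [X in _ + X + _]big1 ?[X in _ + X]big1.
- rewrite !addr0 => /esym/eqP; rewrite mulf_eq0 => /orP[/eqP//|].
  by rewrite gt_eqF// theta_square_gt0.
- move=> i' ii'; apply: big1 => j' _; rewrite (square_int_closed delta0 (closed_theta q)) ?mulr0//.
  move=> u v ui vj e; move: ui vj; case: e => -> ->.
  by move=> ui vj; have [e _] := center_in_square delta0 ui vj; rewrite -val_eqE/= e eqxx in ii'.
- move=> j' jj'; rewrite (square_int_closed delta0 (closed_theta q)) ?mulr0//.
  move=> u v ui vj e; move: ui vj; case: e => -> ->.
  by move=> ui vj; have [e] := center_in_square delta0 ui vj; rewrite -val_eqE/= e eqxx in jj'.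
Qed.

End Homology.

(** * Hilbert spaces *)

Section CauchySchwarz.
Context {R : realType} {V : lmodType R} (b : V -> V -> R).
Hypotheses (bC : forall u v, b u v = b v u)
  (bl : forall a u v w, b (a *: u + v) w = a * b u w + b v w)
  (b0 : forall u, 0 <= b u u).

Lemma cauchy_schwarz_form u v : b u v ^+ 2 <= b u u * b v v.
Proof.
have E t : b (t *: v + u) (t *: v + u) = t ^+ 2 * b v v + 2 * t * b u v + b u u.
  by rewrite bl (bC v) bl (bC u (t *: v + u)) bl (bC v u); ring.
have P t : 0 <= t ^+ 2 * b v v + 2 * t * b u v + b u u by rewrite -E.
have [bv0|bv0] := eqVneq (b v v) 0.
  suff -> : b u v = 0 by rewrite expr0n/= mulr_ge0.
  apply/eqP/negP => /negP n0; have := P (- (b u u + 1) / (2 * b u v)).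
  rewrite bv0 mulr0 add0r.
  have -> : 2 * (- (b u u + 1) / (2 * b u v)) * b u v = - (b u u + 1) by field.
  lra.
have bvp : 0 < b v v by rewrite lt_def bv0 b0.
have := P (- b u v / b v v).
have -> : (- b u v / b v v) ^+ 2 * b v v + 2 * (- b u v / b v v) * b u v + b u u =
   (b u u * b v v - b u v ^+ 2) / b v v by field.
by rewrite pmulr_lge0 ?invr_gt0// subr_ge0.
Qed.

End CauchySchwarz.

Section L2Sum.
Context {R : realType} {I : finType}.

Section Norm.
Context {H : normedModType R}.

(** The norm of the Hilbert module. It is registered as the canonical norm, so
    that Baire's theorem and the other results on Banach spaces apply to the
    module. *)
Definition l2norm (v : {ffun I -> H}) : R := Num.sqrt (\sum_i `|v i| ^+ 2).

Lemma sum_sqr_ge0 (v : {ffun I -> H}) : 0 <= \sum_i `|v i| ^+ 2.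
Proof. by apply: sumr_ge0 => i _; exact: sqr_ge0. Qed.

Lemma l2norm_triangle (v w : {ffun I -> H}) :
  l2norm (v + w) <= l2norm v + l2norm w.
Proof.
rewrite /l2norm; set a := \sum_i `|v i| ^+ 2; set b := \sum_i `|w i| ^+ 2.
have a0 : 0 <= a := sum_sqr_ge0 v; have b0 : 0 <= b := sum_sqr_ge0 w.
pose s := \sum_i `|v i| * `|w i|.
have s2 : s ^+ 2 <= a * b.
  pose dot (x y : {ffun I -> R}) := \sum_i x i * y i.
  have dotC x y : dot x y = dot y x by apply: eq_bigr => i _; rewrite mulrC.
  have dotl k x y z : dot (k *: x + y) z = k * dot x z + dot y z.
    rewrite /dot mulr_sumr -big_split/=; apply: eq_bigr => i _.
    by rewrite !ffunE mulrDl mulrA.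
  have dot0 x : 0 <= dot x x by apply: sumr_ge0 => i _; exact: sqr_ge0.
  have := cauchy_schwarz_form dotC dotl dot0 [ffun i => `|v i|] [ffun i => `|w i|].
  rewrite /dot; under eq_bigr do rewrite !ffunE.
  under [X in _ <= X * _]eq_bigr do rewrite !ffunE -expr2.
  by under [X in _ <= _ * X]eq_bigr do rewrite !ffunE -expr2.
have s_le : s <= Num.sqrt a * Num.sqrt b.
  by rewrite -sqrtrM// (le_trans (ler_norm s))// -sqrtr_sqr ler_wsqrtr.
rewrite -[leRHS]ger0_norm ?addr_ge0 ?sqrtr_ge0// -sqrtr_sqr ler_wsqrtr//.
rewrite sqrrD !sqr_sqrtr// mulr2n.
apply: (@le_trans _ _ (a + (s + s) + b)); last lra.
rewrite /a /b /s -!big_split/=; apply: ler_sum => i _.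
rewrite ffunE; apply: (@le_trans _ _ ((`|v i| + `|w i|) ^+ 2)).
  by rewrite ler_sqr ?nnegrE ?addr_ge0// ler_normD.
by rewrite sqrrD mulr2n.
Qed.

Lemma l2normZ (k : R) (v : {ffun I -> H}) : l2norm (k *: v) = `|k| * l2norm v.
Proof.
rewrite /l2norm; under eq_bigr do rewrite ffunE normrZ exprMn.
by rewrite -mulr_sumr sqrtrM ?sqr_ge0// sqrtr_sqr normr_id.
Qed.

Lemma l2norm_eq0 (v : {ffun I -> H}) : l2norm v = 0 -> v = 0.
Proof.
move=> /eqP; rewrite sqrtr_eq0 => v0.
have /eqP : \sum_i `|v i| ^+ 2 == 0 by rewrite eq_le v0 sum_sqr_ge0.
move=> /psumr_eq0P/(_ _)/= E; apply/ffunP => i; rewrite ffunE.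
have /eqP := E (fun i _ => sqr_ge0 _) i isT.
by rewrite sqrf_eq0 normr_eq0 => /eqP.
Qed.

HB.instance Definition _ := Lmodule_isNormed.Build R {ffun I -> H}
  l2norm_triangle l2normZ l2norm_eq0.

Lemma l2normE (v : {ffun I -> H}) : `|v| = Num.sqrt (\sum_i `|v i| ^+ 2).
Proof. by []. Qed.

Lemma le_coord_l2norm (v : {ffun I -> H}) i : `|v i| <= `|v|.
Proof.
rewrite l2normE -[leLHS]ger0_norm// -sqrtr_sqr ler_wsqrtr//.
by rewrite (bigD1 i)//= lerDl sumr_ge0.
Qed.

Lemma le_l2norm_sum (v : {ffun I -> H}) : `|v| <= \sum_i `|v i|.
Proof.
have s0 : 0 <= \sum_i `|v i| by apply: sumr_ge0.
rewrite l2normE -[leRHS]ger0_norm// -sqrtr_sqr ler_wsqrtr//.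
rewrite [leRHS]expr2 mulr_suml; apply: ler_sum => i _.
by rewrite expr2 ler_wpM2l// (bigD1 i)//= lerDl sumr_ge0.
Qed.

End Norm.

Section Complete.
Context {H : completeNormedModType R}.

Lemma l2sum_complete (F : set_system {ffun I -> H}) :
  ProperFilter F -> cauchy F -> cvg F.
Proof.
move=> FF /cauchyP CF.
have coord i : exists l : H, (fun v : {ffun I -> H} => v i) @ F --> l.
  suff : cvg ((fun v : {ffun I -> H} => v i) @ F) by move/cvg_ex.
  apply/cauchy_cvgP/cauchyP => e e0; have [v Fv] := CF e e0.
  exists (v i); rewrite /=; apply: filterS Fv => w; rewrite -!ball_normE/=.
  apply: le_lt_trans; have := le_coord_l2norm (v - w) i.
  by rewrite !ffunE.
have /choice[l Hl] := coord.
apply/cvg_ex; exists (finfun l); apply/cvgrPdist_lt => e e0.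
pose e' := e / (#|I|%:R + 1).
have I0 : 0 < #|I|%:R + 1 :> R by have := ler0n R #|I|; lra.
have e'0 : 0 < e' by rewrite divr_gt0.
have : F [set v : {ffun I -> H} | forall i, i \in enum I -> `|l i - v i| < e'].
  by apply: near_seq => i _; have /cvgrPdist_lt := Hl i; apply.
apply: filterS => v Hv.
apply: le_lt_trans (le_l2norm_sum _) _.
apply: (@le_lt_trans _ _ (\sum_(i : I) e')).
  apply: ler_sum => i _; rewrite !ffunE; apply/ltW/Hv; exact: mem_enum.
by rewrite sumr_const -mulr_natr /e' mulrAC ltr_pdivrMr// ltr_pM2l// ltrDl.
Qed.

HB.instance Definition _ :=
  Uniform_isComplete.Build {ffun I -> H} l2sum_complete.

End Complete.
End L2Sum.

Section Banach.
Context {R : realType} {X : completeNormedModType R}.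

Lemma cauchy_sequence_cvg (u : nat -> X) :
  (forall e : R, 0 < e -> exists n, forall k, (n <= k)%N -> `|u n - u k| < e) ->
  exists l : X, u @ \oo --> l.
Proof.
move=> H; suff : cvgn u by move/cvg_ex.
apply/cauchy_cvgP/cauchy_exP => e e0; have [n Hn] := H e e0.
by exists (u n), n => // k /= nk; rewrite -ball_normE; exact: Hn.
Qed.

Lemma geometric_sequence_cvg (u : nat -> X) (C : R) :
  (forall n, `|u n.+1 - u n| <= C * 2^-1 ^+ n) ->
  exists2 l : X, u @ \oo --> l & `|l - u 0%N| <= 2 * C.
Proof.
move=> Hu.
have C0 : 0 <= C by have := le_trans (normr_ge0 _) (Hu 0%N); rewrite expr0 mulr1.
have pow0 n : 0 <= 2^-1 ^+ n :> R by rewrite exprn_ge0// invr_ge0.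
have D n k : `|u (n + k)%N - u n| <= 2 * C * (2^-1 ^+ n - 2^-1 ^+ (n + k)).
  elim: k => [|k IHk]; first by rewrite addn0 !subrr normr0 mulr0.
  rewrite addnS; apply: le_trans (ler_distD (u (n + k)%N) _ _) _.
  apply: le_trans (lerD (Hu _) IHk) _; rewrite exprS; lra.
have D' n k : (n <= k)%N -> `|u k - u n| <= 2 * C * 2^-1 ^+ n.
  move=> /subnKC <-; apply: le_trans (D _ _) _.
  by rewrite ler_wpM2l ?mulr_ge0// lerBlDr lerDl.
have small (e : R) : 0 < e -> exists n, 2 * C * 2^-1 ^+ n < e.
  move=> e0.
  have : (fun n => 2 * C * 2^-1 ^+ n) @ \oo --> (2 * C * 0 : R).
    apply: cvgM; first exact: cvg_cst.
    by apply: cvg_expr; rewrite ger0_norm ?invr_ge0// invf_lt1// ltr1n.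
  rewrite mulr0 => /cvgrPdist_lt/(_ e e0)[n _ Hn]; exists n.
  have := Hn n (leqnn n) => /=; rewrite sub0r normrN ger0_norm//.
  by rewrite !mulr_ge0.
have [l Hl] : exists l : X, u @ \oo --> l.
  apply: cauchy_sequence_cvg => e /small[n Hn]; exists n => k nk.
  by rewrite distrC; apply: le_lt_trans Hn; exact: D'.
exists l => //; apply/ler_addgt0Pr => e e0.
move/cvgrPdist_lt : Hl => /(_ e e0)[n _ Hn].
have h1 := ltW (Hn n (leqnn n)); have h2 := D' 0%N n isT.
apply: le_trans (ler_distD (u n) _ _) _.
rewrite expr0 mulr1 in h2; rewrite [leRHS]addrC; exact: lerD.
Qed.

(** The iteration z |-> w - E z contracts by 1 / 2. *)
Lemma neumann (E : X -> X) : (forall u v, E (u + v) = E u + E v) ->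
  (forall v, `|E v| <= 2^-1 * `|v|) ->
  forall w, exists2 z, z + E z = w & `|z| <= 2 * `|w|.
Proof.
move=> Eadd Ehalf w.
have E0 : E 0 = 0 by apply: (addrI (E 0)); rewrite -Eadd !addr0.
have EB u v : E (u - v) = E u - E v.
  by apply/eqP; rewrite -subr_eq opprK -Eadd subrK.
pose u n := iter n (fun z => w - E z) 0.
have uS n : `|u n.+1 - u n| <= `|w| * 2^-1 ^+ n.
  elim: n => [|n IHn]; first by rewrite /u /= E0 !subr0 expr0 mulr1.
  have -> : u n.+2 - u n.+1 = - E (u n.+1 - u n).
    by rewrite EB /u /= !opprB addrC subrKA.
  rewrite normrN exprS; apply: le_trans (Ehalf _) _.
  rewrite [_ * (2^-1 * _)]mulrCA ler_wpM2l ?invr_ge0//.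
have [z uz zw] := geometric_sequence_cvg uS.
exists z; last by rewrite /u/= subr0 in zw.
apply/eqP; rewrite -subr_eq0 -normr_le0; apply/ler_addgt0Pr => e e0.
have e3 : 0 < e / 3 by rewrite divr_gt0.
move/cvgrPdist_lt : uz => /(_ _ e3)[n _ Hn].
have h1 := Hn n (leqnn n); have h2 := Hn n.+1 (leqnSn n).
have -> : z + E z - w = (z - u n.+1) + E (z - u n).
  rewrite EB /u /= opprB -[LHS]addrA -[RHS]addrA; congr (z + _).
  by rewrite [RHS]addrC subrKA.
rewrite add0r; apply: le_trans (ler_normD _ _) _.
have h3 := Ehalf (z - u n).
have h4 : `|z - u n| <= e / 3 := ltW h1; have h5 : `|z - u n.+1| <= e / 3 := ltW h2.
lra.
Qed.

End Banach.

Section ClosedGraph.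
Context {R : realType} {X : completeNormedModType R} (S : X -> X).
Hypotheses (Sadd : forall u v, S (u + v) = S u + S v)
  (SZ : forall (a : R) u, S (a *: u) = a *: S u)
  (Sclosed : forall (u : nat -> X) v w, u @ \oo --> v -> (S \o u) @ \oo --> w ->
     S v = w).

Let S0 : S 0 = 0.
Proof. by have := SZ 0 0; rewrite !scale0r. Qed.

Let SB u v : S (u - v) = S u - S v.
Proof. by rewrite Sadd -scaleN1r SZ scaleN1r. Qed.

(** By Baire, the closure of some sublevel set of v |-> |S v| contains a ball,
    hence by linearity a ball around the origin. *)
Lemma closed_graph_approx : exists2 C : R, 0 < C &
  forall v, exists u, `|v - u| <= 2^-1 * `|v| /\ `|S u| <= C * `|v|.
Proof.
pose A (n : nat) : set X := closure [set v | `|S v| <= n%:R].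
have [n nd] : exists n, ~ dense (~` A n).
  apply/existsNP => Ad.
  have odA n : open (~` A n) /\ dense (~` A n).
    by split; [apply: closed_openC; exact: closed_closure|exact: Ad].
  have [|v [_ Hv]] := Baire odA (O := setT) _ openT; first by exists 0.
  have [m Hm] : exists m : nat, `|S v| <= m%:R.
    by exists (Num.truncn `|S v|).+1; apply/ltW; case/andP: (truncn_itv (normr_ge0 (S v))).
  by apply: (Hv m I); exact: subset_closure.
have [U [[u0 Uu0] oU UA]] : exists U : set X, [/\ U !=set0, open U & U `<=` A n].
  move: nd => /existsNP[U] /not_implyP[U0] /not_implyP[oU] /set0P/negP.
  rewrite negbK => /eqP UA; exists U; split => // u Uu; apply: contrapT => nA.
  by have : (U `&` ~` A n) u by []; rewrite UA.
have /nbhs_ballP[r /= r0 Br] := open_nbhs_nbhs (conj oU Uu0).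
have approx w (e : R) : `|u0 - w| < r -> 0 < e ->
    exists u, `|w - u| < e /\ `|S u| <= n%:R.
  move=> wr e0; have Aw : A n w by apply/UA/Br; rewrite -ball_normE.
  have [u [Su Bu]] := Aw _ (nbhsx_ballx w e e0).
  by exists u; split => //; move: Bu; rewrite -ball_normE.
have r20 : 0 < r / 2 by rewrite divr_gt0.
exists (2 * (2 * n%:R + 1) / r).
  by rewrite divr_gt0// mulr_gt0// ltr_wpDl// mulr_ge0.
move=> v; have [->|v0] := eqVneq v 0.
  by exists 0; rewrite subr0 S0 normr0 !mulr0.
have nv0 : 0 < `|v| by rewrite normr_gt0.
pose k := r / 2 / `|v|; have k0 : 0 < k by rewrite divr_gt0.
have kv : `|k *: v| = r / 2.
  by rewrite normrZ gtr0_norm// /k divfK// gt_eqF.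
have e0 : 0 < r / 8 by rewrite divr_gt0.
have [|u1 [u1v Su1]] := approx (u0 + k *: v) (r / 8) _ e0.
  by rewrite opprD addrA subrr sub0r normrN kv; lra.
have [|u2 [u2v Su2]] := approx u0 (r / 8) _ e0; first by rewrite subrr normr0.
exists (k^-1 *: (u1 - u2)); split.
  have -> : v - k^-1 *: (u1 - u2) = k^-1 *: ((u0 + k *: v - u1) - (u0 - u2)).
    rewrite -[v in LHS](scalerK (lt0r_neq0 k0)) -scalerBr; congr (_ *: _).
    by rewrite !opprB [RHS]addrC -(addrA u0) subrKA [RHS]addrCA.
  rewrite normrZ gtr0_norm ?invr_gt0// mulrC ler_pdivrMr//.
  have -> : 2^-1 * `|v| * k = r / 4.
    by rewrite /k; field; rewrite gt_eqF.
  apply: le_trans (ler_normB _ _) _; have := ltW u1v; have := ltW u2v.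
  by move=> h1 h2; apply: le_trans (lerD h2 h1) _; lra.
rewrite SZ SB normrZ gtr0_norm ?invr_gt0// mulrC ler_pdivrMr//.
have -> : 2 * (2 * n%:R + 1) / r * `|v| * k = 2 * n%:R + 1.
  by rewrite /k; field; rewrite !gt_eqF.
apply: le_trans (ler_normB _ _) _; apply: le_trans (lerD Su1 Su2) _.
by rewrite mulr_natl mulr2n lerDl.
Qed.

(** Iterating the approximation writes v as a series whose images form a
    geometrically convergent series; closedness identifies its sum. *)
Theorem closed_graph : exists2 C : R, 0 <= C & forall v, `|S v| <= C * `|v|.
Proof.
have [C C0 /choice[U HU]] := closed_graph_approx.
exists (2 * C); first by rewrite mulr_ge0// ltW.
move=> v; pose rest := fix r n := if n is k.+1 then r k - U (r k) else v.
have restS n : `|rest n| <= 2^-1 ^+ n * `|v|.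
  elim: n => [|n IHn]; first by rewrite expr0 mul1r.
  have [h1 _] := HU (rest n); rewrite exprS -mulrA; apply: le_trans h1 _.
  by rewrite ler_wpM2l ?invr_ge0.
pose part n := v - rest n.
have partS n : part n.+1 = part n + U (rest n).
  by rewrite /part /= opprB [U _ + _]addrC addrA addrAC.
have Spart n : `|S (part n.+1) - S (part n)| <= C * `|v| * 2^-1 ^+ n.
  rewrite partS Sadd addrAC subrr add0r; have [_ h] := HU (rest n).
  by apply: le_trans h _; rewrite -mulrA ler_pM2l// mulrC.
have [z Hz zle] := geometric_sequence_cvg (u := S \o part) Spart.
have partv : part @ \oo --> v.
  apply/cvgrPdist_le => e e0.
  have : (fun n => 2^-1 ^+ n * `|v|) @ \oo --> (0 * `|v| : R).
    apply: cvgM; last exact: cvg_cst.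
    by apply: cvg_expr; rewrite ger0_norm ?invr_ge0// invf_lt1// ltr1n.
  rewrite mul0r => /cvgrPdist_le/(_ e e0); apply: filterS => n.
  rewrite sub0r normrN ger0_norm ?mulr_ge0// ?exprn_ge0 ?invr_ge0//.
  by apply: le_trans; rewrite /part opprB addrC subrK.
have -> : S v = z by exact: Sclosed partv Hz.
move: zle; rewrite /= /part /= subrr S0 subr0 => /le_trans; apply.
by rewrite mulrA.
Qed.

End ClosedGraph.

Section Riesz.
Context {R : realType} {X : completeNormedModType R} (ip : X -> X -> R).
Hypothesis hip : hilbert_inner ip.

Lemma ipC u v : ip u v = ip v u. Proof. by case: hip. Qed.

Lemma ipE u : ip u u = `|u| ^+ 2. Proof. by case: hip. Qed.

Lemma ip_lin a u v w : ip (a *: u + v) w = a * ip u w + ip v w.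
Proof. by case: hip. Qed.

Lemma ipDl u v w : ip (u + v) w = ip u w + ip v w.
Proof. by rewrite -[u]scale1r ip_lin mul1r scale1r. Qed.

Lemma ip0l w : ip 0 w = 0.
Proof. by apply: (addrI (ip 0 w)); rewrite -ipDl !addr0. Qed.

Lemma ipZl a u w : ip (a *: u) w = a * ip u w.
Proof. by rewrite -[_ *: _]addr0 ip_lin ip0l addr0. Qed.

Lemma ipNl u w : ip (- u) w = - ip u w.
Proof. by rewrite -scaleN1r ipZl mulN1r. Qed.

Lemma ipBl u v w : ip (u - v) w = ip u w - ip v w.
Proof. by rewrite ipDl ipNl. Qed.

Lemma ipDr u v w : ip w (u + v) = ip w u + ip w v.
Proof. by rewrite ipC ipDl !(ipC w). Qed.

Lemma ipZr a u w : ip w (a *: u) = a * ip w u.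
Proof. by rewrite ipC ipZl ipC. Qed.

Lemma ipNr u w : ip w (- u) = - ip w u.
Proof. by rewrite ipC ipNl ipC. Qed.

Lemma ipBr u v w : ip w (u - v) = ip w u - ip w v.
Proof. by rewrite ipDr ipNr. Qed.

Lemma ip_suml (I : Type) (s : seq I) (F : I -> X) w :
  ip (\sum_(i <- s) F i) w = \sum_(i <- s) ip (F i) w.
Proof.
elim: s => [|i s IHs]; first by rewrite !big_nil ip0l.
by rewrite !big_cons ipDl IHs.
Qed.

Lemma ip_norm_le u v : `|ip u v| <= `|u| * `|v|.
Proof.
have ip_pos w : 0 <= ip w w by rewrite ipE sqr_ge0.
have := cauchy_schwarz_form ipC ip_lin ip_pos u v.
rewrite !ipE -exprMn => h.
rewrite -[leRHS]ger0_norm ?mulr_ge0// -!sqrtr_sqr ler_wsqrtr//.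
Qed.

Lemma ip_ext u u' : (forall w, ip u w = ip u' w) -> u = u'.
Proof.
move=> H; apply/eqP; rewrite -subr_eq0 -normr_eq0 -sqrf_eq0 -ipE ipBl.
by rewrite H subrr.
Qed.

(** The representing vector minimizes |v|^2 - 2 l(v); the parallelogram law
    makes minimizing sequences Cauchy. *)
Theorem riesz (l : X -> R) (C : R) :
  (forall a u v, l (a *: u + v) = a * l u + l v) ->
  (forall v, `|l v| <= C * `|v|) -> exists u, forall v, l v = ip u v.
Proof.
move=> llin lC.
have l0 : l 0 = 0.
  by apply: (addrI (l 0)); rewrite -[X in X + _ = _]mul1r -llin scale1r !addr0.
have lZ a u : l (a *: u) = a * l u by rewrite -[_ *: _]addr0 llin l0 addr0.
have lD u v : l (u + v) = l u + l v by rewrite -[u]scale1r llin mul1r scale1r.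
have lB u v : l (u - v) = l u - l v by rewrite lD -scaleN1r lZ mulN1r.
pose J v := ip v v - 2 * l v.
have Jlb v : - C ^+ 2 <= J v.
  have h : l v <= C * `|v| := le_trans (ler_norm _) (lC v).
  have := sqr_ge0 (`|v| - C); rewrite /J ipE sqrrB mulr2n.
  by move: h; move: (`|v| : R) (l v) => x y; lra.
pose m := inf (range J).
have hm : has_inf (range J).
  by split; [exists (J 0); exists 0|exists (- C ^+ 2) => _ [v _ <-]; exact: Jlb].
have mJ v : m <= J v by apply: ge_inf; [case: hm|exists v].
have minimizing n : exists v, J v < m + n.+1%:R^-1.
  have n0 : 0 < n.+1%:R^-1 :> R by rewrite invr_gt0.
  by have [_ [v _ <-] Hv] := inf_adherent n0 hm; exists v.
have /choice[u Ju] := minimizing.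
have para v w : `|v - w| ^+ 2 = 2 * J v + 2 * J w - 4 * J (2^-1 *: (v + w)).
  rewrite -ipE /J !(ipBl, ipBr, ipZl, ipZr, ipDl, ipDr) lZ lD (ipC w v).
  by field.
have close n k : (n <= k)%N -> `|u n - u k| ^+ 2 <= 4 * n.+1%:R^-1.
  move=> nk; rewrite para; have := mJ (2^-1 *: (u n + u k)).
  have := Ju n; have := Ju k.
  have : k.+1%:R^-1 <= n.+1%:R^-1 :> R by rewrite lef_pV2 ?posrE// ler_nat.
  move: (J _) (J (u n)) (J (u k)) (k.+1%:R^-1 : R) (n.+1%:R^-1 : R) => *; lra.
have small (e : R) : 0 < e -> exists n : nat, n.+1%:R^-1 < e.
  move=> e0; exists (Num.truncn e^-1); rewrite invf_plt ?posrE//.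
  by have /truncn_itv/andP[] : 0 <= e^-1 by rewrite invr_ge0 ltW.
have [v uv] : exists v : X, u @ \oo --> v.
  apply: cauchy_sequence_cvg => e e0.
  have [n Hn] := small (e ^+ 2 / 4) (divr_gt0 (exprn_gt0 2 e0) (ltr0Sn _ 3)).
  exists n => k nk; rewrite -ltr_sqr ?nnegrE// ?(ltW e0)//.
  by apply: le_lt_trans (close n k nk) _; move: Hn; rewrite ltr_pdivlMr// mulrC.
have Jv : J v <= m.
  apply/ler_addgt0Pr => e e0.
  pose K := 2 * `|v| + 1 + 2 * `|C| .
  have K0 : 0 < K by rewrite /K; have := normr_ge0 v; have := normr_ge0 C; lra.
  pose d := Num.min 1 (e / (2 * K)).
  have d0 : 0 < d by rewrite lt_min ltr01 divr_gt0// mulr_gt0.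
  have e20 : 0 < e / 2 by rewrite divr_gt0.
  move/cvgrPdist_lt : uv => /(_ d d0)[n _ Hn].
  have [n' Hn'] := small _ e20.
  pose k := maxn n n'.
  have /= dk := Hn k (leq_maxl _ _); move: dk; rewrite lt_min => /andP[dk1 dk2].
  have Jk : J (u k) < m + e / 2.
    apply: lt_trans (Ju k) _; rewrite ltrD2l; apply: le_lt_trans Hn'.
    by rewrite lef_pV2 ?posrE// ler_nat ltnS leq_maxr.
  have E : J v = J (u k) - `|v - u k| ^+ 2 + 2 * ip v (v - u k) - 2 * l (v - u k).
    by rewrite /J -ipE !(ipBl, ipBr) lB (ipC (u k) v); ring.
  have h1 := ip_norm_le v (v - u k); have h2 := lC (v - u k).
  have h3 := ler_norm (ip v (v - u k)); have h4 := ler_norm (- l (v - u k)).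
  rewrite normrN in h4.
  have h5 : C * `|v - u k| <= `|C| * `|v - u k| by rewrite ler_wpM2r// ler_norm.
  have h6 : K * `|v - u k| <= e / 2.
    move: dk2; rewrite ltr_pdivlMr ?mulr_gt0// => /ltW; lra.
  have h7 := sqr_ge0 `|v - u k|; have h8 := normr_ge0 (v - u k).
  rewrite E; move: h6; rewrite /K; lra.
exists v => w; apply/eqP/negP => /negP ne.
pose D := l w - ip v w.
have D0 : D != 0 by rewrite subr_eq0.
have key t : 0 <= t ^+ 2 * `|w| ^+ 2 - 2 * t * D.
  have := le_trans Jv (mJ (v + t *: w)).
  rewrite /J !(ipDl, ipDr, ipZl, ipZr) lD lZ (ipC w v) [ip w w]ipE /D; lra.
pose W := `|w| ^+ 2 + 1.
have W0 : 0 < W by rewrite /W; have := sqr_ge0 `|w|; lra.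
have := key (D / W).
have -> : (D / W) ^+ 2 * `|w| ^+ 2 - 2 * (D / W) * D =
   - ((D / W) ^+ 2 * (W + 1)).
  by rewrite /W; field; rewrite -/W gt_eqF.
rewrite oppr_ge0 leNgt mulr_gt0//; last by rewrite addr_gt0.
by rewrite lt_def sqr_ge0 andbT sqrf_eq0 mulf_neq0// invr_eq0 gt_eqF.
Qed.

End Riesz.

(** * The Clifford algebra and its Hilbert modules *)

Section Signs.
Context {R : realType} {d : nat}.
Implicit Types A B C : {set 'I_d}.
Local Notation sgn := (@cl_sign R d).

Lemma in_symdiff A B i : (i \in symdiff A B) = (i \in A) (+) (i \in B).
Proof. by rewrite !inE; case: (i \in A); case: (i \in B). Qed.

Lemma symdiffC A B : symdiff A B = symdiff B A.
Proof. by apply/setP => i; rewrite !in_symdiff addbC. Qed.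

Lemma symdiffA A B C : symdiff A (symdiff B C) = symdiff (symdiff A B) C.
Proof. by apply/setP => i; rewrite !in_symdiff addbA. Qed.

Lemma symdiffKl A : involutive (symdiff A).
Proof. by move=> B; apply/setP => i; rewrite !in_symdiff addKb. Qed.

Lemma symdiffKr A : involutive (symdiff^~ A).
Proof. by move=> B; apply/setP => i; rewrite /= !in_symdiff -addbA addbb addbF. Qed.

Lemma symdiffAA A : symdiff A A = finset.set0.
Proof. by apply/setP => i; rewrite in_symdiff addbb inE. Qed.

Lemma symdiff0 A : symdiff finset.set0 A = A.
Proof. by apply/setP => i; rewrite in_symdiff inE. Qed.

Lemma symdiffr0 A : symdiff A finset.set0 = A.
Proof. by rewrite symdiffC symdiff0. Qed.

Lemma eq_symdiff A B C : (C == symdiff A B) = (B == symdiff A C).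
Proof. by apply/eqP/eqP => ->; rewrite symdiffKl. Qed.

Lemma reindex_symdiffl (V : nmodType) A (F : {set 'I_d} -> V) :
  \sum_C F C = \sum_C F (symdiff A C).
Proof. by rewrite (reindex_inj (inv_inj (symdiffKl A))). Qed.

Lemma reindex_symdiffr (V : nmodType) A (F : {set 'I_d} -> V) :
  \sum_C F C = \sum_C F (symdiff C A).
Proof. by rewrite (reindex_inj (inv_inj (symdiffKr A))). Qed.

Let pair_sign (a b : 'I_d) : R := if (b <= a)%N then -1 else 1.

(** Both the transpositions and the squares of generators are pairs of an index
    of A and one of B that are weakly decreasing. *)
Lemma cl_signE A B : sgn A B = \prod_(a in A) \prod_(b in B) pair_sign a b.
Proof.
rewrite /cl_sign exprD -!prodr_const.
rewrite (eq_bigl (fun p : 'I_d * 'I_d =>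
  (p.1 \in A) && ((p.2 \in B) && (p.2 < p.1)%N))); last by move=> p.
rewrite -(pair_big_dep (fun a => a \in A) (fun a b => (b \in B) && (b < a)%N)
  (fun _ _ => -1 : R)) /=.
have -> : \prod_(i in A :&: B) (-1 : R) =
    \prod_(i in A) \prod_(b in B) (if b == i then -1 else 1).
  under eq_bigl do rewrite inE.
  rewrite big_mkcondr /=; apply: eq_bigr => i _.
  rewrite -big_mkcondr/=; case: ifP => iB.
    by rewrite (big_pred1 i) // => j /=; case: eqVneq => [->|]; rewrite ?iB ?andbF.
  rewrite big_pred0// => j; case: eqVneq => [->|]; by rewrite ?iB ?andbF.
rewrite -big_split/=; apply: eq_bigr => a _.
rewrite big_mkcondr -big_split/=; apply: eq_bigr => b _.
rewrite /pair_sign -val_eqE/=.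
by case: (ltngtP (val b) (val a)) => //= _; rewrite ?mulr1 ?mul1r.
Qed.

Let prod_symdiff (f : 'I_d -> R) A B : (forall i, f i * f i = 1) ->
  \prod_(i in symdiff A B) f i = (\prod_(i in A) f i) * \prod_(i in B) f i.
Proof.
move=> ff; rewrite [LHS]big_mkcond [X in _ = X * _]big_mkcond.
rewrite [X in _ = _ * X]big_mkcond -big_split/=; apply: eq_bigr => i _.
rewrite in_symdiff; case: (i \in A); case: (i \in B) => //=;
  by rewrite ?ff ?mulr1 ?mul1r.
Qed.

Let pair_sign_sqr a b : pair_sign a b * pair_sign a b = 1.
Proof. by rewrite /pair_sign; case: ifP; rewrite ?mulrNN mulr1. Qed.

(** As a product over pairs of indices the sign is bimultiplicative for the
    symmetric difference. Associativity, conjugation and all commutation rules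
    below reduce to this. *)
Lemma cl_signMl A B C : sgn (symdiff A B) C = sgn A C * sgn B C.
Proof.
rewrite !cl_signE prod_symdiff// => i; rewrite -big_split/=.
by apply: big1 => j _; exact: pair_sign_sqr.
Qed.

Lemma cl_signMr A B C : sgn C (symdiff A B) = sgn C A * sgn C B.
Proof.
rewrite !cl_signE -big_split/=; apply: eq_bigr => i _.
by rewrite prod_symdiff// => j; exact: pair_sign_sqr.
Qed.

Lemma cl_sign_sqr A B : sgn A B * sgn A B = 1.
Proof. by rewrite /cl_sign -expr2 sqrr_sign. Qed.

Lemma cl_sign0l A : sgn finset.set0 A = 1.
Proof. by rewrite cl_signE big_set0. Qed.

Lemma cl_sign0r A : sgn A finset.set0 = 1.
Proof. by rewrite cl_signE big1// => i _; rewrite big_set0. Qed.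

Lemma cl_sign1 (i k : 'I_d) : sgn [set i]%SET [set k]%SET = if (k <= i)%N then -1 else 1.
Proof. by rewrite cl_signE !big_set1. Qed.

(** The conjugation sign of e_A is that of e_A e_A, because the pairs of A are
    ordered in one way or the other. *)
Lemma conj_sign A : (-1) ^+ (#|A| * #|A|.+1)./2 = sgn A A.
Proof.
rewrite /cl_sign finset.setIid; congr (_ ^+ _).
set n := #|[pred p : 'I_d * 'I_d | _]|.
have E : (n + n + #|A| = #|A| * #|A|)%N.
  have n1 : n = (\sum_(a in A) \sum_(b in A) (b < a)%N)%N.
    rewrite /n -sum1_card.
    rewrite (eq_bigl (fun p : 'I_d * 'I_d =>
      (p.1 \in A) && ((p.2 \in A) && (p.2 < p.1)%N))); last by move=> p.
    rewrite -(pair_big_dep (fun a => a \in A) (fun a b => (b \in A) && (b < a)%N)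
      (fun _ _ => 1%N)) /=.
    by apply: eq_bigr => a _; rewrite big_mkcondr; apply: eq_bigr => b _; case: ifP.
  have n2 : n = (\sum_(a in A) \sum_(b in A) (a < b)%N)%N.
    by rewrite n1 exchange_big.
  have n3 : #|A| = (\sum_(a in A) \sum_(b in A) (b == a))%N.
    rewrite -sum1_card; apply: eq_bigr => a aA; rewrite (bigD1 a)//= eqxx.
    by rewrite big1// => b /andP[_ /negbTE->].
  have n4 : (#|A| * #|A| = \sum_(a in A) \sum_(b in A) 1)%N.
    under eq_bigr do rewrite sum1_card.
    by rewrite sum_nat_const.
  rewrite n4 {1}n1 n2 n3 -!big_split/=; apply: eq_bigr => a _.
  rewrite -!big_split/=; apply: eq_bigr => b _.
  by rewrite -val_eqE/=; case: (ltngtP (val b) (val a)).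
have -> : (#|A| * #|A|.+1 = (n + #|A|).*2)%N by lia.
by rewrite doubleK.
Qed.

End Signs.

Section CliffordAlgebra.
Context {R : realType} {d : nat}.
Implicit Types (A B C : {set 'I_d}) (a b : clifford R d).
Local Notation sgn := (@cl_sign R d).
Local Notation e := (@cl_basis R d).

Lemma cl_decomp a : a = \sum_A a A *: e A.
Proof.
apply/ffunP => C; rewrite sum_ffunE (bigD1 C)//= !ffunE eqxx [_ *: _]mulr1.
by rewrite big1 ?addr0// => A neA; rewrite !ffunE eq_sym (negbTE neA) scaler0.
Qed.

Lemma cl_mulE a b C : cl_mul a b C = \sum_A a A * b (symdiff A C) * sgn A (symdiff A C).
Proof.
rewrite /cl_mul sum_ffunE; apply: eq_bigr => A _; rewrite sum_ffunE.
rewrite (bigD1 (symdiff A C))//= !ffunE symdiffKl eqxx [_ *: _]mulr1.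
by rewrite big1 ?addr0// => B BC; rewrite !ffunE eq_symdiff (negbTE BC) scaler0.
Qed.

Lemma cl_conjE a A : cl_conj a A = sgn A A * a A.
Proof. by rewrite ffunE conj_sign. Qed.

Lemma cl_mulDl a b (c : clifford R d) : cl_mul (a + b) c = cl_mul a c + cl_mul b c.
Proof.
apply/ffunP => C; rewrite ffunE !cl_mulE -big_split; apply: eq_bigr => A _.
by rewrite ffunE/=; ring.
Qed.

Lemma cl_mulDr a b (c : clifford R d) : cl_mul c (a + b) = cl_mul c a + cl_mul c b.
Proof.
apply/ffunP => C; rewrite ffunE !cl_mulE -big_split; apply: eq_bigr => A _.
by rewrite ffunE/=; ring.
Qed.

Lemma cl_mulZl k a b : cl_mul (k *: a) b = k *: cl_mul a b.
Proof.
apply/ffunP => C; rewrite ffunE !cl_mulE scaler_sumr; apply: eq_bigr => A _.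
by rewrite ffunE/= /GRing.scale/=; ring.
Qed.

Lemma cl_mulZr k a b : cl_mul a (k *: b) = k *: cl_mul a b.
Proof.
apply/ffunP => C; rewrite ffunE !cl_mulE scaler_sumr; apply: eq_bigr => A _.
by rewrite ffunE/= /GRing.scale/=; ring.
Qed.

Lemma cl_mulNl a b : cl_mul (- a) b = - cl_mul a b.
Proof. by rewrite -scaleN1r cl_mulZl scaleN1r. Qed.

Lemma cl_mulNr a b : cl_mul a (- b) = - cl_mul a b.
Proof. by rewrite -scaleN1r cl_mulZr scaleN1r. Qed.

Lemma cl_mul1l a : cl_mul (e finset.set0) a = a.
Proof.
apply/ffunP => C; rewrite cl_mulE (bigD1 finset.set0)//= ffunE eqxx symdiff0 cl_sign0l.
by rewrite mul1r mulr1 big1 ?addr0// => A A0; rewrite ffunE (negbTE A0) !mul0r.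
Qed.

Lemma cl_mul1r a : cl_mul a (e finset.set0) = a.
Proof.
apply/ffunP => C; rewrite cl_mulE (bigD1 C)//= ffunE symdiffAA eqxx cl_sign0r.
rewrite !mulr1 big1 ?addr0// => A neA; rewrite ffunE [_ == finset.set0](_ : _ = false).
  by rewrite mulr0 mul0r.
apply/negbTE; apply: contra neA => /eqP E; apply/eqP.
by rewrite -(symdiffr0 A) -E symdiffKl.
Qed.

Lemma cl_mul_basis A B : cl_mul (e A) (e B) = sgn A B *: e (symdiff A B).
Proof.
apply/ffunP => C; rewrite cl_mulE (bigD1 A)//= !ffunE eqxx mul1r.
rewrite big1 ?addr0; last by move=> D DA; rewrite ffunE (negbTE DA) !mul0r.
rewrite [symdiff A C == B]eq_sym eq_symdiff; case: eqP => [->|_].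
  by rewrite symdiffKl mul1r /GRing.scale/= mulr1.
by rewrite mul0r /GRing.scale/= mulr0.
Qed.

Lemma cl_conjD a b : cl_conj (a + b) = cl_conj a + cl_conj b.
Proof. by apply/ffunP => A; rewrite [RHS]ffunE !cl_conjE ffunE mulrDr. Qed.

Lemma cl_conjN a : cl_conj (- a) = - cl_conj a.
Proof. by apply/ffunP => A; rewrite [RHS]ffunE !cl_conjE ffunE mulrN. Qed.

Lemma conj_basis A : cl_conj (e A) = sgn A A *: e A.
Proof.
apply/ffunP => C; rewrite cl_conjE !ffunE.
by case: eqP => [->|_] //; rewrite mulr0 scaler0.
Qed.

Lemma cl_conjM a b : cl_conj (cl_mul a b) = cl_mul (cl_conj b) (cl_conj a).
Proof.
apply/ffunP => C; rewrite cl_conjE !cl_mulE mulr_sumr.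
rewrite [RHS](reindex_symdiffr C); apply: eq_bigr => A _.
rewrite !cl_conjE [symdiff A C]symdiffC -symdiffA -[symdiff C (symdiff A C)]symdiffC.
have -> : symdiff (symdiff A C) C = A by exact: symdiffKr.
rewrite [symdiff C A]symdiffC !(cl_signMl, cl_signMr).
have := cl_sign_sqr (R := R) A A; have := cl_sign_sqr (R := R) A C.
have := cl_sign_sqr (R := R) C A; have := cl_sign_sqr (R := R) C C.
move: (sgn A A) (sgn A C) (sgn C A) (sgn C C) => w x y z zz yy xx ww.
transitivity (a A * b (symdiff A C) * w * z * x * (w * w) * (y * y)); last by ring.
by rewrite ww yy !mulr1; ring.
Qed.

Lemma cl_conj0 : cl_conj (0 : clifford R d) = 0.
Proof. by apply/ffunP => A; rewrite cl_conjE !ffunE mulr0. Qed.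

Lemma cl_norm_conj a : cl_norm (cl_conj a) = cl_norm a.
Proof.
rewrite /cl_norm; congr Num.sqrt; apply: eq_bigr => A _.
by rewrite cl_conjE exprMn expr2 cl_sign_sqr mul1r.
Qed.

Lemma pv_val_slice (J : 'rV[R]_d.+1) x y : imag_unit J ->
  pv_val (slice J x y) = x *: e finset.set0 + y *: pv_val J.
Proof.
move=> [J0 _]; rewrite /pv_val /slice !mxE J0 eqxx !mulr1 mulr0 addr0 scale0r add0r.
congr (_ + _); rewrite scaler_sumr; apply: eq_bigr => i _.
by rewrite !mxE/= mulr0 add0r scalerA.
Qed.

Lemma pv_conj_slice (J : 'rV[R]_d.+1) x y : imag_unit J ->
  pv_conj (slice J x y) = slice J x (- y).
Proof.
move=> [J0 _]; apply/rowP => i; rewrite !mxE !eqxx/=.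
by case: eqVneq => [->|_]; rewrite ?J0 ?mulr0 ?add0r ?mulNr.
Qed.

Lemma pv_val_conj_slice (J : 'rV[R]_d.+1) x y : imag_unit J ->
  pv_val (pv_conj (slice J x y)) = x *: e finset.set0 - y *: pv_val J.
Proof. by move=> HJ; rewrite pv_conj_slice// pv_val_slice// scaleNr. Qed.

Lemma imag_unit_sum (J : 'rV[R]_d.+1) : imag_unit J ->
  \sum_(i < d) J 0 (lift ord0 i) ^+ 2 = 1.
Proof.
move=> [J0 J1]; move: J1; rewrite /pv_norm big_ord_recl J0 expr0n/= add0r => J1.
rewrite -[LHS]sqr_sqrtr; last by apply: sumr_ge0 => i _; exact: sqr_ge0.
by rewrite J1 expr1n.
Qed.

(** The products of distinct generators cancel in pairs. *)
Lemma imag_unit_sqr (J : 'rV[R]_d.+1) : imag_unit J ->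
  cl_mul (pv_val J) (pv_val J) = - e finset.set0.
Proof.
move=> /[dup] /imag_unit_sum sum1 [J0 _].
have HJ : pv_val J = \sum_(i < d) J 0 (lift ord0 i) *: e [set i]%SET.
  by rewrite /pv_val J0 scale0r add0r.
have suml (I : finType) (F : I -> clifford R d) a :
    cl_mul (\sum_i F i) a = \sum_i cl_mul (F i) a.
  apply: (big_morph (fun b => cl_mul b a)) => [b c|]; first exact: cl_mulDl.
  by rewrite -[0](scale0r 0) cl_mulZl !scale0r.
have sumr (I : finType) (F : I -> clifford R d) a :
    cl_mul a (\sum_i F i) = \sum_i cl_mul a (F i).
  apply: (big_morph (fun b => cl_mul a b)) => [b c|]; first exact: cl_mulDr.
  by rewrite -[0](scale0r 0) cl_mulZr !scale0r.
pose t i k := (J 0 (lift ord0 i) * J 0 (lift ord0 k)) *: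
   (sgn [set i]%SET [set k]%SET *: e (symdiff [set i]%SET [set k]%SET)).
have E : cl_mul (pv_val J) (pv_val J) = \sum_i \sum_k t i k.
  rewrite {1}HJ suml; apply: eq_bigr => i _; rewrite HJ sumr; apply: eq_bigr => k _.
  by rewrite cl_mulZl cl_mulZr cl_mul_basis scalerA.
have tt i k : t i k + t k i = (i == k)%:R *: (- (2 * J 0 (lift ord0 i) ^+ 2) *: e finset.set0).
  have [<-|ik] := eqVneq i k.
    by rewrite /t cl_sign1 leqnn symdiffAA scale1r !scalerA -scalerDl; congr (_ *: _); ring.
  rewrite scale0r /t !cl_sign1 [symdiff [set k]%SET _]symdiffC !scalerA -scalerDl.
  rewrite -val_eqE/= in ik; case: ltngtP ik => //= _ _.
    by rewrite [X in X *: _](_ : _ = 0) ?scale0r//; ring.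
  by rewrite [X in X *: _](_ : _ = 0) ?scale0r//; ring.
have D : cl_mul (pv_val J) (pv_val J) + cl_mul (pv_val J) (pv_val J) =
   - (2 : R) *: e finset.set0.
  rewrite E {2}exchange_big -big_split/=.
  transitivity (\sum_(i < d) (- (2 * J 0 (lift ord0 i) ^+ 2) *: e finset.set0)).
    apply: eq_bigr => i _; rewrite -big_split/= (eq_bigr _ (fun k _ => tt i k)).
    rewrite (bigD1 i)//= eqxx scale1r big1 ?addr0// => k ki.
    by rewrite eq_sym (negbTE ki) scale0r.
  by rewrite -scaler_suml sumrN -mulr_sumr sum1 mulr1.
have n2 : (2 : R) != 0 by rewrite pnatr_eq0.
apply: (scalerI n2).
by rewrite -[2]/(1 + 1) scalerDl scale1r D [RHS]scalerN scaleNr.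
Qed.

End CliffordAlgebra.

Section HilbertModules.
Context {R : realType} {d : nat} {H : completeNormedModType R}.
Variables (ip : H -> H -> R) (hip : hilbert_inner ip).
Implicit Types (A B C : {set 'I_d}) (s t : clifford R d).
Local Notation X := {ffun {set 'I_d} -> H}.
Implicit Types u v w : X.
Local Notation sgn := (@cl_sign R d).
Local Notation e := (@cl_basis R d).

Lemma hm_normE (v : X) : hm_norm v = `|v|.
Proof. by []. Qed.

(** The scalar part of the Clifford-valued inner product; with it the module is
    a real Hilbert space. *)
Definition rip (v w : X) : R := \sum_A ip (v A) (w A).

Lemma hilbert_rip : hilbert_inner rip.
Proof.
split => [u v|a u v w|u].
- by apply: eq_bigr => A _; exact: (ipC hip).
- rewrite /rip mulr_sumr -big_split; apply: eq_bigr => A _.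
  by rewrite !ffunE (ip_lin hip).
- rewrite l2normE sqr_sqrtr; last exact: sum_sqr_ge0.
  by apply: eq_bigr => A _; rewrite (ipE hip).
Qed.

Lemma hm_lmulE s v C :
  hm_lmul s v C = \sum_B (s B * sgn B (symdiff B C)) *: v (symdiff B C).
Proof.
rewrite /hm_lmul exchange_big sum_ffunE; apply: eq_bigr => B _; rewrite sum_ffunE.
rewrite (bigD1 (symdiff B C))//= ffunE symdiffKl eqxx.
by rewrite big1 ?addr0// => A neA; rewrite ffunE eq_symdiff (negbTE neA).
Qed.

Lemma hm_rmulE s v C :
  hm_rmul v s C = \sum_B (s B * sgn (symdiff C B) B) *: v (symdiff C B).
Proof.
rewrite /hm_rmul exchange_big sum_ffunE; apply: eq_bigr => B _; rewrite sum_ffunE.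
rewrite (bigD1 (symdiff C B))//= ffunE (symdiffKr B C) eqxx.
rewrite big1 ?addr0// => A neA; rewrite ffunE symdiffC eq_symdiff symdiffC.
by rewrite (negbTE neA).
Qed.

Lemma hm_lmul_basisE A v C :
  hm_lmul (e A) v C = sgn A (symdiff A C) *: v (symdiff A C).
Proof.
rewrite hm_lmulE (bigD1 A)//= ffunE eqxx mul1r big1 ?addr0// => B BA.
by rewrite ffunE (negbTE BA) mul0r scale0r.
Qed.

Lemma hm_rmul_basisE A v C :
  hm_rmul v (e A) C = sgn (symdiff C A) A *: v (symdiff C A).
Proof.
rewrite hm_rmulE (bigD1 A)//= ffunE eqxx mul1r big1 ?addr0// => B BA.
by rewrite ffunE (negbTE BA) mul0r scale0r.
Qed.

Lemma hm_lmulDr s v w : hm_lmul s (v + w) = hm_lmul s v + hm_lmul s w.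
Proof.
apply/ffunP => C; rewrite ffunE !hm_lmulE -big_split; apply: eq_bigr => B _.
by rewrite ffunE scalerDr.
Qed.

Lemma hm_lmulZr s k v : hm_lmul s (k *: v) = k *: hm_lmul s v.
Proof.
apply/ffunP => C; rewrite ffunE !hm_lmulE scaler_sumr; apply: eq_bigr => B _.
by rewrite ffunE !scalerA mulrC.
Qed.

Lemma hm_lmulDl s t v : hm_lmul (s + t) v = hm_lmul s v + hm_lmul t v.
Proof.
apply/ffunP => C; rewrite ffunE !hm_lmulE -big_split; apply: eq_bigr => B _.
by rewrite ffunE mulrDl scalerDl.
Qed.

Lemma hm_lmulZl k s v : hm_lmul (k *: s) v = k *: hm_lmul s v.
Proof.
apply/ffunP => C; rewrite ffunE !hm_lmulE scaler_sumr; apply: eq_bigr => B _.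
by rewrite ffunE scalerA /GRing.scale/= mulrA.
Qed.

Lemma hm_lmulNl s v : hm_lmul (- s) v = - hm_lmul s v.
Proof. by rewrite -scaleN1r hm_lmulZl scaleN1r. Qed.

Lemma hm_lmulNr s v : hm_lmul s (- v) = - hm_lmul s v.
Proof. by rewrite -scaleN1r hm_lmulZr scaleN1r. Qed.

Lemma hm_lmulBr s v w : hm_lmul s (v - w) = hm_lmul s v - hm_lmul s w.
Proof. by rewrite hm_lmulDr hm_lmulNr. Qed.

Lemma hm_lmulBl s t v : hm_lmul (s - t) v = hm_lmul s v - hm_lmul t v.
Proof. by rewrite hm_lmulDl hm_lmulNl. Qed.

Lemma hm_lmul1 v : hm_lmul (e finset.set0) v = v.
Proof. by apply/ffunP => C; rewrite hm_lmul_basisE symdiff0 cl_sign0l scale1r. Qed.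

Lemma hm_lmul_decomp s v : hm_lmul s v = \sum_A s A *: hm_lmul (e A) v.
Proof.
apply/ffunP => C; rewrite hm_lmulE sum_ffunE; apply: eq_bigr => A _.
by rewrite ffunE hm_lmul_basisE scalerA.
Qed.

Lemma hm_lmulM s t v : hm_lmul (cl_mul s t) v = hm_lmul s (hm_lmul t v).
Proof.
apply/ffunP => C; rewrite [RHS]hm_lmulE hm_lmulE.
under eq_bigr do rewrite cl_mulE mulr_suml scaler_suml.
rewrite exchange_big; apply: eq_bigr => A _ /=.
rewrite hm_lmulE scaler_sumr [LHS](reindex_symdiffl A); apply: eq_bigr => B _.
rewrite symdiffKl scalerA -symdiffA; have -> : symdiff B (symdiff A C) = symdiff A (symdiff B C).
  by rewrite !symdiffA [symdiff B A]symdiffC.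
congr (_ *: _); rewrite !(cl_signMl, cl_signMr).
have := cl_sign_sqr (R := R) A B.
move: (sgn A A) (sgn A B) (sgn A C) (sgn B A) (sgn B B) (sgn B C) => aa ab ac ba bb bc E.
transitivity (s A * t B * (ab * ab) * aa * ac * ba * bb * bc); first by ring.
by rewrite E; ring.
Qed.

Lemma hm_rmulDl s v w : hm_rmul (v + w) s = hm_rmul v s + hm_rmul w s.
Proof.
apply/ffunP => C; rewrite ffunE !hm_rmulE -big_split; apply: eq_bigr => B _.
by rewrite ffunE scalerDr.
Qed.

Lemma hm_rmulZl s k v : hm_rmul (k *: v) s = k *: hm_rmul v s.
Proof.
apply/ffunP => C; rewrite ffunE !hm_rmulE scaler_sumr; apply: eq_bigr => B _.
by rewrite ffunE !scalerA mulrC.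
Qed.

Lemma hm_rmulNl s v : hm_rmul (- v) s = - hm_rmul v s.
Proof. by rewrite -scaleN1r hm_rmulZl scaleN1r. Qed.

Lemma hm_rmulBl s v w : hm_rmul (v - w) s = hm_rmul v s - hm_rmul w s.
Proof. by rewrite hm_rmulDl hm_rmulNl. Qed.

Lemma hm_rmul_scalar k v : hm_rmul v (k *: e finset.set0) = k *: v.
Proof.
apply/ffunP => C; rewrite hm_rmulE (bigD1 finset.set0)//= !ffunE eqxx symdiffr0 cl_sign0r.
rewrite [k *: _]mulr1 mulr1 big1 ?addr0// => B B0.
by rewrite !ffunE (negbTE B0) scaler0 mul0r scale0r.
Qed.

Lemma hm_rmul_decomp s v : hm_rmul v s = \sum_A s A *: hm_rmul v (e A).
Proof.
apply/ffunP => C; rewrite hm_rmulE sum_ffunE; apply: eq_bigr => A _.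
by rewrite ffunE hm_rmul_basisE scalerA.
Qed.

Lemma hm_lrmul A B v :
  hm_lmul (e A) (hm_rmul v (e B)) = hm_rmul (hm_lmul (e A) v) (e B).
Proof.
apply/ffunP => C; rewrite hm_lmul_basisE !hm_rmul_basisE hm_lmul_basisE !scalerA symdiffA.
by congr (_ *: _); rewrite !(cl_signMl, cl_signMr); ring.
Qed.

(** Multiplication by e_A permutes the components up to signs. *)
Lemma rip_lmul_basis A v w :
  rip (hm_lmul (e A) v) w = sgn A A * rip v (hm_lmul (e A) w).
Proof.
rewrite /rip (reindex_symdiffl A) mulr_sumr; apply: eq_bigr => C _.
rewrite !hm_lmul_basisE symdiffKl (ipZl hip) (ipZr hip) mulrA.
by congr (_ * _); rewrite cl_signMr mulrA cl_sign_sqr mul1r.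
Qed.

Lemma rip_rmul_basis A v w :
  rip (hm_rmul v (e A)) w = sgn A A * rip v (hm_rmul w (e A)).
Proof.
rewrite /rip (reindex_symdiffr A) mulr_sumr; apply: eq_bigr => C _.
rewrite !hm_rmul_basisE (symdiffKr A C) (ipZl hip) (ipZr hip) mulrA.
congr (_ * _); rewrite cl_signMl mulrCA cl_sign_sqr mulr1 //.
Qed.

Lemma rip_lmul s v w : rip (hm_lmul s v) w = rip v (hm_lmul (cl_conj s) w).
Proof.
rewrite hm_lmul_decomp (ip_suml hilbert_rip) [in RHS]hm_lmul_decomp.
rewrite (ipC hilbert_rip v) (ip_suml hilbert_rip); apply: eq_bigr => A _.
rewrite !(ipZl hilbert_rip) rip_lmul_basis cl_conjE (ipC hilbert_rip v).
by rewrite mulrA [s A * _]mulrC.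
Qed.

(** The other components of the Clifford-valued inner product are scalar
    products as well, against the right multiples of the second vector. *)
Lemma hm_ipE v w C : hm_ip ip v w C = sgn C C * rip v (hm_rmul w (e C)).
Proof.
rewrite /hm_ip sum_ffunE /rip mulr_sumr; apply: eq_bigr => A _; rewrite sum_ffunE.
rewrite (bigD1 (symdiff A C))//= big1 ?addr0; last first.
  move=> B BC; rewrite conj_basis cl_mulZl cl_mul_basis !ffunE eq_symdiff.
  by rewrite (negbTE BC) !scaler0.
rewrite conj_basis cl_mulZl cl_mul_basis !ffunE symdiffKl eqxx hm_rmul_basisE (ipZr hip).
rewrite /GRing.scale/= mulr1 !(cl_signMl, cl_signMr) mulrA mulrC mulrA.
have := cl_sign_sqr (R := R) A A; have := cl_sign_sqr (R := R) C C.
move: (sgn A A) (sgn A C) (sgn C C) (ip _ _) => a b c r cc aa.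
transitivity ((a * a) * b * r); first by ring.
by rewrite aa; transitivity ((c * c) * b * r); [rewrite cc|ring].
Qed.

Lemma hm_ip_ext v w v' w' :
  (forall A, rip v (hm_rmul w (e A)) = rip v' (hm_rmul w' (e A))) ->
  hm_ip ip v w = hm_ip ip v' w'.
Proof. by move=> E; apply/ffunP => A; rewrite !hm_ipE E. Qed.

Lemma hm_ip_scalar v w : hm_ip ip v w finset.set0 = rip v w.
Proof.
by rewrite hm_ipE cl_sign0l mul1r -[e _]scale1r hm_rmul_scalar scale1r.
Qed.

Lemma hm_lmul_bounded s : exists2 C : R, 0 <= C & forall v, `|hm_lmul s v| <= C * `|v|.
Proof.
have basis A v : `|hm_lmul (e A) v| = `|v|.
  rewrite !l2normE; congr Num.sqrt; rewrite [RHS](reindex_symdiffl A).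
  apply: eq_bigr => B _; rewrite hm_lmul_basisE normrZ.
  have -> : `|sgn A (symdiff A B)| = 1 by rewrite /cl_sign normrX normrN1 expr1n.
  by rewrite mul1r.
exists (\sum_A `|s A|); first by apply: sumr_ge0.
move=> v; rewrite hm_lmul_decomp (le_trans (ler_norm_sum _ _ _))//.
by rewrite mulr_suml; apply: ler_sum => A _; rewrite normrZ basis.
Qed.

Lemma hm_lmul_imag_unit (J : 'rV[R]_d.+1) v : imag_unit J ->
  hm_lmul (pv_val J) (hm_lmul (pv_val J) v) = - v.
Proof. by move=> HJ; rewrite -hm_lmulM imag_unit_sqr// hm_lmulNl hm_lmul1. Qed.

End HilbertModules.

(** * Resolvents *)

Section RightLinear.
Context {R : realType} {d : nat} {H : completeNormedModType R}.
Local Notation X := {ffun {set 'I_d} -> H}.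
Variables (T : operator d H) (Tlin : op_rlinear T).
Implicit Types u v w : X.

Lemma op_domD u v : op_dom T u -> op_dom T v -> op_dom T (u + v).
Proof. by case: Tlin => _ h _ hu hv; case: (h u v). Qed.

Lemma op_funD u v : op_dom T u -> op_dom T v ->
  op_fun T (u + v) = op_fun T u + op_fun T v.
Proof. by case: Tlin => _ h _ hu hv; case: (h u v). Qed.

Lemma op_domZ (k : R) v : op_dom T v -> op_dom T (k *: v).
Proof. by case: Tlin => _ _ h /(h _ (k *: cl_basis finset.set0))[]; rewrite hm_rmul_scalar. Qed.

Lemma op_funZ (k : R) v : op_dom T v -> op_fun T (k *: v) = k *: op_fun T v.
Proof.
by case: Tlin => _ _ h /(h _ (k *: cl_basis finset.set0))[_]; rewrite !hm_rmul_scalar.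
Qed.

Lemma op_domB u v : op_dom T u -> op_dom T v -> op_dom T (u - v).
Proof. by move=> hu hv; rewrite -scaleN1r; apply: op_domD => //; exact: op_domZ. Qed.

Lemma op_funB u v : op_dom T u -> op_dom T v ->
  op_fun T (u - v) = op_fun T u - op_fun T v.
Proof.
move=> hu hv; rewrite -scaleN1r op_funD//; last exact: op_domZ.
by rewrite op_funZ// scaleN1r.
Qed.

Lemma op_dom_rmul v s : op_dom T v -> op_dom T (hm_rmul v s).
Proof. by case: Tlin => _ _ h /(h v s)[]. Qed.

Lemma op_fun_rmul v s : op_dom T v -> op_fun T (hm_rmul v s) = hm_rmul (op_fun T v) s.
Proof. by case: Tlin => _ _ h /(h v s)[]. Qed.

Lemma op_fun0 : op_fun T 0 = 0.
Proof. by rewrite -[0 in LHS](scale0r 0) op_funZ ?scale0r//; case: Tlin. Qed.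

End RightLinear.

Section Inverse.
Context {R : realType} {d : nat} {H : completeNormedModType R}.
Local Notation X := {ffun {set 'I_d} -> H}.
Variables (T : operator d H).
Implicit Types u v w : X.

Lemma op_invK v : op_injective T -> op_dom T v ->
  op_fun (op_inv T) (op_fun T v) = v.
Proof.
move=> inj dv; rewrite /op_inv/=.
case: xgetP => [u -> [du e]|/(_ v)]; first exact: inj e.
by case; split.
Qed.

Lemma op_invP w : op_dom (op_inv T) w ->
  op_dom T (op_fun (op_inv T) w) /\ op_fun T (op_fun (op_inv T) w) = w.
Proof.
move=> [v dv e]; rewrite /op_inv/=.
by case: xgetP => [u -> //|/(_ v)]; case; split.
Qed.

Lemma op_inv_rlinear : op_rlinear T -> op_injective T -> op_rlinear (op_inv T).
Proof.
move=> Tlin inj; have [T0 TD Ts] := Tlin; split.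
- by exists 0 => //; exact: op_fun0.
- move=> _ _ [u du <-] [v dv <-]; have [duv e] := TD u v du dv.
  by rewrite -e; split; [exists (u + v)|rewrite !op_invK].
- move=> _ s [v dv <-]; have [dvs e] := Ts v s dv.
  by rewrite -e; split; [exists (hm_rmul v s)|rewrite !op_invK].
Qed.

End Inverse.

Section Resolvent.
Context {R : realType} {d : nat} {H : completeNormedModType R}.
Local Notation X := {ffun {set 'I_d} -> H}.
Implicit Types (u v w : X) (p q : R * R).
Variable (ip : H -> H -> R).
Hypothesis (hip : hilbert_inner ip).
Let hX : hilbert_inner (rip (d := d) ip) := hilbert_rip hip.
Local Notation "<< u , w >>" := (rip ip u w) (at level 0).

Definition Q_plane (T : operator d H) p : operator d H :=
  Operator [set v | op_dom T v /\ op_dom T (op_fun T v)]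
    (fun v => op_fun T (op_fun T v) - (2 * p.1) *: op_fun T v
              + (p.1 ^+ 2 + p.2 ^+ 2) *: v).

Definition rho_plane (T : operator d H) : set (R * R) :=
  [set p | op_injective (Q_plane T p) /\ op_bounded (op_inv (Q_plane T p))].

(** Q_s[T] depends on the real part and the modulus of s only. *)
Lemma Q_op_slice (T : operator d H) (J : 'rV[R]_d.+1) x y : imag_unit J ->
  Q_op (slice J x y) T = Q_plane T (x, y).
Proof.
move=> HJ; have [J0 _] := HJ; rewrite /Q_op /Q_plane /=; congr Operator; apply/funext => v.
have -> : slice J x y 0 0 = x by rewrite !mxE J0 eqxx mulr1 mulr0 addr0.
suff -> : pv_norm (slice J x y) ^+ 2 = x ^+ 2 + y ^+ 2 by [].
rewrite sqr_sqrtr; last by apply: sumr_ge0 => i _; exact: sqr_ge0.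
rewrite big_ord_recl !mxE J0 eqxx mulr1 mulr0 addr0; congr (_ + _).
rewrite -[RHS]mulr1 -(imag_unit_sum HJ) mulr_sumr.
by apply: eq_bigr => i _; rewrite !mxE/= mulr0 add0r exprMn.
Qed.

Lemma rho_S_slice (T : operator d H) (J : 'rV[R]_d.+1) x y : imag_unit J ->
  rho_S T (slice J x y) = rho_plane T (x, y).
Proof. by move=> HJ; rewrite /rho_S /rho_plane /= Q_op_slice. Qed.

Lemma Q_plane_rlinear (T : operator d H) p : op_rlinear T -> op_rlinear (Q_plane T p).
Proof.
move=> Tlin; split => /=.
- by rewrite (op_fun0 Tlin); case: Tlin.
- move=> u v [du du'] [dv dv']; rewrite (op_funD Tlin)//; split.
    by split; exact: op_domD.
  apply: (ip_ext hX) => w.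
  by rewrite (op_funD Tlin)// !(ipDl hX, ipNl hX, ipZl hX); ring.
- move=> v s [dv dv']; rewrite (op_fun_rmul Tlin)//; split.
    by split; exact: op_dom_rmul.
  by rewrite (op_fun_rmul Tlin)// hm_rmulDl hm_rmulBl !hm_rmulZl.
Qed.

Section Fixed.
Variables (T : operator d H) (Tcl : op_closed T).
Let Tlin : op_rlinear T. Proof. by case: Tcl. Qed.

Definition Qinv p : X -> X := op_fun (op_inv (Q_plane T p)).

(** In the complex plane spanned by the real numbers and a formal imaginary
    unit j commuting with T, the operator (x + j y - T)^-1 is
    res_a - j res_b. *)
Definition res_a p v : X := p.1 *: Qinv p v - op_fun T (Qinv p v).
Definition res_b p v : X := p.2 *: Qinv p v.

Section Point.
Variables (p : R * R) (hp : rho_plane T p).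

Lemma Qinv_dom v : op_dom T (Qinv p v) /\ op_dom T (op_fun T (Qinv p v)).
Proof.
have [_ [_ dT _]] := hp; have : op_dom (op_inv (Q_plane T p)) v by rewrite dT.
by case/op_invP.
Qed.

Lemma QinvK v : op_fun T (op_fun T (Qinv p v)) =
  v + (2 * p.1) *: op_fun T (Qinv p v) - (p.1 ^+ 2 + p.2 ^+ 2) *: Qinv p v.
Proof.
have [_ [_ dT _]] := hp; have : op_dom (op_inv (Q_plane T p)) v by rewrite dT.
case/op_invP => _ /= E; rewrite -[X in _ = X + _ - _]E -/(Qinv p v).
by apply: (ip_ext hX) => w; rewrite !(ipDl hX, ipNl hX, ipZl hX); ring.
Qed.

Lemma Qinv_Q v : op_dom T v -> op_dom T (op_fun T v) ->
  Qinv p (op_fun (Q_plane T p) v) = v.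
Proof. by move=> dv dv'; rewrite /Qinv op_invK//; case: hp. Qed.

Lemma Qinv_rlinear : op_rlinear (op_inv (Q_plane T p)).
Proof. by case: hp => _ []. Qed.

Let Qdom v : op_dom (op_inv (Q_plane T p)) v.
Proof. by case: hp => _ [_ -> _]. Qed.

Lemma QinvD u v : Qinv p (u + v) = Qinv p u + Qinv p v.
Proof. exact: op_funD Qinv_rlinear _ _ (Qdom _) (Qdom _). Qed.

Lemma QinvZ (k : R) v : Qinv p (k *: v) = k *: Qinv p v.
Proof. exact: op_funZ Qinv_rlinear _ _ (Qdom _). Qed.

Lemma QinvB u v : Qinv p (u - v) = Qinv p u - Qinv p v.
Proof. exact: op_funB Qinv_rlinear _ _ (Qdom _) (Qdom _). Qed.

Lemma Qinv_rmul v s : Qinv p (hm_rmul v s) = hm_rmul (Qinv p v) s.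
Proof. exact: op_fun_rmul Qinv_rlinear _ _ (Qdom _). Qed.

Lemma Qinv_bounded : exists2 C : R, 0 <= C & forall v, `|Qinv p v| <= C * `|v|.
Proof.
have [_ [_ _ [M HM]]] := hp; exists `|M| => // v.
by apply: le_trans (HM v) _; rewrite hm_normE ler_wpM2r// ler_norm.
Qed.

Lemma Qinv_comm v : op_dom T v -> op_fun T (Qinv p v) = Qinv p (op_fun T v).
Proof.
move=> dv; have [d1 d2] := Qinv_dom v; have E := QinvK v.
have d3 : op_dom T (op_fun T (op_fun T (Qinv p v))).
  by rewrite E; apply: (op_domB Tlin); [apply: (op_domD Tlin) => //|]; exact: op_domZ.
rewrite -[LHS](Qinv_Q d2 d3) /Q_plane/=; congr (Qinv p _).
rewrite {1}E (op_funB Tlin) ?(op_funD Tlin) ?(op_funZ Tlin)//; try exact: op_domZ.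
  by apply: (ip_ext hX) => w; rewrite !(ipDl hX, ipNl hX, ipZl hX); ring.
by apply: (op_domD Tlin) => //; exact: op_domZ.
Qed.

(** T Q_p[T]^-1 is everywhere defined and closed, hence bounded. *)
Lemma TQinv_bounded :
  exists2 C : R, 0 <= C & forall v, `|op_fun T (Qinv p v)| <= C * `|v|.
Proof.
apply: (closed_graph (S := fun v => op_fun T (Qinv p v))) => [u v|k u|u v w uv Tuw].
- by rewrite QinvD (op_funD Tlin)//; case: (Qinv_dom u) (Qinv_dom v) => ? _ [].
- by rewrite QinvZ (op_funZ Tlin)//; case: (Qinv_dom u).
have [_ cl] := Tcl; have [C C0 HC] := Qinv_bounded.
have [||| _ //] := cl (fun n => Qinv p (u n)) (Qinv p v) w.
- by move=> n; case: (Qinv_dom (u n)).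
- apply/cvgrPdist_le => e e0.
  have C10 : 0 < C + 1 by rewrite ltr_wpDl.
  have e1 : 0 < e / (C + 1) by rewrite divr_gt0.
  move/cvgrPdist_le : uv => /(_ _ e1); apply: filterS => n un.
  rewrite sub0r normrN ger0_norm ?sqrtr_ge0// hm_normE -QinvB.
  apply: le_trans (HC _) _; rewrite distrC in un.
  apply: (@le_trans _ _ ((C + 1) * (e / (C + 1)))).
    by apply: ler_pM => //; rewrite lerDl.
  by rewrite mulrC divfK// gt_eqF.
- apply/cvgrPdist_le => e e0.
  move/cvgrPdist_le : Tuw => /(_ _ e0); apply: filterS => n un.
  by rewrite sub0r normrN ger0_norm ?sqrtr_ge0// hm_normE distrC.
Qed.

Lemma res_a_dom v : op_dom T (res_a p v).
Proof.
by have [d1 d2] := Qinv_dom v; apply: (op_domB Tlin) => //; exact: op_domZ.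
Qed.

Lemma res_b_dom v : op_dom T (res_b p v).
Proof. by have [d1 d2] := Qinv_dom v; exact: op_domZ. Qed.

Lemma res_aD u v : res_a p (u + v) = res_a p u + res_a p v.
Proof.
rewrite /res_a QinvD (op_funD Tlin); try by case: (Qinv_dom u) (Qinv_dom v) => ? _ [].
by rewrite scalerDr opprD addrACA.
Qed.

Lemma res_aZ (k : R) v : res_a p (k *: v) = k *: res_a p v.
Proof.
rewrite /res_a QinvZ (op_funZ Tlin); last by case: (Qinv_dom v).
by rewrite scalerBr !scalerA mulrC.
Qed.

Lemma res_aB u v : res_a p (u - v) = res_a p u - res_a p v.
Proof. by rewrite -scaleN1r res_aD res_aZ scaleN1r. Qed.

Lemma res_a_rmul v s : res_a p (hm_rmul v s) = hm_rmul (res_a p v) s.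
Proof.
rewrite /res_a Qinv_rmul (op_fun_rmul Tlin); last by case: (Qinv_dom v).
by rewrite hm_rmulBl hm_rmulZl.
Qed.

Lemma res_bD u v : res_b p (u + v) = res_b p u + res_b p v.
Proof. by rewrite /res_b QinvD scalerDr. Qed.

Lemma res_bZ (k : R) v : res_b p (k *: v) = k *: res_b p v.
Proof. by rewrite /res_b QinvZ !scalerA mulrC. Qed.

Lemma res_bB u v : res_b p (u - v) = res_b p u - res_b p v.
Proof. by rewrite -scaleN1r res_bD res_bZ scaleN1r. Qed.

Lemma res_b_rmul v s : res_b p (hm_rmul v s) = hm_rmul (res_b p v) s.
Proof. by rewrite /res_b Qinv_rmul hm_rmulZl. Qed.

(** The real and imaginary parts of (z - T) (z - T)^-1 = 1, z = x + j y, and of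
    (z - T)^-1 (z - T) = 1. *)
Lemma res_right_re v :
  op_fun T (res_a p v) = p.1 *: res_a p v + p.2 *: res_b p v - v.
Proof.
have [d1 d2] := Qinv_dom v; rewrite {1}/res_a (op_funB Tlin)// ?(op_funZ Tlin)//;
  last exact: op_domZ.
rewrite QinvK /res_a /res_b; apply: (ip_ext hX) => w.
by rewrite !(ipDl hX, ipNl hX, ipZl hX); ring.
Qed.

Lemma res_right_im v : op_fun T (res_b p v) = p.1 *: res_b p v - p.2 *: res_a p v.
Proof.
have [d1 d2] := Qinv_dom v; rewrite {1}/res_b (op_funZ Tlin)//.
rewrite /res_a /res_b; apply: (ip_ext hX) => w.
by rewrite !(ipDl hX, ipNl hX, ipZl hX); ring.
Qed.

Lemma res_a_comm v : op_dom T v -> res_a p (op_fun T v) = op_fun T (res_a p v).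
Proof.
move=> dv; have [d1 d2] := Qinv_dom v; rewrite /res_a -(Qinv_comm dv).
by rewrite (op_funB Tlin)// ?(op_funZ Tlin)//; exact: op_domZ.
Qed.

Lemma res_b_comm v : op_dom T v -> res_b p (op_fun T v) = op_fun T (res_b p v).
Proof.
move=> dv; have [d1 d2] := Qinv_dom v.
by rewrite /res_b -(Qinv_comm dv) (op_funZ Tlin).
Qed.

End Point.

(** The resolvent identity R_p - R_q = (q - p) R_p R_q in components. *)
Lemma res_identity p q v : rho_plane T p -> rho_plane T q ->
  res_a p v - res_a q v =
    (q.1 - p.1) *: (res_a p (res_a q v) - res_b p (res_b q v)) +
    (q.2 - p.2) *: (res_a p (res_b q v) + res_b p (res_a q v)) /\
  res_b p v - res_b q v =
    (q.1 - p.1) *: (res_a p (res_b q v) + res_b p (res_a q v)) -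
    (q.2 - p.2) *: (res_a p (res_a q v) - res_b p (res_b q v)).
Proof.
move=> hp hq; have da := res_a_dom hq v; have db := res_b_dom hq v.
have ra := res_right_re hq v; have rb := res_right_im hq v.
(* v = (q - T) R_q v, to which R_p is applied in both components *)
have va : v = q.1 *: res_a q v + q.2 *: res_b q v - op_fun T (res_a q v).
  by rewrite ra opprB addrCA subrr addr0.
have vb : 0 = q.1 *: res_b q v - q.2 *: res_a q v - op_fun T (res_b q v).
  by rewrite rb subrr.
move: (res_a q v) (res_b q v) da db va vb {ra rb} => a b da db va vb.
have a1 : res_a p v = q.1 *: res_a p a + q.2 *: res_a p b
    - (p.1 *: res_a p a + p.2 *: res_b p a - a).
  rewrite {1}va (res_aB hp) (res_aD hp) !(res_aZ hp) (res_a_comm hp da).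
  by rewrite (res_right_re hp).
have b1 : 0 = q.1 *: res_b p b - q.2 *: res_b p a
    - (p.1 *: res_b p b - p.2 *: res_a p b).
  have : res_b p 0 = 0 by rewrite -[0 in LHS](scale0r 0) (res_bZ hp) scale0r.
  rewrite {1}vb !(res_bB hp) !(res_bZ hp) (res_b_comm hp db).
  by rewrite (res_right_im hp) => ->.
have b2 : res_b p v = q.1 *: res_b p a + q.2 *: res_b p b
    - (p.1 *: res_b p a - p.2 *: res_a p a).
  rewrite {1}va (res_bB hp) (res_bD hp) !(res_bZ hp) (res_b_comm hp da).
  by rewrite (res_right_im hp).
have a2 : 0 = q.1 *: res_a p b - q.2 *: res_a p a
    - (p.1 *: res_a p b + p.2 *: res_b p b - b).
  have : res_a p 0 = 0 by rewrite -[0 in LHS](scale0r 0) (res_aZ hp) scale0r.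
  rewrite {1}vb !(res_aB hp) !(res_aZ hp) (res_a_comm hp db).
  by rewrite (res_right_re hp) => ->.
have pair (u u' : X) w : u = u' -> <<u, w>> = <<u', w>> by move->.
split; apply: (ip_ext hX) => w.
  have := pair _ _ w a1; have := pair _ _ w b1.
  by rewrite !(ipDl hX, ipNl hX, ipZl hX, ip0l hX); lra.
have := pair _ _ w b2; have := pair _ _ w a2.
by rewrite !(ipDl hX, ipNl hX, ipZl hX, ip0l hX); lra.
Qed.

(** For q near p, Q_q[T] is a small perturbation (1 + E) Q_p[T], which Neumann's
    series inverts. *)
Lemma rho_plane_near p : rho_plane T p -> exists C : R, \forall q \near p,
  rho_plane T q /\ forall v, `|Qinv q v| <= C * `|v| /\ `|op_fun T (Qinv q v)| <= C * `|v|.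
Proof.
move=> hp; have [C C0 HC] := Qinv_bounded hp; have [D D0 HD] := TQinv_bounded hp.
exists (2 * (C + D)).
pose c1 (q : R * R) := 2 * (p.1 - q.1).
pose c2 (q : R * R) := (q.1 ^+ 2 + q.2 ^+ 2) - (p.1 ^+ 2 + p.2 ^+ 2).
have small : \forall q \near p, (`|c1 q| + `|c2 q|) * (C + D) <= 2^-1.
  have ccc : {for p, continuous (fun q => (`|c1 q| + `|c2 q|) * (C + D))}.
    apply: continuousM; last exact: cvg_cst.
    apply: continuousD.
      apply: (@continuous_comp _ _ _ c1 (fun x => `|x|)); last exact: norm_continuous.
      apply: continuousM; first exact: cvg_cst.
      by apply: continuousB; [exact: cvg_cst|exact: cvg_fst].
    apply: (@continuous_comp _ _ _ c2 (fun x => `|x|)); last exact: norm_continuous.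
    apply: continuousB; last exact: cvg_cst.
    apply: continuousD.
      by apply: (@continuousM _ _ fst fst); exact: cvg_fst.
    by apply: (@continuousM _ _ snd snd); exact: cvg_snd.
  have := ccc; rewrite /prop_for /continuous_at {2}/c1 {2}/c2 !subrr mulr0 normr0 addr0 mul0r.
  move=> /cvgrPdist_le/(_ 2^-1); rewrite invr_gt0 => /(_ (ltr0Sn _ 1)).
  apply: filterS => q; rewrite sub0r normrN ger0_norm//.
  by rewrite mulr_ge0 ?addr_ge0.
apply: filterS small => q small.
pose E v : X := c1 q *: op_fun T (Qinv p v) + c2 q *: Qinv p v.
have ED u v : E (u + v) = E u + E v.
  have [du _] := Qinv_dom hp u; have [dv _] := Qinv_dom hp v.
  by rewrite /E (QinvD hp) (op_funD Tlin)// !scalerDr addrACA.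
have Ehalf v : `|E v| <= 2^-1 * `|v|.
  apply: le_trans (ler_normD _ _) _; rewrite (normrZ (c1 q)) (normrZ (c2 q)).
  apply: (@le_trans _ _ ((`|c1 q| + `|c2 q|) * (C + D) * `|v|)).
    have h1 : `|c1 q| * `|op_fun T (Qinv p v)| <= `|c1 q| * (D * `|v|).
      by rewrite ler_wpM2l.
    have h2 : `|c2 q| * `|Qinv p v| <= `|c2 q| * (C * `|v|) by rewrite ler_wpM2l.
    have h3 : 0 <= `|c1 q| * (C * `|v|) by rewrite !mulr_ge0.
    have h4 : 0 <= `|c2 q| * (D * `|v|) by rewrite !mulr_ge0.
    apply: le_trans (lerD h1 h2) _.
    rewrite -subr_ge0.
    have -> : (`|c1 q| + `|c2 q|) * (C + D) * `|v| -
      (`|c1 q| * (D * `|v|) + `|c2 q| * (C * `|v|)) =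
      `|c1 q| * (C * `|v|) + `|c2 q| * (D * `|v|) by ring.
    exact: addr_ge0.
  by rewrite ler_wpM2r.
have QE v : op_fun (Q_plane T q) (Qinv p v) = v + E v.
  rewrite /Q_plane/= (QinvK hp) /E; apply: (ip_ext hX) => w.
  by rewrite !(ipDl hX, ipNl hX, ipZl hX) /c1 /c2; ring.
have Qq_lin := Q_plane_rlinear q Tlin.
have inj : op_injective (Q_plane T q).
  move=> u u' du du' e.
  have [duu1 duu2] := op_domB Qq_lin du du'.
  have := op_funB Qq_lin du du'; rewrite e subrr.
  rewrite -[u - u'](Qinv_Q hp duu1 duu2) QE.
  set z := op_fun (Q_plane T p) (u - u') => /eqP.
  rewrite addrC addr_eq0 => /eqP Ez.
  have : `|z| <= 2^-1 * `|z| by rewrite -[leLHS]normrN -Ez.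
  move=> zle; have z0 : z = 0.
    by apply/eqP; rewrite -normr_le0; have := normr_ge0 z; lra.
  move: (Qinv_Q hp duu1 duu2); rewrite -/z z0.
  have -> : Qinv p 0 = 0 by rewrite -[0 in LHS](scale0r 0) (QinvZ hp) scale0r.
  by move=> /esym/eqP; rewrite subr_eq0 => /eqP.
have sol w : exists2 z, Qinv q w = Qinv p z & `|z| <= 2 * `|w|.
  have [z zE zw] := neumann ED Ehalf w; exists z => //.
  rewrite /Qinv -zE -QE op_invK//; exact: Qinv_dom.
have bnd v : `|Qinv q v| <= 2 * (C + D) * `|v| /\
    `|op_fun T (Qinv q v)| <= 2 * (C + D) * `|v|.
  have [z -> zv] := sol v.
  have h1 : C * `|z| <= C * (2 * `|v|) by rewrite ler_wpM2l.
  have h2 : D * `|z| <= D * (2 * `|v|) by rewrite ler_wpM2l.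
  have h3 : 0 <= C * (2 * `|v|) by rewrite !mulr_ge0.
  have h4 : 0 <= D * (2 * `|v|) by rewrite !mulr_ge0.
  have h5 := HC z; have h6 := HD z.
  split; [apply: le_trans h5 _|apply: le_trans h6 _];
    rewrite mulrAC mulrDr ![2 * `|v| * _]mulrC; lra.
split => //; split => //; split.
- exact: op_inv_rlinear.
- apply/seteqP; split => // w _; have [z zE _] := neumann ED Ehalf w.
  by exists (Qinv p z); [exact: Qinv_dom|rewrite QE].
- by exists (2 * (C + D)) => v; have [] := bnd v.
Qed.

End Fixed.
End Resolvent.

Section OperatorLimits.
Context {R : realType} {X : completeNormedModType R}.
Implicit Types (B : X -> X).

Definition bounded_op B := exists2 C : R, 0 <= C & forall v, `|B v| <= C * `|v|.

(** Convergence in the operator norm. *)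
Definition op_cvg {I : Type} (F : set_system I) (A : I -> X -> X) B :=
  forall eps : R, 0 < eps -> \forall i \near F, forall v, `|A i v - B v| <= eps * `|v|.

Context {I : Type} {F : set_system I} {FF : Filter F}.

Lemma op_cvg_cst B : op_cvg F (fun=> B) B.
Proof.
move=> e e0; apply: filterE => i v; rewrite subrr normr0 mulr_ge0// ltW//.
Qed.

Lemma op_cvgD A1 A2 B1 B2 : op_cvg F A1 B1 -> op_cvg F A2 B2 ->
  op_cvg F (fun i v => A1 i v + A2 i v) (fun v => B1 v + B2 v).
Proof.
move=> h1 h2 e e0; have e20 : 0 < e / 2 by rewrite divr_gt0.
apply: filterS2 (h1 _ e20) (h2 _ e20) => i k1 k2 v.
rewrite opprD addrACA [e]splitr mulrDl.
by apply: le_trans (ler_normD _ _) (lerD (k1 v) (k2 v)).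
Qed.

Lemma op_cvgZ (f : I -> R) (l : R) A B : f @ F --> l -> op_cvg F A B -> bounded_op B ->
  op_cvg F (fun i v => f i *: A i v) (fun v => l *: B v).
Proof.
move=> fl AB [C C0 HC] e e0.
have d0 : 0 < `|l| + 1 by rewrite ltr_wpDl.
have e1 : 0 < Num.min 1 (e / 2 / (C + 1)) by rewrite lt_min ltr01 !divr_gt0// ltr_wpDl.
have e2 : 0 < e / 2 / (`|l| + 1) by rewrite !divr_gt0.
have near1 := AB _ e2.
move/cvgrPdist_le : fl => /(_ _ e1) near2.
apply: filterS2 near1 near2 => i k1 k2 v.
move: k2; rewrite distrC le_min => /andP[k2 k3].
have -> : f i *: A i v - l *: B v = f i *: (A i v - B v) + (f i - l) *: B v.
  by rewrite scalerBr scalerBl addrA subrK.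
apply: le_trans (ler_normD _ _) _; rewrite !normrZ.
have h1 : `|f i| <= `|l| + 1.
  by rewrite -[f i](subrK l) addrC; apply: le_trans (ler_normD _ _) _; rewrite lerD2l.
have h2 : `|f i| * `|A i v - B v| <= (`|l| + 1) * (e / 2 / (`|l| + 1) * `|v|).
  by apply: ler_pM.
have h3 : `|f i - l| * `|B v| <= e / 2 / (C + 1) * ((C + 1) * `|v|).
  apply: ler_pM => //; apply: le_trans (HC v) _; by rewrite ler_wpM2r// lerDl.
apply: le_trans (lerD h2 h3) _.
have n1 : `|l| + 1 != 0 by rewrite gt_eqF.
have n2 : C + 1 != 0 by rewrite gt_eqF// ltr_wpDl.
by rewrite le_eqVlt; apply/orP; left; apply/eqP; field; rewrite n1 n2.
Qed.

Lemma op_cvgN A B : op_cvg F A B -> op_cvg F (fun i v => - A i v) (fun v => - B v).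
Proof.
by move=> h e e0; apply: filterS (h e e0) => i k v; rewrite -opprD normrN.
Qed.

Lemma op_cvgB A1 A2 B1 B2 : op_cvg F A1 B1 -> op_cvg F A2 B2 ->
  op_cvg F (fun i v => A1 i v - A2 i v) (fun v => B1 v - B2 v).
Proof. by move=> h1 h2; apply: op_cvgD => //; exact: op_cvgN. Qed.

Lemma op_cvg_comp A1 A2 B1 B2 : (forall u v, B1 (u - v) = B1 u - B1 v) ->
  bounded_op B1 -> bounded_op B2 -> op_cvg F A1 B1 -> op_cvg F A2 B2 ->
  op_cvg F (fun i v => A1 i (A2 i v)) (fun v => B1 (B2 v)).
Proof.
move=> B1B [C C0 HC] [D D0 HD] h1 h2 e e0.
have D1 : 0 < D + 1 by rewrite ltr_wpDl.
have C1 : 0 < C + 1 by rewrite ltr_wpDl.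
have e1 : 0 < e / 2 / (D + 1) by rewrite !divr_gt0.
have e2 : 0 < Num.min 1 (e / 2 / (C + 1)) by rewrite lt_min ltr01 !divr_gt0.
apply: filterS2 (h1 _ e1) (h2 _ e2) => i k1 k2 v.
have -> : A1 i (A2 i v) - B1 (B2 v) = (A1 i (A2 i v) - B1 (A2 i v)) + B1 (A2 i v - B2 v).
  by rewrite B1B addrA subrK.
have m1 : `|A2 i v - B2 v| <= `|v|.
  apply: le_trans (k2 v) _; rewrite -[leRHS]mul1r ler_wpM2r//.
  by rewrite ge_min lexx.
have m2 : `|A2 i v - B2 v| <= e / 2 / (C + 1) * `|v|.
  by apply: le_trans (k2 v) _; rewrite ler_wpM2r// ge_min lexx orbT.
have m3 : `|A2 i v| <= (D + 1) * `|v|.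
  rewrite -[A2 i v](subrK (B2 v)); apply: le_trans (ler_normD _ _) _.
  by rewrite mulrDl mul1r addrC lerD.
apply: le_trans (ler_normD _ _) _.
have n1 : `|A1 i (A2 i v) - B1 (A2 i v)| <= e / 2 / (D + 1) * ((D + 1) * `|v|).
  by apply: le_trans (k1 _) _; rewrite ler_wpM2l// ltW.
have n2 : `|B1 (A2 i v - B2 v)| <= (C + 1) * (e / 2 / (C + 1) * `|v|).
  by apply: le_trans (HC _) _; apply: ler_pM => //; rewrite lerDl.
apply: le_trans (lerD n1 n2) _.
have n3 : D + 1 != 0 by rewrite gt_eqF.
have n4 : C + 1 != 0 by rewrite gt_eqF.
by rewrite le_eqVlt; apply/orP; left; apply/eqP; field; rewrite n3 n4.
Qed.

Lemma op_cvg_ip (ip : X -> X -> R) A B v w : hilbert_inner ip ->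
  op_cvg F A B -> (fun i => ip (A i v) w) @ F --> ip (B v) w.
Proof.
move=> hip h; apply/cvgrPdist_le => e e0.
have K0 : 0 < `|v| * `|w| + 1 by rewrite ltr_wpDl// mulr_ge0.
have e1 : 0 < e / (`|v| * `|w| + 1) by rewrite divr_gt0.
apply: filterS (h _ e1) => i k.
rewrite distrC -(ipBl hip); apply: le_trans (ip_norm_le hip _ _) _.
apply: (@le_trans _ _ (e / (`|v| * `|w| + 1) * `|v| * `|w|)); first by rewrite ler_wpM2r.
rewrite -mulrA mulrAC ler_pdivrMr// ler_pM2l// lerDl//.
Qed.

Lemma op_cvg_sum (J : Type) (s : seq J) (A : J -> I -> X -> X) (B : J -> X -> X) :
  (forall j, op_cvg F (A j) (B j)) ->
  op_cvg F (fun i v => \sum_(j <- s) A j i v) (fun v => \sum_(j <- s) B j v).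
Proof.
move=> h; elim: s => [|j s IHs].
  move=> e e0; apply: filterE => i v.
  by rewrite !big_nil subrr normr0 mulr_ge0// ltW.
move=> e e0; apply: filterS (op_cvgD (h j) IHs e0) => i k v.
by rewrite !big_cons.
Qed.

Lemma bounded_opD B1 B2 : bounded_op B1 -> bounded_op B2 ->
  bounded_op (fun v => B1 v + B2 v).
Proof.
move=> [C C0 HC] [D D0 HD]; exists (C + D); first exact: addr_ge0.
by move=> v; rewrite mulrDl; apply: le_trans (ler_normD _ _) (lerD (HC v) (HD v)).
Qed.

Lemma bounded_opB B1 B2 : bounded_op B1 -> bounded_op B2 ->
  bounded_op (fun v => B1 v - B2 v).
Proof.
move=> h1 [D D0 HD]; apply: bounded_opD => //; exists D => // v.
by rewrite normrN.
Qed.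

Lemma bounded_op_comp B1 B2 : bounded_op B1 -> bounded_op B2 ->
  bounded_op (fun v => B1 (B2 v)).
Proof.
move=> [C C0 HC] [D D0 HD]; exists (C * D); first exact: mulr_ge0.
by move=> v; apply: le_trans (HC _) _; rewrite -mulrA ler_wpM2l.
Qed.

End OperatorLimits.

Section ResolventCalculus.
Context {R : realType} {d : nat} {H : completeNormedModType R}.
Local Notation X := {ffun {set 'I_d} -> H}.
Implicit Types (u v w : X) (p q : R * R).
Variables (ip : H -> H -> R) (hip : hilbert_inner ip).
Let hX : hilbert_inner (rip (d := d) ip) := hilbert_rip hip.
Local Notation "<< u , w >>" := (rip ip u w) (at level 0).
Variables (T : operator d H) (Tcl : op_closed T).
Local Notation ra := (res_a T).
Local Notation rb := (res_b T).
Local Notation rho := (rho_plane T).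

Lemma open_rho_plane : open rho.
Proof.
rewrite openE => p hp; have [C HC] := rho_plane_near hip Tcl hp.
by apply: filterS HC => q [].
Qed.

Lemma res_near p : rho p -> exists2 C : R, 0 <= C & \forall q \near p,
  rho q /\ forall v, `|ra q v| <= C * `|v| /\ `|rb q v| <= C * `|v|.
Proof.
move=> hp; have [C HC] := rho_plane_near hip Tcl hp.
have near_le (x y : R) : `|x - y| < 1 -> `|x| <= `|y| + 1.
  by move=> h; rewrite -lerBlDl; apply: le_trans (lerB_dist _ _) (ltW h).
have n1 : \forall q \near p, `|q.1| <= `|p.1| + 1.
  by apply: filterS (box_nbhs p ltr01) => q [/near_le].
have n2 : \forall q \near p, `|q.2| <= `|p.2| + 1.
  by apply: filterS (box_nbhs p ltr01) => q [_ /near_le].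
exists ((`|p.1| + `|p.2| + 2) * `|C|); first by rewrite mulr_ge0// addr_ge0// addr_ge0.
apply: filterS3 HC n1 n2 => q [hq bq] h1 h2; split => // v.
have [b1 b2] := bq v.
have b1' : `|Qinv T q v| <= `|C| * `|v|.
  by apply: le_trans b1 _; rewrite ler_wpM2r// ler_norm.
have b2' : `|op_fun T (Qinv T q v)| <= `|C| * `|v|.
  by apply: le_trans b2 _; rewrite ler_wpM2r// ler_norm.
have c0 : 0 <= `|C| * `|v| by rewrite mulr_ge0.
have m1 : `|q.1| * `|Qinv T q v| <= (`|p.1| + 1) * (`|C| * `|v|) by exact: ler_pM.
have m2 : `|q.2| * `|Qinv T q v| <= (`|p.2| + 1) * (`|C| * `|v|) by exact: ler_pM.
have m3 : 0 <= `|p.1| * (`|C| * `|v|) by rewrite mulr_ge0.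
have m4 : 0 <= `|p.2| * (`|C| * `|v|) by rewrite mulr_ge0.
rewrite -mulrA; split.
  apply: le_trans (ler_normB _ _) _; rewrite normrZ.
  apply: le_trans (lerD m1 b2') _; lra.
rewrite normrZ; apply: le_trans m2 _; lra.
Qed.

Lemma res_bounded p : rho p -> bounded_op (ra p) /\ bounded_op (rb p).
Proof.
move=> hp; have [C C0 /nbhs_singleton[_ h]] := res_near hp.
by split; exists C => // v; case: (h v).
Qed.

(** The resolvent identity makes p |-> (x + j y - T)^-1 continuous in norm. *)
Lemma res_cvg p : rho p -> op_cvg (nbhs p) ra (ra p) /\ op_cvg (nbhs p) rb (rb p).
Proof.
move=> hp; have [C C0 HC] := res_near hp.
have [_ Hp] := nbhs_singleton HC.
have step q v : rho q -> (forall v, `|ra q v| <= C * `|v| /\ `|rb q v| <= C * `|v|) ->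
    `|ra q v - ra p v| <= 2 * C * C * (`|p.1 - q.1| + `|p.2 - q.2|) * `|v| /\
    `|rb q v - rb p v| <= 2 * C * C * (`|p.1 - q.1| + `|p.2 - q.2|) * `|v|.
  move=> hq Hq; have [-> ->] := res_identity hip Tcl v hq hp.
  have [pa pb] := Hp v.
  have cc u : `|u| <= C * `|v| -> `|ra q u| <= C * C * `|v| /\ `|rb q u| <= C * C * `|v|.
    move=> hu; have [h1 h2] := Hq u; rewrite -mulrA.
    by split; [apply: le_trans h1 _|apply: le_trans h2 _]; rewrite ler_wpM2l.
  have [aa ba] := cc _ pa; have [ab bb] := cc _ pb.
  have s1 : `|ra q (ra p v) - rb q (rb p v)| <= 2 * (C * C * `|v|).
    by apply: le_trans (ler_normB _ _) _; rewrite mulr_natl mulr2n lerD.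
  have s2 : `|ra q (rb p v) + rb q (ra p v)| <= 2 * (C * C * `|v|).
    by apply: le_trans (ler_normD _ _) _; rewrite mulr_natl mulr2n lerD.
  have -> : 2 * C * C * (`|p.1 - q.1| + `|p.2 - q.2|) * `|v| =
     `|p.1 - q.1| * (2 * (C * C * `|v|)) + `|p.2 - q.2| * (2 * (C * C * `|v|)) by ring.
  split.
    by apply: le_trans (ler_normD _ _) _; rewrite !normrZ lerD// ler_wpM2l.
  apply: le_trans (ler_normB _ _) _; rewrite !normrZ lerD// ler_wpM2l//.
have small (e : R) : 0 < e ->
    \forall q \near p, 2 * C * C * (`|p.1 - q.1| + `|p.2 - q.2|) <= e.
  move=> e0; have K0 : 0 < 4 * C * C + 1 by rewrite ltr_wpDl// !mulr_ge0.
  have e1 : 0 < e / (4 * C * C + 1) by rewrite divr_gt0.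
  apply: filterS (box_nbhs p e1) => q [q1 q2].
  have D0 : 0 <= C * C by exact: mulr_ge0.
  rewrite (distrC p.1) (distrC p.2).
  have h : (4 * C * C + 1) * (e / (4 * C * C + 1)) = e by rewrite mulrC divfK// gt_eqF.
  set E := e / (4 * C * C + 1) in e1 q1 q2 h *; rewrite -h.
  have h1 : C * C * `|q.1 - p.1| <= C * C * E by rewrite ler_wpM2l// ltW.
  have h2 : C * C * `|q.2 - p.2| <= C * C * E by rewrite ler_wpM2l// ltW.
  lra.
split => e e0.
  apply: filterS2 HC (small e e0) => q [hq Hq] s v; have [h _] := step q v hq Hq.
  by apply: le_trans h _; rewrite ler_wpM2r.
apply: filterS2 HC (small e e0) => q [hq Hq] s v; have [_ h] := step q v hq Hq.
by apply: le_trans h _; rewrite ler_wpM2r.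
Qed.

(** The components of (x + j y - T)^-2. *)
Definition res_re2 p v : X := ra p (ra p v) - rb p (rb p v).
Definition res_im2 p v : X := ra p (rb p v) + rb p (ra p v).

Lemma res2_cvg p : rho p ->
  op_cvg (nbhs p) res_re2 (res_re2 p) /\ op_cvg (nbhs p) res_im2 (res_im2 p).
Proof.
move=> hp; have [ca cb] := res_cvg hp; have [ba bb] := res_bounded hp.
have aB := res_aB Tcl hp; have bB := res_bB (T := T) hp.
split.
  by apply: op_cvgB; apply: op_cvg_comp.
by apply: op_cvgD; apply: op_cvg_comp.
Qed.

Lemma continuous_res_a p v w : rho p -> {for p, continuous (fun q => <<ra q v, w>>)}.
Proof. by move=> hp; have [ca _] := res_cvg hp; exact: op_cvg_ip hX ca. Qed.

Lemma continuous_res_b p v w : rho p -> {for p, continuous (fun q => <<rb q v, w>>)}.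
Proof. by move=> hp; have [_ cb] := res_cvg hp; exact: op_cvg_ip hX cb. Qed.

Lemma continuous_res_re2 p v w : rho p -> {for p, continuous (fun q => <<res_re2 q v, w>>)}.
Proof. by move=> hp; have [ca _] := res2_cvg hp; exact: op_cvg_ip hX ca. Qed.

Lemma continuous_res_im2 p v w : rho p -> {for p, continuous (fun q => <<res_im2 q v, w>>)}.
Proof. by move=> hp; have [_ cb] := res2_cvg hp; exact: op_cvg_ip hX cb. Qed.

(** The resolvent identity provides increments of this shape, in which the
    difference quotient appears at the moving point. *)
Lemma is_derive_increment (f G : R -> R) x : {for x, continuous G} ->
  (\forall h \near 0, f (x + h) - f x = h * G (x + h)) -> is_derive x 1 f (G x).
Proof.
move=> cG E; apply: is_derive_eps => e e0.
have cxh : (fun h => G (x + h)) @ (0 : R) --> G x.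
  have c1 : {for (0 : R), continuous (fun h => x + h)}.
    by apply: (@continuousD _ _ _ (cst _) id); [exact: cvg_cst|exact: cvg_id].
  by apply: (@cvg_comp _ _ _ _ G _ (nbhs (x + 0)) _ c1); rewrite addr0.
move/cvgrPdist_le : cxh => /(_ e e0) n2; apply: filterS2 E n2 => h -> h2.
by rewrite mulrC -mulrBl normrM ler_wpM2r// distrC.
Qed.

Let near_rho p (h : R -> R * R) : rho p -> {for 0, continuous h} -> h 0 = p ->
  \forall t \near 0, rho (h t).
Proof.
by move=> hp ch E; apply: ch; rewrite E; exact: open_nbhs_nbhs (conj open_rho_plane hp).
Qed.

Let near_horizontal p : rho p -> \forall h \near 0, rho (p.1 + h, p.2).
Proof.
case: p => x y hp; apply: near_rho hp _ _; last by rewrite addr0.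
apply: cvg_pair_comp => /=; last exact: cvg_cst.
by apply: (@continuousD _ _ _ (cst _) id); [exact: cvg_cst|exact: cvg_id].
Qed.

Let near_vertical p : rho p -> \forall h \near 0, rho (p.1, p.2 + h).
Proof.
case: p => x y hp; apply: near_rho hp _ _; last by rewrite addr0.
apply: cvg_pair_comp => /=; first exact: cvg_cst.
by apply: (@continuousD _ _ _ (cst _) id); [exact: cvg_cst|exact: cvg_id].
Qed.

Let re2 p v w q := <<ra q (ra p v), w>> - <<rb q (rb p v), w>>.
Let im2 p v w q := <<ra q (rb p v), w>> + <<rb q (ra p v), w>>.

Let continuous_re2 p v w : rho p -> {for p, continuous (re2 p v w)}.
Proof. by move=> hp; apply: continuousB; [exact: continuous_res_a|exact: continuous_res_b]. Qed.

Let continuous_im2 p v w : rho p -> {for p, continuous (im2 p v w)}.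
Proof. by move=> hp; apply: continuousD; [exact: continuous_res_a|exact: continuous_res_b]. Qed.

Let res_increment p q v w : rho p -> rho q ->
  <<ra q v, w>> - <<ra p v, w>> = (p.1 - q.1) * re2 p v w q + (p.2 - q.2) * im2 p v w q /\
  <<rb q v, w>> - <<rb p v, w>> = (p.1 - q.1) * im2 p v w q - (p.2 - q.2) * re2 p v w q.
Proof.
move=> hp hq; rewrite -!(ipBl hX); have [-> ->] := res_identity hip Tcl v hq hp.
rewrite /re2 /im2.
move: (ra q (ra p v)) (rb q (rb p v)) (ra q (rb p v)) (rb q (ra p v)) => a b a' b'.
by split; rewrite !(ipDl hX, ipNl hX, ipZl hX).
Qed.

Lemma res_a_dx p v w : rho p ->
  is_derive p.1 1 (fun x => <<ra (x, p.2) v, w>>) (- <<res_re2 p v, w>>).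
Proof.
case: p => x y hp /=; rewrite (ipBl hX).
apply: (is_derive_increment (G := fun x' => - re2 (x, y) v w (x', y))).
  by apply: continuousN; apply: continuous_horizontal; exact: continuous_re2.
apply: filterS (near_horizontal hp) => h /(res_increment v w hp)[-> _] /=.
by rewrite subrr; ring.
Qed.

Lemma res_a_dy p v w : rho p ->
  is_derive p.2 1 (fun y => <<ra (p.1, y) v, w>>) (- <<res_im2 p v, w>>).
Proof.
case: p => x y hp /=; rewrite (ipDl hX).
apply: (is_derive_increment (G := fun y' => - im2 (x, y) v w (x, y'))).
  by apply: continuousN; apply: continuous_vertical; exact: continuous_im2.
apply: filterS (near_vertical hp) => h /(res_increment v w hp)[-> _] /=.
by rewrite subrr; ring.
Qed.

Lemma res_b_dx p v w : rho p ->
  is_derive p.1 1 (fun x => <<rb (x, p.2) v, w>>) (- <<res_im2 p v, w>>).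
Proof.
case: p => x y hp /=; rewrite (ipDl hX).
apply: (is_derive_increment (G := fun x' => - im2 (x, y) v w (x', y))).
  by apply: continuousN; apply: continuous_horizontal; exact: continuous_im2.
apply: filterS (near_horizontal hp) => h /(res_increment v w hp)[_ ->] /=.
by rewrite subrr; ring.
Qed.

Lemma res_b_dy p v w : rho p ->
  is_derive p.2 1 (fun y => <<rb (p.1, y) v, w>>) (<<res_re2 p v, w>>).
Proof.
case: p => x y hp /=; rewrite (ipBl hX).
apply: (is_derive_increment (G := fun y' => re2 (x, y) v w (x, y'))).
  by apply: continuous_vertical; exact: continuous_re2.
apply: filterS (near_vertical hp) => h /(res_increment v w hp)[_ ->] /=.
by rewrite subrr; ring.
Qed.

End ResolventCalculus.

(** * Adjoints *)

Section Adjoint.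
Context {R : realType} {d : nat} {H : completeNormedModType R}.
Local Notation X := {ffun {set 'I_d} -> H}.
Implicit Types (u v w : X) (p q : R * R).
Variables (ip : H -> H -> R) (hip : hilbert_inner ip).
Let hX : hilbert_inner (rip (d := d) ip) := hilbert_rip hip.
Local Notation "<< u , w >>" := (rip ip u w) (at level 0).
Local Notation e := (@cl_basis R d).

(** The components of the Clifford-valued products are real products with the
    vectors v e_A, which are in the domain as v is. *)
Lemma adj_atP (T : operator d H) w u : op_rlinear T ->
  adj_at ip T w u <-> forall v, op_dom T v -> <<u, v>> = <<w, op_fun T v>>.
Proof.
move=> Tlin; split => h v dv.
  by rewrite -!(hm_ip_scalar hip) h.
apply: (hm_ip_ext hip) => A.
by rewrite h ?(op_fun_rmul Tlin)//; exact: op_dom_rmul.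
Qed.

Variable T : operator d H.
Hypotheses (Tcl : op_closed T) (Td : densely_defined T).
Let Tlin : op_rlinear T. Proof. by case: Tcl. Qed.
Local Notation Ts := (adjoint ip T).

Lemma dense_ext u u' : (forall v, op_dom T v -> <<u, v>> = <<u', v>>) -> u = u'.
Proof.
move=> E; apply/eqP; rewrite -subr_eq0 -normr_le0.
have [//|n0] := lerP `|u - u'| 0.
have [v dv] := Td (u - u') n0; rewrite hm_normE => h.
have : `|u - u'| ^+ 2 = <<u - u', u - u' - v>>.
  have z : <<u - u', v>> = 0 by rewrite (ipBl hX) E// subrr.
  by rewrite (ipBr hX (u - u')) z subr0 (ipE hX).
move=> e2; have := ip_norm_le hX (u - u') (u - u' - v).
have := ler_norm <<u - u', u - u' - v>>; rewrite -e2 => h1 h2.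
have := le_trans h1 h2; rewrite expr2 ler_pM2l// => /(lt_le_trans h).
by rewrite ltxx.
Qed.

Lemma adjoint_eq w u : (forall v, op_dom T v -> <<u, v>> = <<w, op_fun T v>>) ->
  op_dom Ts w /\ op_fun Ts w = u.
Proof.
move=> h; have hu : adj_at ip T w u by apply/(adj_atP _ _ Tlin).
split; first by exists u.
rewrite /adjoint/=; case: xgetP => [u' -> /(adj_atP _ _ Tlin) h'|/(_ u)//].
by apply: dense_ext => v dv; rewrite h'// h.
Qed.

Lemma adjointP w v : op_dom Ts w -> op_dom T v ->
  <<op_fun Ts w, v>> = <<w, op_fun T v>>.
Proof. by move=> [u /(adj_atP _ _ Tlin) h] dv; have [_ ->] := adjoint_eq h; exact: h. Qed.

Lemma adjoint_closed : op_closed Ts.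
Proof.
split.
  split.
  - by have [] := @adjoint_eq 0 0 _; first by move=> v dv; rewrite !(ip0l hX).
  - move=> u v du dv; apply: adjoint_eq => w dw.
    by rewrite !(ipDl hX) !adjointP.
  - move=> v s dv; apply: adjoint_eq => w dw.
    rewrite !(hm_rmul_decomp s) !(ip_suml hX); apply: eq_bigr => A _.
    rewrite !(ipZl hX) !(rip_rmul_basis hip) adjointP//; last exact: op_dom_rmul.
    by rewrite (op_fun_rmul Tlin).
move=> u v w du uv uw; apply: adjoint_eq => x dx.
have cvg_zero (a : nat -> X) (b y : X) : (fun n => hm_norm (a n - b)) @ \oo --> (0:R) ->
    (fun n => <<a n, y>>) @ \oo --> <<b, y>>.
  move=> h; have h2 : (fun n => hm_norm (a n - b) * `|y|) @ \oo --> (0 * `|y| : R).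
    by apply: cvgM h _; exact: cvg_cst.
  rewrite mul0r in h2; apply/cvgrPdist_le => eps eps0.
  move/cvgrPdist_le : h2 => /(_ _ eps0); apply: filterS => n.
  rewrite sub0r normrN hm_normE ger0_norm ?mulr_ge0// => h2.
  rewrite distrC -(ipBl hX); exact: le_trans (ip_norm_le hX _ _) h2.
have c1 := cvg_zero _ _ x uw; have c2 := cvg_zero _ _ (op_fun T x) uv.
have E : (fun n => <<op_fun Ts (u n), x>>) = (fun n => <<u n, op_fun T x>>).
  by apply/funext => n; rewrite adjointP.
by rewrite E in c1; apply: cvg_unique c1 c2; exact: norm_hausdorff.
Qed.

Lemma bounded_adjoint (B : X -> X) : (forall u v, B (u + v) = B u + B v) ->
  (forall (k : R) v, B (k *: v) = k *: B v) -> bounded_op B ->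
  exists B' : X -> X, forall w v, <<B' w, v>> = <<w, B v>>.
Proof.
move=> BD BZ [C C0 HC].
have ex w : exists u, forall v, <<w, B v>> = <<u, v>>.
  apply: (@riesz _ _ _ hX (fun v => <<w, B v>>) (`|w| * C)).
    by move=> k u v; rewrite BD BZ (ipDr hX) (ipZr hX).
  move=> v; apply: le_trans (ip_norm_le hX _ _) _.
  by rewrite -mulrA ler_wpM2l.
by have /choice[B' HB] := ex; exists B' => w v; rewrite HB.
Qed.

(** With Q = Q_p[T]^-1, the adjoints of Q and T Q provide a solution of
    Q_p[T^*] u = w. *)
Lemma rho_plane_adjoint p : rho_plane T p -> rho_plane Ts p /\
  forall w v, <<Qinv Ts p w, v>> = <<w, Qinv T p v>> /\
    <<op_fun Ts (Qinv Ts p w), v>> = <<w, op_fun T (Qinv T p v)>>.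
Proof.
move=> hp; have Tslin : op_rlinear Ts by case: adjoint_closed.
have Qlin := Q_plane_rlinear hip p Tslin.
have [B' HB] := bounded_adjoint (QinvD hp) (QinvZ hp) (Qinv_bounded hp).
have [||D' HD] := @bounded_adjoint (fun v => op_fun T (Qinv T p v)) _ _ (TQinv_bounded Tcl hp).
- move=> u v; rewrite (QinvD hp) (op_funD Tlin)//.
    by case: (Qinv_dom hp u).
  by case: (Qinv_dom hp v).
- by move=> k v; rewrite (QinvZ hp) (op_funZ Tlin)//; case: (Qinv_dom hp v).
have [B'd B'e] : (forall w, op_dom Ts (B' w)) /\ (forall w, op_fun Ts (B' w) = D' w).
  have h w : op_dom Ts (B' w) /\ op_fun Ts (B' w) = D' w.
    apply: adjoint_eq => v dv; rewrite HD HB; congr <<_, _>>.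
    exact: (Qinv_comm hip Tcl hp).
  by split => w; case: (h w).
have [D'd D'e] : (forall w, op_dom Ts (D' w)) /\ (forall w, op_fun Ts (D' w) =
    w + (2 * p.1) *: D' w - (p.1 ^+ 2 + p.2 ^+ 2) *: B' w).
  have h w : op_dom Ts (D' w) /\ op_fun Ts (D' w) =
      w + (2 * p.1) *: D' w - (p.1 ^+ 2 + p.2 ^+ 2) *: B' w.
    apply: adjoint_eq => v dv; rewrite HD -(Qinv_comm hip Tcl hp)// (QinvK hip hp).
    rewrite !(ipDl hX, ipNl hX, ipZl hX) HD HB.
    by rewrite !(ipDr hX, ipNr hX, ipZr hX).
  by split => w; case: (h w).
have dQ w : op_dom (Q_plane Ts p) (B' w) by split; rewrite ?B'e.
have QB w : op_fun (Q_plane Ts p) (B' w) = w.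
  have -> : op_fun (Q_plane Ts p) (B' w) = op_fun Ts (op_fun Ts (B' w))
      - (2 * p.1) *: op_fun Ts (B' w) + (p.1 ^+ 2 + p.2 ^+ 2) *: B' w by [].
  rewrite B'e D'e; apply: (ip_ext hX) => x.
  by rewrite !(ipDl hX, ipNl hX, ipZl hX); ring.
have inj : op_injective (Q_plane Ts p).
  (* a vector in the kernel is orthogonal to the range of Q_p[T], the whole space *)
  move=> u u' du du' Euu.
  have [duu1 duu2] := op_domB Qlin du du'.
  have Z : op_fun (Q_plane Ts p) (u - u') = 0 by rewrite (op_funB Qlin)// Euu subrr.
  apply/eqP; rewrite -subr_eq0; apply/eqP; apply: (ip_ext hX) => x; rewrite (ip0l hX).
  have [dx1 dx2] := Qinv_dom hp x.
  have -> : x = op_fun T (op_fun T (Qinv T p x)) - (2 * p.1) *: op_fun T (Qinv T p x)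
      + (p.1 ^+ 2 + p.2 ^+ 2) *: Qinv T p x.
    rewrite (QinvK hip hp); apply: (ip_ext hX) => y.
    by rewrite !(ipDl hX, ipNl hX, ipZl hX); ring.
  rewrite !(ipDr hX, ipNr hX, ipZr hX) -!adjointP//.
  by rewrite -!(ipZl hX) -(ipNl hX) -!(ipDl hX) [X in <<X, _>>]Z (ip0l hX).
have Qe w : Qinv Ts p w = B' w by rewrite /Qinv -{1}(QB w) op_invK.
split; last by move=> w v; rewrite Qe B'e HB HD.
split => //; split.
- exact: op_inv_rlinear.
- by apply/seteqP; split => // w _; exists (B' w).
- have [C C0 HC] := Qinv_bounded hp; exists C => w; rewrite !hm_normE -/(Qinv Ts p w) Qe.
  have [->|n0] := eqVneq (B' w) 0; first by rewrite normr0 mulr_ge0.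
  have n0' : 0 < `|B' w| by rewrite normr_gt0.
  rewrite -(ler_pM2r n0') -expr2 -(ipE hX) HB.
  apply: le_trans (ler_norm _) _; apply: le_trans (ip_norm_le hX _ _) _.
  by have := ler_wpM2l (normr_ge0 w) (HC (B' w)); rewrite mulrCA mulrA.
Qed.

Lemma res_adjoint p w v : rho_plane T p ->
  <<res_a Ts p w, v>> = <<w, res_a T p v>> /\ <<res_b Ts p w, v>> = <<w, res_b T p v>>.
Proof.
move=> hp; have [_ /(_ w v)[h1 h2]] := rho_plane_adjoint hp.
rewrite /res_a /res_b !(ipDl hX, ipNl hX, ipZl hX, ipDr hX, ipNr hX, ipZr hX).
by rewrite h1 h2.
Qed.

End Adjoint.

(** * Holomorphic functions and the reflection in the real axis *)

Section CauchyRiemann.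
Context {R : realType}.
Implicit Types (O : set (R * R)) (u v k l : R * R -> R) (z p : R * R).

(** u + i v is holomorphic on O, with derivative k + i l. *)
Definition CR_pair O u v := exists k l : R * R -> R,
  [/\ forall z, O z -> {for z, continuous u}, forall z, O z -> {for z, continuous v},
      forall z, O z -> {for z, continuous k}, forall z, O z -> {for z, continuous l} &
   forall z, O z ->
   [/\ is_derive z.1 1 (fun x => u (x, z.2)) (k z),
       is_derive z.2 1 (fun y => v (z.1, y)) (k z),
       is_derive z.1 1 (fun x => v (x, z.2)) (l z) &
       is_derive z.2 1 (fun y => u (z.1, y)) (- l z)]].

(** The form v dx + u dy is the imaginary part of (u + i v) dz. *)
Lemma CR_closed O u v : open O -> CR_pair O u v -> closed_form O v u.
Proof.
move=> oO [k [l [cu cv ck cl D]]]; apply: (green oO cv cu ck) => z /D[] //.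
Qed.

Lemma CR_pairM O u1 v1 u2 v2 : CR_pair O u1 v1 -> CR_pair O u2 v2 ->
  CR_pair O (fun z => u1 z * u2 z - v1 z * v2 z) (fun z => u1 z * v2 z + v1 z * u2 z).
Proof.
move=> [k1 [l1 [cu1 cv1 ck1 cl1 D1]]] [k2 [l2 [cu2 cv2 ck2 cl2 D2]]].
exists (fun z => (k1 z * u2 z + u1 z * k2 z) - (l1 z * v2 z + v1 z * l2 z)).
exists (fun z => (k1 z * v2 z + u1 z * l2 z) + (l1 z * u2 z + v1 z * k2 z)).
have cM (f g : R * R -> R) : (forall z, O z -> {for z, continuous f}) ->
   (forall z, O z -> {for z, continuous g}) ->
   (forall z, O z -> {for z, continuous (fun z => f z * g z)}).
  by move=> cf cg z Oz; apply: continuousM; [exact: cf|exact: cg].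
have cD (f g : R * R -> R) : (forall z, O z -> {for z, continuous f}) ->
   (forall z, O z -> {for z, continuous g}) ->
   (forall z, O z -> {for z, continuous (fun z => f z + g z)}).
  by move=> cf cg z Oz; apply: continuousD; [exact: cf|exact: cg].
have cB (f g : R * R -> R) : (forall z, O z -> {for z, continuous f}) ->
   (forall z, O z -> {for z, continuous g}) ->
   (forall z, O z -> {for z, continuous (fun z => f z - g z)}).
  by move=> cf cg z Oz; apply: continuousB; [exact: cf|exact: cg].
split.
- by apply: cB; apply: cM.
- by apply: cD; apply: cM.
- by apply: cB; apply: cD; apply: cM.
- by apply: (cD); apply: (cD); apply: (cM).
case=> x y Oz; have /= [a1 b1 c1 d1] := D1 _ Oz; have /= [a2 b2 c2 d2] := D2 _ Oz.
split.
- by apply: is_derive_eq (is_derive_sub (is_derive_mul a1 a2) (is_derive_mul c1 c2)) _.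
- apply: is_derive_eq (is_derive_add (is_derive_mul d1 b2) (is_derive_mul b1 d2)) _.
  by rewrite /=; ring.
- by apply: is_derive_eq (is_derive_add (is_derive_mul a1 c2) (is_derive_mul c1 a2)) _.
- apply: is_derive_eq (is_derive_sub (is_derive_mul d1 d2) (is_derive_mul b1 b2)) _.
  by rewrite /=; ring.
Qed.

Lemma CR_pairD O u1 v1 u2 v2 : CR_pair O u1 v1 -> CR_pair O u2 v2 ->
  CR_pair O (fun z => u1 z + u2 z) (fun z => v1 z + v2 z).
Proof.
move=> [k1 [l1 [cu1 cv1 ck1 cl1 D1]]] [k2 [l2 [cu2 cv2 ck2 cl2 D2]]].
exists (fun z => k1 z + k2 z), (fun z => l1 z + l2 z).
split; try by move=> z Oz; apply: continuousD;
  [by [apply: cu1|apply: cv1|apply: ck1|apply: cl1]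
  |by [apply: cu2|apply: cv2|apply: ck2|apply: cl2]].
move=> z Oz; have [a1 b1 c1 d1] := D1 _ Oz; have [a2 b2 c2 d2] := D2 _ Oz.
split.
- exact: is_derive_add a1 a2.
- exact: is_derive_add b1 b2.
- exact: is_derive_add c1 c2.
- by apply: is_derive_eq (is_derive_add d1 d2) _; rewrite opprD.
Qed.

Lemma CR_pair0 O : CR_pair O (fun=> 0) (fun=> 0).
Proof.
exists (fun=> 0), (fun=> 0); split; try by move=> z _; exact: cvg_cst.
by move=> z _; rewrite oppr0; split; exact: is_derive_cst.
Qed.

Lemma CR_pair_sum O (I : Type) (s : seq I) (u v : I -> R * R -> R) :
  (forall i, CR_pair O (u i) (v i)) ->
  CR_pair O (fun z => \sum_(i <- s) u i z) (fun z => \sum_(i <- s) v i z).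
Proof.
move=> h; elim: s => [|i s IHs].
  have e0 : (fun z : R * R => \sum_(i <- [::]) u i z) = fun=> 0.
    by apply/funext => z; rewrite big_nil.
  have e1 : (fun z : R * R => \sum_(i <- [::]) v i z) = fun=> 0.
    by apply/funext => z; rewrite big_nil.
  by rewrite e0 e1; exact: CR_pair0.
have e0 : (fun z : R * R => \sum_(j <- i :: s) u j z) =
    fun z => u i z + \sum_(j <- s) u j z.
  by apply/funext => z; rewrite big_cons.
have e1 : (fun z : R * R => \sum_(j <- i :: s) v j z) =
    fun z => v i z + \sum_(j <- s) v j z.
  by apply/funext => z; rewrite big_cons.
by rewrite e0 e1; exact: CR_pairD.
Qed.

(** Multiplication by i. *)
Lemma CR_pair_rot O u v : CR_pair O u v -> CR_pair O (fun z => - v z) u.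
Proof.
move=> [k [l [cu cv ck cl D]]]; exists (fun z => - l z), k; split => //.
- by move=> z Oz; apply: continuousN; exact: cv.
- by move=> z Oz; apply: continuousN; exact: cl.
move=> z Oz; have [a b c e] := D _ Oz; split => //.
  by apply: is_derive_eq (is_deriveN c) _.
by apply: is_derive_eq (is_deriveN b) _.
Qed.

Lemma CR_pair_sub O O' u v : O `<=` O' -> CR_pair O' u v -> CR_pair O u v.
Proof.
move=> OO [k [l [cu cv ck cl D]]]; exists k, l; split => z /OO.
- exact: cu.
- exact: cv.
- exact: ck.
- exact: cl.
- exact: D.
Qed.

(** f is continuous on the vertical line through z, and near z it is Lipschitz
    in the horizontal direction, uniformly in the height. *)
Lemma continuous_of_partials O (f fx : R * R -> R) z : open O -> O z ->
  (forall z, O z -> is_derive z.1 1 (fun x => f (x, z.2)) (fx z)) ->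
  (forall z, O z -> {for z, continuous fx}) ->
  derivable (fun y => f (z.1, y)) z.2 1 ->
  {for z, continuous f}.
Proof.
move=> oO Oz dx cfx dy; apply/cvgrPdist_lt => e e0.
have e20 : 0 < e / 2 by rewrite divr_gt0.
have cy : {for z.2, continuous (fun y => f (z.1, y))}.
  exact/differentiable_continuous/derivable1_diffP.
have n1 : \forall q \near z, `|f (z.1, q.2) - f z| < e / 2.
  move/cvgrPdist_lt : cy => /(_ _ e20)/nbhs_ballP[r /= r0 Hr].
  apply: filterS (box_nbhs z r0) => q [_ q2].
  have := Hr q.2; rewrite /ball/= distrC => /(_ q2).
  by rewrite distrC -surjective_pairing.
have [r1 r10 H1] := nbhs_box (open_nbhs_nbhs (conj oO Oz)).
have [r2 r20 H2] := eps_continuous (cfx _ Oz) ltr01.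
pose K := `|fx z| + 1.
have K0 : 0 < K by rewrite ltr_wpDl.
have e2K : 0 < e / 2 / K by rewrite divr_gt0.
pose r := Num.min r1 (Num.min r2 (e / 2 / K)).
have r0 : 0 < r by rewrite !lt_min r10 r20.
apply: filterS2 n1 (box_nbhs z r0) => q fq [q1 q2].
have inbox x : between z.1 q.1 x -> box z r (x, q.2).
  move=> bx; split => //=; apply: between_dist bx => //.
  by rewrite subrr normr0.
have B1 x : between z.1 q.1 x -> O (x, q.2).
  move=> /inbox Bx; apply/H1; apply: box_le Bx; by rewrite /r ge_min lexx.
have B2 x : between z.1 q.1 x -> `|fx (x, q.2) - fx z| < 1.
  move=> /inbox Bx; apply/H2; apply: box_le Bx; by rewrite /r !ge_min lexx orbT.
have E : oint (fun x => fx (x, q.2)) z.1 q.1 = f (q.1, q.2) - f (z.1, q.2).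
  apply: (@oint_ftc _ _ (fun x => f (x, q.2))) => x bx.
    by apply/continuous_horizontal/cfx/B1.
  by apply: (dx (x, q.2)); exact: B1.
have [x bx Ex] := @oint_mean _ (fun x => fx (x, q.2)) z.1 q.1 (fun x bx =>
  continuous_horizontal (cfx _ (B1 _ bx))).
have fxK : `|fx (x, q.2)| <= K.
  rewrite -[fx (x, q.2)](subrK (fx z)) addrC; apply: le_trans (ler_normD _ _) _.
  by rewrite lerD2l; apply/ltW/B2.
have small : `|f q - f (z.1, q.2)| < e / 2.
  rewrite {1}[q]surjective_pairing -E Ex normrM.
  have q1' : `|q.1 - z.1| < e / 2 / K.
    by apply: lt_le_trans q1 _; rewrite /r !ge_min lexx !orbT.
  apply: le_lt_trans (ler_wpM2r (normr_ge0 _) fxK) _.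
  by rewrite mulrC -ltr_pdivlMr.
rewrite distrC; apply: le_lt_trans (ler_distD (f (z.1, q.2)) _ _) _.
by rewrite [e]splitr ltrD.
Qed.

Definition mirror z : R * R := (z.1, - z.2).

Lemma mirrorK : involutive mirror.
Proof. by case=> x y; rewrite /mirror /= opprK. Qed.

Definition mirror_arc (c : R -> R * R) : R -> R * R := fun t => mirror (c t).

Lemma C1_arc_mirror c : C1_arc c ->
  C1_arc (mirror_arc c) /\ forall t, derive1 (mirror_arc c) t = mirror (derive1 c t).
Proof.
move=> [dc cc].
have D t : derivable (mirror_arc c) t 1 /\
    'D_1 (mirror_arc c) t = mirror (derive1 c t).
  have d1 := is_derive_cvg (is_derive_fst (dc t)).
  have d2 := is_derive_cvg (is_derive_snd (dc t)).
  have C : (fun h => h^-1 *: ((mirror_arc c \o shift t) (h *: 1) - mirror_arc c t))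
      @ 0^' --> mirror (derive1 c t).
    apply: cvg_trans (cvg_pair_comp (l := mirror (derive1 c t)) d1 (cvgN d2)).
    apply: near_eq_cvg; near=> h.
    rewrite /= [h *: 1]mulr1 [h + t]addrC /mirror_arc /mirror /=.
    congr pair; transitivity (- (h^-1 * ((c (t + h)).2 - (c t).2))) => //.
    by rewrite /GRing.scale/=; ring.
  split; first by apply/cvg_ex; eexists; exact: C.
  exact: (cvg_lim (@norm_hausdorff _ _) C).
have D' t : derive1 (mirror_arc c) t = mirror (derive1 c t).
  by rewrite derive1E; case: (D t).
split; last exact: D'.
split; first by move=> t; case: (D t).
have -> : derive1 (mirror_arc c) = fun t => mirror (derive1 c t) by apply/funext.
move=> t; apply: cvg_pair_comp; first exact: cvg_fst_comp (cc t).
by apply: cvgN; exact: cvg_snd_comp (cc t).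
Unshelve. all: by end_near. Qed.

Lemma arcint_mirror (P Q : R * R -> R) c (a b : R) : C1_arc c ->
  arcint P Q (mirror_arc c) a b =
  arcint (fun z => P (mirror z)) (fun z => - Q (mirror z)) c a b.
Proof.
move=> /C1_arc_mirror[_ E]; apply: eq_oint => t _.
by rewrite E /mirror_arc /=; ring.
Qed.

Lemma eq_arcint (P Q P' Q' : R * R -> R) c (a b : R) :
  (forall t, between a b t -> P (c t) = P' (c t) /\ Q (c t) = Q' (c t)) ->
  arcint P Q c a b = arcint P' Q' c a b.
Proof. by move=> E; apply: eq_oint => t /E[-> ->]. Qed.

Lemma arcintZ (k : R) O (P Q : R * R -> R) c : closed_form O P Q -> C1_arc c ->
  (forall t : R, 0 <= t <= 1 -> O (c t)) ->
  arcint (fun z => k * P z) (fun z => k * Q z) c 0 1 = k * arcint P Q c 0 1.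
Proof.
move=> cf cc Oc; rewrite /arcint -ointZ.
  by apply: eq_oint => t _; ring.
move=> t; rewrite /between min_l// max_r// => t01.
exact: arc_integrand_continuous cf cc (Oc t t01).
Qed.

Lemma arcintN O (P Q : R * R -> R) c : closed_form O P Q -> C1_arc c ->
  (forall t : R, 0 <= t <= 1 -> O (c t)) ->
  arcint (fun z => - P z) (fun z => - Q z) c 0 1 = - arcint P Q c 0 1.
Proof.
move=> cf cc Oc; rewrite -mulN1r -(arcintZ _ cf cc Oc).
by apply: eq_oint => t _; ring.
Qed.

Lemma arcint_theta_mirror p c : C1_arc c ->
  (forall t : R, 0 <= t <= 1 -> c t <> mirror p) ->
  arcint (theta_x p) (theta_y p) (mirror_arc c) 0 1 =
  - arcint (theta_x (mirror p)) (theta_y (mirror p)) c 0 1.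
Proof.
move=> cc cp; rewrite arcint_mirror//.
rewrite -(arcintN (closed_theta (mirror p)) cc cp).
apply: eq_arcint => t _; rewrite /theta_x /theta_y /=.
have -> : (- (c t).2 - p.2) ^+ 2 = ((c t).2 - - p.2) ^+ 2 by ring.
by split; [rewrite -[RHS]mulNr; congr (_ / _); ring|].
Qed.

(** What the admissible cycles have in common, O being the set where both f and
    the resolvent are defined: their winding numbers are prescribed at all points
    outside of O, so that any two of them are homologous in O. *)
Definition surrounds (K O : set (R * R)) (L : seq (R -> R * R)) :=
  [/\ forall c, c \in L -> C1_arc c,
      closed_chain L,
      forall c (t : R), c \in L -> 0 <= t <= 1 -> O (c t),
      forall p, K p -> \sum_(c <- L) arcint (theta_x p) (theta_y p) c 0 1 = 2 * pi &
      forall p, ~ K p -> ~ O p ->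
        \sum_(c <- L) arcint (theta_x p) (theta_y p) c 0 1 = 0].

(** The reflection of L' has the opposite winding numbers, so that together
    with L it is homologous to 0 in O. *)
Lemma integral_mirrored K O P Q L L' : open O -> closed_form O P Q ->
  (forall p, K p -> ~ O p) ->
  (forall p, O p -> O (mirror p)) -> (forall p, K p -> K (mirror p)) ->
  surrounds K O L -> surrounds K O L' ->
  \sum_(c <- L) arcint P Q c 0 1 = - \sum_(c <- L') arcint P Q (mirror_arc c) 0 1.
Proof.
move=> oO cf KO Or Kr [C1 cyc LO LK L0] [C1' cyc' LO' LK' L0'].
suff H : \sum_(c <- L ++ map mirror_arc L') arcint P Q c 0 1 = 0.
  by apply/eqP; rewrite -addr_eq0; rewrite big_cat big_map in H; apply/eqP.
apply: (cauchy_homology oO cf).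
- move=> g; rewrite big_cat/= big_map (cyc g) add0r.
  exact: (cyc' (fun z => g (mirror z))).
- by move=> c; rewrite mem_cat => /orP[/C1//|/mapP[c' /C1'/C1_arc_mirror[+ _] ->]].
- move=> c t; rewrite mem_cat => /orP[/LO + /[dup] t01|/mapP[c' cL ->] t01]; first exact.
  by apply: Or; exact: LO'.
move=> p nO; rewrite big_cat/= big_map big_seq.
have nOr : ~ O (mirror p) by move=> /Or; rewrite mirrorK.
have E c : c \in L' -> arcint (theta_x p) (theta_y p) (mirror_arc c) 0 1 =
    - arcint (theta_x (mirror p)) (theta_y (mirror p)) c 0 1.
  move=> cL; apply: arcint_theta_mirror; first exact: C1'.
  by move=> t t01 e; apply: nOr; rewrite -e; exact: LO'.
rewrite -big_seq [X in _ + X]big_seq (eq_bigr _ E) -big_seq sumrN.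
have [Kp|nKp] := pselect (K p).
  by rewrite LK// LK' ?subrr//; exact: Kr.
rewrite L0// L0' ?subrr// => /Kr; by rewrite mirrorK.
Qed.

End CauchyRiemann.

(** * Riemann integrals of operator-valued functions *)

Section Partition.
Context {R : realType}.

Lemma partition_in (n : nat) (t : nat -> R) : t 0%N = 0 -> t n = 1 ->
  (forall i, (i < n)%N -> t i <= t i.+1) -> forall i, (i <= n)%N -> 0 <= t i <= 1.
Proof.
move=> t0 tn mono i ilen; apply/andP; split.
  elim: i ilen => [|i IHi] ilen; first by rewrite t0.
  by apply: le_trans (IHi (ltnW ilen)) (mono _ ilen).
rewrite -tn -(subnKC ilen).
have h k : (i + k <= n)%N -> t i <= t (i + k)%N.
  elim: k => [|k IHk] kn; first by rewrite addn0.
  rewrite addnS in kn *; exact: le_trans (IHk (ltnW kn)) (mono _ kn).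
by apply: h; rewrite subnKC.
Qed.

Lemma riemann_sum_bound (phi : R -> R) (e delta : R) n (t xi : nat -> R) :
  (forall x : R, 0 <= x <= 1 -> {for x, continuous phi}) ->
  (forall x y, 0 <= x <= 1 -> 0 <= y <= 1 -> `|x - y| <= delta ->
     `|phi x - phi y| <= e) ->
  t 0%N = 0 -> t n = 1 ->
  (forall i, (i < n)%N -> t i <= xi i <= t i.+1 /\ t i.+1 - t i < delta) ->
  `|\sum_(i < n) (t i.+1 - t i) * phi (xi i) - oint phi 0 1| <= e.
Proof.
move=> cphi uphi t0 tn part.
have mono i : (i < n)%N -> t i <= t i.+1 by move=> /part[/andP[h1 h2] _]; exact: le_trans h2.
have t01 := partition_in t0 tn mono.
have E k : (k <= n)%N -> oint phi 0 (t k) = \sum_(i < k) oint phi (t i) (t i.+1).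
  elim: k => [|k IHk] kn; first by rewrite t0 ointaa big_ord0.
  rewrite big_ord_recr/= -IHk ?(ltnW kn)//.
  by rewrite (oint_chasles (m := 0) (M := 1))// ?lexx ?ler01// t01// ltnW.
rewrite -tn (E n)// -sumrB.
apply: le_trans (ler_norm_sum _ _ _) _.
have step (i : 'I_n) : `|(t i.+1 - t i) * phi (xi i) - oint phi (t i) (t i.+1)|
    <= (t i.+1 - t i) * e.
  have [/andP[x1 x2] gap] := part i (ltn_ord i).
  have h1 := t01 i (ltnW (ltn_ord i)); have h2 := t01 i.+1 (ltn_ord i).
  have hx : 0 <= xi i <= 1 by apply/andP; split; lra.
  have [x bx ->] := @oint_mean _ phi (t i) (t i.+1) (fun x bx => cphi x (between_sub h1 h2 bx)).
  rewrite [_ * phi _]mulrC -mulrBl normrM [leRHS]mulrC.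
  have g0 : 0 <= t i.+1 - t i by rewrite subr_ge0 mono.
  rewrite [X in _ * X]ger0_norm// ler_wpM2r//.
  apply: uphi => //; first exact: between_sub h1 h2 bx.
  have /betweenP bx' := bx; rewrite ler_norml; apply/andP; split; lra.
apply: le_trans (ler_sum _ (fun i _ => step i)) _.
rewrite -mulr_suml -(big_mkord xpredT (fun i => t i.+1 - t i)) telescope_sumr//.
by rewrite tn t0 subr0 mul1r.
Qed.

End Partition.

Section OperatorIntegral.
Context {R : realType} {d : nat} {H : completeNormedModType R}.
Local Notation X := {ffun {set 'I_d} -> H}.
Implicit Types (u v w : X).
Variables (ip : H -> H -> R) (hip : hilbert_inner ip).
Let hX : hilbert_inner (rip (d := d) ip) := hilbert_rip hip.
Local Notation "<< u , w >>" := (rip ip u w) (at level 0).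

Lemma is_op_integral_ext (F F' : R -> X -> X) (A : X -> X) :
  (forall t : R, 0 <= t <= 1 -> forall v, F t v = F' t v) ->
  is_op_integral F A -> is_op_integral F' A.
Proof.
move=> E h e e0; have [delta d0 hd] := h e e0; exists delta => // n t xi t0 tn part v.
have mono i : (i < n)%N -> t i <= t i.+1 by move=> /part[/andP[h1 h2] _]; exact: le_trans h2.
have t01 := partition_in t0 tn mono.
have := hd n t xi t0 tn part v; congr (hm_norm (_ - _) <= _).
apply: eq_bigr => i _; rewrite E//.
have [/andP[x1 x2] _] := part i (ltn_ord i).
have h1 := t01 i (ltnW (ltn_ord i)); have h2 := t01 i.+1 (ltn_ord i).
apply/andP; split; lra.
Qed.

(** The integral is defined weakly, by Riesz; comparing each Riemann summand
    with the mean value of a scalar integral makes the Riemann sums converge to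
    it in norm, with no Cauchy argument on refinements. *)
Theorem op_integral_exists (F : R -> X -> X) :
  (forall t : R, 0 <= t <= 1 -> op_cvg (nbhs t) F (F t)) ->
  exists2 A : X -> X, is_op_integral F A &
    forall v w, <<A v, w>> = oint (fun t => <<F t v, w>>) 0 1.
Proof.
move=> cF.
have c01 (x : R) : between 0 1 x -> 0 <= x <= 1 by rewrite /between min_l// max_r.
have cphi v w (t : R) : between 0 1 t -> {for t, continuous (fun t => <<F t v, w>>)}.
  by move=> /c01/cF h; exact: op_cvg_ip hX h.
have bnd v : exists M : R, forall t : R, 0 <= t <= 1 -> `|F t v| <= M.
  suff : \forall M \near +oo, forall t : R, 0 <= t <= 1 -> `|F t v| <= M.
    by move=> /filter_ex[M]; exists M.
  apply: near_unit_segment => t t01; near=> s M.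
  have h1 : `|F s v - F t v| <= 1 * `|v|.
    near: s; apply: filterS (cF t t01 1 ltr01) => s; exact.
  have h2 : `|v| + `|F t v| <= M by near: M; exact: nbhs_pinfty_ge.
  rewrite -[F s v](subrK (F t v)); apply: le_trans (ler_normD _ _) (le_trans _ h2).
  by rewrite lerD2r -[leRHS]mul1r.
have ex v : exists u, forall w, oint (fun t => <<F t v, w>>) 0 1 = <<u, w>>.
  have [M HM] := bnd v.
  apply: (@riesz _ _ _ hX (fun w => oint (fun t => <<F t v, w>>) 0 1) M).
    move=> k u w; rewrite -ointZ; last exact: cphi.
    rewrite -ointD; last exact: cphi.
      by apply: eq_oint => t _; rewrite (ipDr hX) (ipZr hX).
    move=> t t01; apply: continuousM; [exact: cvg_cst|exact: cphi].
  move=> w; have [x x01 ->] := oint_mean (cphi v w).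
  rewrite subr0 mulr1; apply: le_trans (ip_norm_le hX _ _) _.
  by rewrite ler_wpM2r// HM// c01.
have /choice[A HA] := ex.
exists A; last by move=> v w; rewrite HA.
move=> e e0.
have e20 : 0 < e / 2 by rewrite divr_gt0.
have unif : \forall delta \near 0^'+, forall t : R, 0 <= t <= 1 -> forall s,
    `|s - t| <= delta -> forall v, `|F s v - F t v| <= e * `|v|.
  apply: near_unit_segment => t t01.
  have /nbhs_ballP[r /= r0 Hr] := cF t t01 _ e20.
  have r20 : 0 < r / 2 by rewrite divr_gt0.
  near=> s delta => x xs v.
  have st : `|t - s| < r / 2 by near: s; exact: nbhsx_ballx.
  have dr : delta <= r / 2 by near: delta; exact: nbhs_right_le.
  have h1 : `|F s v - F t v| <= e / 2 * `|v|.
    by apply: Hr; apply: lt_trans st _; move: r0; lra.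
  have h2 : `|F x v - F t v| <= e / 2 * `|v|.
    apply: Hr; rewrite /ball/=; apply: le_lt_trans (ler_distD s _ _) _.
    by rewrite (distrC s x) [r]splitr; apply: ltr_leD st (le_trans xs dr).
  apply: le_trans (ler_distD (F t v) _ _) _.
  by rewrite [e]splitr mulrDl (distrC (F t v)) lerD.
have [delta [d0 Hd]] := filter_ex (filterI (nbhs_right_gt (0 : R)) unif).
exists delta => // n t xi t0 tn part v.
set S := \sum_(i < n) _; rewrite !hm_normE.
have key w : `|<<S - A v, w>>| <= e * `|v| * `|w|.
  have -> : <<S - A v, w>> =
      \sum_(i < n) (t i.+1 - t i) * <<F (xi i) v, w>> - oint (fun t => <<F t v, w>>) 0 1.
    rewrite (ipBl hX) HA /S (ip_suml hX); congr (_ - _).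
    by apply: eq_bigr => i _; rewrite (ipZl hX).
  apply: (@riemann_sum_bound _ (fun t => <<F t v, w>>) _ delta) => //.
    by move=> x x01; apply: cphi; rewrite /between min_l// max_r.
  move=> x y x01 y01 xy; rewrite -(ipBl hX).
  by apply: le_trans (ip_norm_le hX _ _) _; rewrite ler_wpM2r// Hd.
have [->|n0] := eqVneq (S - A v) 0; first by rewrite normr0 mulr_ge0// ltW.
have n0' : 0 < `|S - A v| by rewrite normr_gt0.
rewrite -(ler_pM2r n0') -expr2 -(ipE hX).
by apply: le_trans (ler_norm _) (key _).
Unshelve. all: by end_near. Qed.

End OperatorIntegral.

(** * Contour integrals of resolvents *)

Section ContourIntegrals.
Context {R : realType} {d : nat} {H : completeNormedModType R}.
Local Notation X := {ffun {set 'I_d} -> H}.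
Implicit Types (u v w : X) (z p q : R * R) (A : {set 'I_d}).
Variables (ip : H -> H -> R) (hip : hilbert_inner ip).
Let hX : hilbert_inner (rip (d := d) ip) := hilbert_rip hip.
Local Notation "<< u , w >>" := (rip ip u w) (at level 0).
Variables (T : operator d H) (Tcl : op_closed T).
Local Notation ra := (res_a T).
Local Notation rb := (res_b T).

Lemma res_CR v w : CR_pair (rho_plane T) (fun z => <<ra z v, w>>) (fun z => - <<rb z v, w>>).
Proof.
exists (fun z => - <<res_re2 T z v, w>>), (fun z => <<res_im2 T z v, w>>).
split=> z hz.
- exact: (continuous_res_a hip).
- by apply: continuousN; exact: (continuous_res_b hip).
- by apply: continuousN; exact: (continuous_res_re2 hip).
- exact: (continuous_res_im2 hip).
split.
- exact: (res_a_dx hip).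
- by have h := res_b_dy hip Tcl v w hz; exact: is_deriveN.
- have h := res_b_dx hip Tcl v w hz.
  by apply: is_derive_eq (is_deriveN h) _; rewrite opprK.
- exact: (res_a_dy hip).
Qed.

Lemma rho_plane_mirror z : rho_plane T z -> rho_plane T (mirror z).
Proof. by rewrite /rho_plane /= /Q_plane /= sqrrN. Qed.

Lemma res_a_mirror z v : ra (mirror z) v = ra z v.
Proof. by rewrite /res_a /Qinv /Q_plane /= sqrrN. Qed.

Lemma res_b_mirror z v : rb (mirror z) v = - rb z v.
Proof. by rewrite /res_b /Qinv /Q_plane /= sqrrN scaleNr. Qed.

Variables (D : set (R * R)) (oD : open D) (Dr : forall z, D z -> D (mirror z)).

(** The pair (f0, f1) is given through its components in the basis e_A. *)
Definition even_odd_pair (f0 f1 : {set 'I_d} -> R * R -> R) :=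
  forall A, [/\ CR_pair D (f0 A) (f1 A), forall z, D z -> f0 A (mirror z) = f0 A z &
                forall z, D z -> f1 A (mirror z) = - f1 A z].

Let O := rho_plane T `&` D.

Let oO : open O.
Proof. by apply: openI => //; exact: (open_rho_plane hip). Qed.

Let Or z : O z -> O (mirror z).
Proof. by move=> [/rho_plane_mirror h /Dr h']. Qed.

Variables (f0 f1 : {set 'I_d} -> R * R -> R) (f01 : even_odd_pair f0 f1).

(** The imaginary and the real part of the sum over A of
    <(x + j y - T)^-1 N_A v, M_A w> (f0_A + j f1_A). *)
Definition form_x (g0 g1 : {set 'I_d} -> R * R -> R) (N M : {set 'I_d} -> X -> X) v w z :=
  \sum_A (<<ra z (N A v), M A w>> * g1 A z - <<rb z (N A v), M A w>> * g0 A z).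
Definition form_y (g0 g1 : {set 'I_d} -> R * R -> R) (N M : {set 'I_d} -> X -> X) v w z :=
  \sum_A (<<ra z (N A v), M A w>> * g0 A z + <<rb z (N A v), M A w>> * g1 A z).

Lemma form_closed g0 g1 N M v w : (forall A, CR_pair D (g0 A) (g1 A)) ->
  closed_form O (form_x g0 g1 N M v w) (form_y g0 g1 N M v w).
Proof.
move=> g01.
have h A : CR_pair O
    (fun z => <<ra z (N A v), M A w>> * g0 A z - (- <<rb z (N A v), M A w>>) * g1 A z)
    (fun z => <<ra z (N A v), M A w>> * g1 A z + (- <<rb z (N A v), M A w>>) * g0 A z).
  apply: CR_pairM; first by apply: CR_pair_sub (res_CR _ _); exact: subIsetl.
  by apply: CR_pair_sub (g01 A); exact: subIsetr.
have := CR_closed oO (CR_pair_sum (index_enum _) h).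
set P := (fun z => _); set Q := (fun z => _).
have -> : P = form_x g0 g1 N M v w.
  by apply/funext => z; apply: eq_bigr => A _; rewrite mulNr.
have -> // : Q = form_y g0 g1 N M v w.
by apply/funext => z; apply: eq_bigr => A _; rewrite mulNr opprK.
Qed.

Let f_CR A : CR_pair D (f0 A) (f1 A). Proof. by case: (f01 A). Qed.

Let f_rot A : CR_pair D (fun z => - f1 A z) (f0 A).
Proof. by apply: CR_pair_rot; exact: f_CR. Qed.

Lemma form_x_mirror N M v w z : O z ->
  form_x f0 f1 N M v w (mirror z) = - form_x f0 f1 N M v w z.
Proof.
move=> [_ Dz]; rewrite /form_x -sumrN; apply: eq_bigr => A _.
have [_ h0 h1] := f01 A.
by rewrite res_a_mirror res_b_mirror (ipNl hX) h0// h1//; ring.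
Qed.

Lemma form_y_mirror N M v w z : O z ->
  form_y f0 f1 N M v w (mirror z) = form_y f0 f1 N M v w z.
Proof.
move=> [_ Dz]; apply: eq_bigr => A _; have [_ h0 h1] := f01 A.
by rewrite res_a_mirror res_b_mirror (ipNl hX) h0// h1//; ring.
Qed.

Lemma form_x_rot_mirror N M v w z : O z ->
  form_x (fun A z => - f1 A z) f0 N M v w (mirror z) =
  form_x (fun A z => - f1 A z) f0 N M v w z.
Proof.
move=> [_ Dz]; apply: eq_bigr => A _; have [_ h0 h1] := f01 A.
by rewrite res_a_mirror res_b_mirror (ipNl hX) h0// h1//; ring.
Qed.

Lemma form_y_rot_mirror N M v w z : O z ->
  form_y (fun A z => - f1 A z) f0 N M v w (mirror z) =
  - form_y (fun A z => - f1 A z) f0 N M v w z.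
Proof.
move=> [_ Dz]; rewrite /form_y -sumrN; apply: eq_bigr => A _.
have [_ h0 h1] := f01 A.
by rewrite res_a_mirror res_b_mirror (ipNl hX) h0// h1//; ring.
Qed.

Variable K : set (R * R).
Hypotheses (KO : forall z, K z -> ~ O z) (Kr : forall z, K z -> K (mirror z)).

(** The form changes its sign under reflection, as does the orientation of a
    cycle: its integral only depends on the winding numbers. *)
Lemma contour_independence L L' N M v w : surrounds K O L -> surrounds K O L' ->
  \sum_(c <- L) arcint (form_x f0 f1 N M v w) (form_y f0 f1 N M v w) c 0 1 =
  \sum_(c <- L') arcint (form_x f0 f1 N M v w) (form_y f0 f1 N M v w) c 0 1.
Proof.
move=> sL sL'; have cf := form_closed N M v w f_CR.
rewrite (integral_mirrored oO cf KO Or Kr sL sL') -sumrN big_seq [RHS]big_seq.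
apply: eq_bigr => c cL; have [C1 _ LO _ _] := sL'.
rewrite arcint_mirror; last exact: C1.
rewrite -[RHS]opprK -(arcintN cf (C1 _ cL) (fun t => LO c t cL)); congr (- _).
apply: eq_arcint => t; rewrite /between min_l// max_r// => t01.
by rewrite form_x_mirror ?form_y_mirror//; exact: LO.
Qed.

(** The rotated form is invariant under reflection, which reverses cycles. *)
Lemma rotated_integral0 L N M v w : surrounds K O L ->
  \sum_(c <- L) arcint (form_x (fun A z => - f1 A z) f0 N M v w)
    (form_y (fun A z => - f1 A z) f0 N M v w) c 0 1 = 0.
Proof.
move=> sL; have cf := form_closed N M v w f_rot.
have E := integral_mirrored oO cf KO Or Kr sL sL.
suff E' : \sum_(c <- L) arcint (form_x (fun A z => - f1 A z) f0 N M v w)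
    (form_y (fun A z => - f1 A z) f0 N M v w) (mirror_arc c) 0 1 =
    \sum_(c <- L) arcint (form_x (fun A z => - f1 A z) f0 N M v w)
    (form_y (fun A z => - f1 A z) f0 N M v w) c 0 1.
  by have /eqP := etrans E (congr1 -%R E'); rewrite -addr_eq0 -mulr2n mulrn_eq0 => /eqP.
apply: eq_big_seq => c cL; have [C1 _ LO _ _] := sL.
rewrite arcint_mirror; last exact: C1.
apply: eq_arcint => t; rewrite /between min_l// max_r// => t01.
by rewrite form_x_rot_mirror ?form_y_rot_mirror ?opprK//; exact: LO.
Qed.

(** With gamma = x + J y, the product -J gamma' f is p + J q. *)
Definition coef_p (c : R -> R * R) A t : R :=
  (derive1 c t).2 * f0 A (c t) + (derive1 c t).1 * f1 A (c t).
Definition coef_q (c : R -> R * R) A t : R :=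
  (derive1 c t).2 * f1 A (c t) - (derive1 c t).1 * f0 A (c t).

(** The common shape of the integrands of the left and of the right calculus:
    all that involves the basis and the imaginary unit is in M, N, M', N'. *)
Definition twisted_integrand (M N M' N' : {set 'I_d} -> X -> X)
    (c : R -> R * R) (t : R) v : X :=
  \sum_A (coef_p c A t *: (M A (ra (c t) (N A v)) - M' A (rb (c t) (N' A v))) +
          coef_q c A t *: (M' A (ra (c t) (N' A v)) + M A (rb (c t) (N A v)))).

Section Twisted.
Variables M N M' N' Ms Ms' : {set 'I_d} -> X -> X.
Hypotheses (MB : forall A u v, M A (u - v) = M A u - M A v)
  (M'B : forall A u v, M' A (u - v) = M' A u - M' A v)
  (Mb : forall A, bounded_op (M A)) (M'b : forall A, bounded_op (M' A))
  (Nb : forall A, bounded_op (N A)) (N'b : forall A, bounded_op (N' A))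
  (MMs : forall A u w, << M A u, w>> = <<u, Ms A w>>)
  (MMs' : forall A u w, << M' A u, w>> = <<u, Ms' A w>>).

Lemma twisted_integrand_cvg c (t : R) : C1_arc c -> O (c t) ->
  op_cvg (nbhs t) (twisted_integrand M N M' N' c) (twisted_integrand M N M' N' c t).
Proof.
move=> cc [hr hD]; have cct := C1_arc_continuous cc (x := t).
have [_ /(_ t) dct] := cc.
have [ca cb] := res_cvg hip Tcl hr; have [ba bb] := res_bounded hip Tcl hr.
have {}ca : op_cvg (nbhs t) (fun s => ra (c s)) (ra (c t)) by move=> e /ca; exact: cct.
have {}cb : op_cvg (nbhs t) (fun s => rb (c s)) (rb (c t)) by move=> e /cb; exact: cct.
have aB := res_aB Tcl hr; have bB := res_bB (T := T) hr.
have cf0 A : {for t, continuous (fun s => f0 A (c s))}.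
  have [k [l [h _ _ _ _]]] := f_CR A.
  by apply: continuous_comp => //; exact: h.
have cf1 A : {for t, continuous (fun s => f1 A (c s))}.
  have [k [l [_ h _ _ _]]] := f_CR A.
  by apply: continuous_comp => //; exact: h.
have d1 : {for t, continuous (fun s => (derive1 c s).1)} by exact: (cvg_fst_comp dct).
have d2 : {for t, continuous (fun s => (derive1 c s).2)} by exact: (cvg_snd_comp dct).
have cp A : {for t, continuous (coef_p c A)}.
  by apply: continuousD; apply: continuousM; [exact: d2|exact: cf0|exact: d1|exact: cf1].
have cq A : {for t, continuous (coef_q c A)}.
  by apply: continuousB; apply: continuousM; [exact: d2|exact: cf1|exact: d1|exact: cf0].
have sandwich (S S' : X -> X) (r : R * R -> X -> X) :
    (forall u v, S (u - v) = S u - S v) -> bounded_op S -> bounded_op S' ->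
    (forall u v, r (c t) (u - v) = r (c t) u - r (c t) v) -> bounded_op (r (c t)) ->
    op_cvg (nbhs t) (fun s => r (c s)) (r (c t)) ->
    op_cvg (nbhs t) (fun s v => S (r (c s) (S' v))) (fun v => S (r (c t) (S' v))).
  move=> SB Sb S'b rB rb' cr.
  apply: (op_cvg_comp (A1 := fun=> S) (A2 := fun s v => r (c s) (S' v))) => //.
  - by apply: bounded_op_comp.
  - exact: op_cvg_cst.
  - apply: (op_cvg_comp (A1 := fun s => r (c s)) (A2 := fun=> S')) => //.
    exact: op_cvg_cst.
apply: op_cvg_sum => A; apply: op_cvgD; apply: op_cvgZ.
- exact: cp.
- by apply: op_cvgB; apply: sandwich.
- by apply: bounded_opB; apply: bounded_op_comp => //; apply: bounded_op_comp.
- exact: cq.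
- by apply: op_cvgD; apply: sandwich.
- by apply: bounded_opD; apply: bounded_op_comp => //; apply: bounded_op_comp.
Qed.

(** The terms with M' and N', in which the imaginary unit is hidden, form the
    closed form of j (f0 + j f1) = - f1 + j f0. *)
Lemma twisted_integrand_ip c (t : R) v w :
  <<twisted_integrand M N M' N' c t v, w>> =
  (form_x f0 f1 N Ms v w (c t) * (derive1 c t).1 +
   form_y f0 f1 N Ms v w (c t) * (derive1 c t).2) -
  (form_x (fun A z => - f1 A z) f0 N' Ms' v w (c t) * (derive1 c t).1 +
   form_y (fun A z => - f1 A z) f0 N' Ms' v w (c t) * (derive1 c t).2).
Proof.
rewrite /twisted_integrand (ip_suml hX) /form_x /form_y !mulr_suml -!big_split/=.
rewrite -sumrB; apply: eq_bigr => A _.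
rewrite [LHS](ipDl hX) [X in X + _ = _](ipZl hX) [X in _ + X = _](ipZl hX).
rewrite (ipBl hX) (ipDl hX) !MMs !MMs' /coef_p /coef_q.
by ring.
Qed.

(** By [rotated_integral0] the terms with M' and N' integrate to 0, which makes
    the integral independent of the imaginary unit. *)
Theorem twisted_integral G : surrounds K O (flatten G) ->
  exists2 I : X -> X, is_cycle_integral (twisted_integrand M N M' N') G I &
    forall v w, <<I v, w>> = \sum_(c <- flatten G)
      arcint (form_x f0 f1 N Ms v w) (form_y f0 f1 N Ms v w) c 0 1.
Proof.
move=> sG; have [C1 _ LO _ _] := sG.
have cfr v w := form_closed N' Ms' v w f_rot.
have cf v w := form_closed N Ms v w f_CR.
have c01 (x : R) : between 0 1 x -> 0 <= x <= 1 by rewrite /between min_l// max_r.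
have one c : exists I : X -> X, c \in flatten G ->
    is_op_integral (twisted_integrand M N M' N' c) I /\
    forall v w, <<I v, w>> =
      arcint (form_x f0 f1 N Ms v w) (form_y f0 f1 N Ms v w) c 0 1 -
      arcint (form_x (fun A z => - f1 A z) f0 N' Ms' v w)
        (form_y (fun A z => - f1 A z) f0 N' Ms' v w) c 0 1.
  have [cG|ncG] := boolP (c \in flatten G); last by exists id.
  have [t|I hI IE] := op_integral_exists hip (F := twisted_integrand M N M' N' c).
    by move=> t01; apply: twisted_integrand_cvg; [exact: C1|exact: LO].
  exists I => _; split => // v w; rewrite IE.
  rewrite (eq_oint (fun t _ => twisted_integrand_ip c t v w)).
  have k1 t : between 0 1 t -> {for t, continuous (fun t =>
      form_x f0 f1 N Ms v w (c t) * (derive1 c t).1 +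
      form_y f0 f1 N Ms v w (c t) * (derive1 c t).2)}.
    by move=> /c01 t01; apply: (arc_integrand_continuous (cf v w));
      [exact: C1|exact: LO].
  have k2 t : between 0 1 t -> {for t, continuous (fun t =>
      form_x (fun A z => - f1 A z) f0 N' Ms' v w (c t) * (derive1 c t).1 +
      form_y (fun A z => - f1 A z) f0 N' Ms' v w (c t) * (derive1 c t).2)}.
    by move=> /c01 t01; apply: (arc_integrand_continuous (cfr v w));
      [exact: C1|exact: LO].
  by rewrite ointB.
have /choice[I HI] := one.
pose L := flatten G.
exists (fun v => \sum_(k < size L) I (nth (cst 0) L k) v).
  exists (fun k => I (nth (cst 0) L k)); split => // k kL.
  by have [] := HI (nth (cst 0) L k) (mem_nth _ kL).
move=> v w; rewrite (ip_suml hX).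
rewrite -(big_mkord xpredT (fun k => <<I (nth (cst 0) L k) v, w>>)).
rewrite -(big_nth (cst 0) xpredT (fun c => <<I c v, w>>)) big_seq.
rewrite (eq_bigr _ (fun c cL => proj2 (HI c cL) v w)) -big_seq sumrB.
by rewrite [X in _ - X](rotated_integral0 N' Ms' v w sG) subr0.
Qed.

End Twisted.

End ContourIntegrals.

(** * Slices, axially symmetric sets and admissible cycles *)

Section Slices.
Context {R : realType} {d : nat}.
Implicit Types (J s : 'rV[R]_d.+1) (x y : R) (K U : set 'rV[R]_d.+1).

Lemma imag_unitN J : imag_unit J -> imag_unit (- J).
Proof.
move=> [J0 J1]; split; first by rewrite !mxE J0 oppr0.
by rewrite -J1 /pv_norm; congr Num.sqrt; apply: eq_bigr => i _; rewrite mxE sqrrN.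
Qed.

Lemma sliceN J x y : slice (- J) x y = slice J x (- y).
Proof. by rewrite /slice scalerN scaleNr. Qed.

Lemma slice_re J x y : imag_unit J -> slice J x y 0 0 = x.
Proof. by move=> [J0 _]; rewrite !mxE J0 eqxx mulr1 mulr0 addr0. Qed.

Lemma slice_im_norm J x y : imag_unit J -> pv_im_norm (slice J x y) = `|y|.
Proof.
move=> HJ; rewrite /pv_im_norm.
have -> : \sum_(i < d) slice J x y 0 (lift ord0 i) ^+ 2 = y ^+ 2.
  rewrite -[RHS]mulr1 -(imag_unit_sum HJ) mulr_sumr; apply: eq_bigr => i _.
  by rewrite !mxE/= mulr0 add0r exprMn.
by rewrite sqrtr_sqr.
Qed.

Lemma axially_symmetric_slice K J J' x y : axially_symmetric K -> imag_unit J ->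
  imag_unit J' -> K (slice J x y) -> K (slice J' x y).
Proof.
move=> sK HJ HJ' /sK h; have [y0|y0] := leP 0 y.
  by have := h J' HJ'; rewrite slice_re// slice_im_norm// ger0_norm.
have := h _ (imag_unitN HJ'); rewrite slice_re// slice_im_norm// ltr0_norm//.
by rewrite sliceN opprK.
Qed.

Variables (K : set 'rV[R]_d.+1) (sK : axially_symmetric K) (J0 : 'rV[R]_d.+1)
  (HJ0 : imag_unit J0).

Lemma plane_setC p : plane_set (~` K) p <-> ~ plane_set K p.
Proof.
split => [h /(_ J0 HJ0)|h J HJ Kp]; first exact: h.
by apply: h => J' HJ'; exact: axially_symmetric_slice Kp.
Qed.

Lemma plane_set_slice p J : imag_unit J -> plane_set K p <-> K (slice J p.1 p.2).
Proof.
by move=> HJ; split => [|Kp J' HJ']; [exact|exact: axially_symmetric_slice Kp].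
Qed.

Lemma plane_set_mirror p : plane_set K p -> plane_set K (mirror p).
Proof. by move=> Kp J HJ; rewrite /mirror/= -sliceN; apply: Kp; exact: imag_unitN. Qed.

Lemma plane_setC_mirror p : plane_set (~` K) p -> plane_set (~` K) (mirror p).
Proof. by move=> Kp J HJ; rewrite /mirror/= -sliceN; apply: Kp; exact: imag_unitN. Qed.

Lemma continuous_slice J : continuous (fun p : R * R => slice J p.1 p.2).
Proof.
move=> p; apply: cvgD; apply: cvgZr_tmp; [exact: cvg_fst|exact: cvg_snd].
Qed.

Lemma open_plane_setC : compact K -> open (plane_set (~` K)).
Proof.
move=> cK; have cl : closed K by apply: compact_closed cK; exact: norm_hausdorff.
have -> : plane_set (~` K) = (fun p => slice J0 p.1 p.2) @^-1` (~` K).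
  apply/seteqP; split => p; first by move=> h; exact: h J0 HJ0.
  by move=> h; apply/plane_setC => /(_ J0 HJ0).
by apply: open_comp; [move=> p _; exact: continuous_slice|exact: closed_openC].
Qed.

Lemma closed_chain_jordan (G : seq (seq (R -> R * R))) :
  (forall i, (i < size G)%N -> jordan_curve (nth [::] G i)) ->
  closed_chain (flatten G) /\ forall c, c \in flatten G -> C1_arc c.
Proof.
elim: G => [|g G IHG] hG; first by split => // h; rewrite big_nil.
have [cG C1G] := IHG (fun i => hG i.+1).
have [n0 C1g closes _] := hG 0%N isT; rewrite /= in n0 C1g closes.
split; last first.
  move=> c; rewrite mem_cat => /orP[cg|]; last exact: C1G.
  by have := C1g (index c g); rewrite index_mem nth_index//; exact.
move=> h; rewrite big_cat/= (cG h) addr0 sumrB !(big_nth (cst 0)).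
apply/eqP; rewrite subr_eq0; apply/eqP.
rewrite [LHS]big_nat; under eq_bigr => i i0 do rewrite closes//.
rewrite -big_nat !big_mkord.
move: (size g) n0 => [//|n] _.
rewrite big_ord_recr [RHS]big_ord_recl/= modnn addrC; congr (_ + _).
by apply: eq_bigr => i _; rewrite modn_small// ltnS.
Qed.

(** A point outside of K where the resolvent is not defined is outside of the
    closure of U, where the winding number is 0. *)
Lemma surrounds_cycle (rho : set (R * R)) U J G : imag_unit J -> open U ->
  K `<=` U -> (forall x y, closure U (slice J x y) -> rho (x, y)) ->
  boundary_cycle U J G ->
  surrounds (plane_set K) (rho `&` plane_set (~` K)) (flatten G).
Proof.
move=> HJ oU KU clU [jG bG inG outG].
have [cG C1G] := closed_chain_jordan jG.
have pi0 : (2 * pi : R) != 0 by rewrite mulf_neq0// gt_eqF ?pi_gt0.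
have wE p : \sum_(c <- flatten G) arcint (theta_x p) (theta_y p) c 0 1 =
    2 * pi * winding G p by rewrite winding_arcint mulVKf.
split => //.
- move=> c t cc t01; have kc : (index c (flatten G) < size (flatten G))%N.
    by rewrite index_mem.
  have [|cl nU] := (proj2 (bG (c t).1 (c t).2)).
    exists (index c (flatten G)), t; split => //.
    by rewrite nth_index// -surjective_pairing.
  split; first by have := clU _ _ cl; rewrite -surjective_pairing.
  apply/plane_setC => /(plane_set_slice _ HJ)/KU Us; apply: nU.
  by have := open_subsetE; rewrite (interior_id U).1.
- move=> p /(plane_set_slice _ HJ)/KU; case: p => x y /inG w.
  by rewrite wE w mulr1.
- move=> [x y] nK nO; rewrite wE outG ?mulr0// => /clU h; apply: nO; split => //.
  exact/plane_setC.
Qed.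

End Slices.

Section SlicePairs.
Context {R : realType} {d : nat}.
Implicit Types (U : set 'rV[R]_d.+1) (f : R -> R -> clifford R d).
Local Notation D U := (plane_set U).

Lemma derivable_is_derive (f : R -> R) x : derivable f x 1 ->
  is_derive x 1 f (derive1 f x).
Proof. by move=> df; rewrite derive1E; exact: derivableP. Qed.

Lemma slice_pair_even_odd U (f0 f1 : R -> R -> clifford R d) : open (D U) -> slice_pair U f0 f1 ->
  even_odd_pair (D U) (fun A z => f0 z.1 z.2 A) (fun A z => f1 z.1 z.2 A).
Proof.
move=> oD [C0 C1 e0 e1 CR] A.
have dx (f : R -> R -> clifford R d) : C1_on (D U) f -> forall z, D U z ->
    is_derive z.1 1 (fun x => f x z.2 A) (partial_x f A z.1 z.2).
  by move=> Cf [x y] Dz; have [h _ _ _] := Cf A x y Dz; exact: derivable_is_derive.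
have dy (f : R -> R -> clifford R d) : C1_on (D U) f -> forall z, D U z ->
    is_derive z.2 1 (fun y => f z.1 y A) (partial_y f A z.1 z.2).
  by move=> Cf [x y] Dz; have [_ h _ _] := Cf A x y Dz; exact: derivable_is_derive.
have cx (f : R -> R -> clifford R d) : C1_on (D U) f -> forall z, D U z ->
    {for z, continuous (fun z => partial_x f A z.1 z.2)}.
  by move=> Cf [x y] Dz; have [_ _ h _] := Cf A x y Dz.
have cc (f : R -> R -> clifford R d) : C1_on (D U) f -> forall z, D U z ->
    {for z, continuous (fun z => f z.1 z.2 A)}.
  move=> Cf [x y] Dz; have [_ h _ _] := Cf A x y Dz.
  by apply: (continuous_of_partials oD Dz (dx f Cf) (cx f Cf)).
split.
- exists (fun z => partial_x f0 A z.1 z.2), (fun z => partial_x f1 A z.1 z.2).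
  split; [exact: cc|exact: cc|exact: cx|exact: cx|].
  move=> z Dz; have Dz' : D U (z.1, z.2) by rewrite -surjective_pairing.
  have [E1 E2] := CR A _ _ Dz'.
  split.
  + exact: dx.
  + by rewrite E1; exact: dy.
  + exact: dx.
  + by rewrite -E2; exact: dy.
- by move=> [x y] Dz /=; rewrite e0.
- by move=> [x y] Dz /=; rewrite e1// ffunE.
Qed.

Lemma derive1Z (g : R -> R) (k x : R) : derivable g x 1 ->
  derivable (fun u => k * g u) x 1 /\ derive1 (fun u => k * g u) x = k * derive1 g x.
Proof.
move=> /derivable_is_derive dg.
have h : is_derive x 1 (fun u => k * g u) (k * derive1 g x) by exact: is_deriveZ.
split; first exact: (@ex_derive _ _ _ _ _ _ _ h).
by rewrite [LHS]derive1E; exact: (@derive_val _ _ _ _ _ _ _ h).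
Qed.

Definition conj_fun (f : R -> R -> clifford R d) x y := cl_conj (f x y).

Lemma C1_on_conj (E : set (R * R)) f : open E -> C1_on E f -> C1_on E (conj_fun f) /\
  forall A x y, E (x, y) -> partial_x (conj_fun f) A x y = cl_sign A A * partial_x f A x y /\
    partial_y (conj_fun f) A x y = cl_sign A A * partial_y f A x y.
Proof.
move=> oE Cf.
have ux A y : (fun u => conj_fun f u y A) = (fun u => cl_sign A A * f u y A).
  by apply/funext => u; rewrite /conj_fun cl_conjE.
have uy A x : (fun u => conj_fun f x u A) = (fun u => cl_sign A A * f x u A).
  by apply/funext => u; rewrite /conj_fun cl_conjE.
have P A x y : E (x, y) ->
    partial_x (conj_fun f) A x y = cl_sign A A * partial_x f A x y /\
    partial_y (conj_fun f) A x y = cl_sign A A * partial_y f A x y.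
  move=> Exy; have [d1 d2 _ _] := Cf A x y Exy.
  rewrite /partial_x /partial_y ux uy.
  by have [_ ->] := derive1Z (cl_sign A A) d1; have [_ ->] := derive1Z (cl_sign A A) d2.
split; last exact: P.
move=> A x y Exy; have [d1 d2 c1 c2] := Cf A x y Exy.
have nE : \forall q \near (x, y), E q by exact: open_nbhs_nbhs (conj oE Exy).
have cont (g g' : R * R -> R) (k : R) : (forall q, E q -> g q = k * g' q) ->
    {for (x, y), continuous g'} -> {for (x, y), continuous g}.
  move=> e cg; rewrite /prop_for /continuous_at e//.
  have : (fun q => k * g' q) @ (x, y) --> k * g' (x, y) by apply: cvgM cg; exact: cvg_cst.
  by apply: cvg_trans; apply: near_eq_cvg; apply: filterS nE => q /e ->.
split.
- by rewrite ux; case: (derive1Z (cl_sign A A) d1).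
- by rewrite uy; case: (derive1Z (cl_sign A A) d2).
- apply: (cont (fun p => partial_x (conj_fun f) A p.1 p.2)
    (fun p => partial_x f A p.1 p.2) (cl_sign A A)); last by [].
  move=> [a b] Eq.
  by case: (P A a b Eq).
- apply: (cont (fun p => partial_y (conj_fun f) A p.1 p.2)
    (fun p => partial_y f A p.1 p.2) (cl_sign A A)); last by [].
  move=> [a b] Eq.
  by case: (P A a b Eq).
Qed.

Lemma slice_pair_conj U (f0 f1 : R -> R -> clifford R d) : open (D U) -> slice_pair U f0 f1 ->
  slice_pair U (conj_fun f0) (conj_fun f1).
Proof.
move=> oD [C0 C1 e0 e1 CR].
have [C0' P0] := C1_on_conj oD C0; have [C1' P1] := C1_on_conj oD C1.
split => //.
- by move=> x y Dz; rewrite /conj_fun e0.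
- by move=> x y Dz; rewrite /conj_fun e1// cl_conjN.
move=> A x y Dz; have [-> ->] := P0 A x y Dz; have [-> ->] := P1 A x y Dz.
by have [-> ->] := CR A x y Dz; rewrite mulrN.
Qed.

End SlicePairs.

Section Integrands.
Context {R : realType} {d : nat} {H : completeNormedModType R}.
Local Notation X := {ffun {set 'I_d} -> H}.
Implicit Types (v w : X) (A : {set 'I_d}).
Variables (ip : H -> H -> R) (hip : hilbert_inner ip).
Let hX : hilbert_inner (rip (d := d) ip) := hilbert_rip hip.
Local Notation "<< u , w >>" := (rip ip u w) (at level 0).
Variables (T : operator d H) (Tcl : op_closed T) (J : 'rV[R]_d.+1) (HJ : imag_unit J).
Local Notation e := (@cl_basis R d).
Local Notation mulJ := (hm_lmul (H := H) (pv_val J)).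

Lemma SL_res_slice x y v : rho_plane T (x, y) ->
  SL_res (slice J x y) T v = res_a T (x, y) v - res_b T (x, y) (mulJ v).
Proof.
move=> hp; rewrite /SL_res Q_op_slice// pv_val_conj_slice// hm_lmulBl !hm_lmulZl.
rewrite hm_lmul1 /res_a /res_b -!/(Qinv T (x, y) _) (QinvB hp) !(QinvZ hp).
by rewrite addrAC.
Qed.

Lemma SR_res_slice x y v : SR_res (slice J x y) T v =
  res_a T (x, y) v - mulJ (res_b T (x, y) v).
Proof.
rewrite /SR_res Q_op_slice// pv_val_conj_slice// hm_lmulBl !hm_lmulZl hm_lmul1.
by rewrite /res_a /res_b -!/(Qinv T (x, y) _) hm_lmulZr addrAC.
Qed.

Lemma arc_dsJ_mul c (t : R) v : hm_lmul (arc_dsJ J c t) v =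
  (derive1 c t).2 *: v - (derive1 c t).1 *: mulJ v.
Proof.
rewrite /arc_dsJ pv_val_slice// cl_mulDr !cl_mulZr !cl_mulNl cl_mul1r imag_unit_sqr//.
by rewrite opprK hm_lmulDl !hm_lmulZl hm_lmulNl hm_lmul1 scalerN addrC.
Qed.

Variables (f : 'rV[R]_d.+1 -> clifford R d) (f0 f1 : R -> R -> clifford R d).
Local Notation F0 := (fun A (z : R * R) => f0 z.1 z.2 A).
Local Notation F1 := (fun A (z : R * R) => f1 z.1 z.2 A).

Let linear_sum (S : X -> X) (g : {set 'I_d} -> R) (h : {set 'I_d} -> X) :
  (forall u v, S (u + v) = S u + S v) -> (forall (k : R) v, S (k *: v) = k *: S v) ->
  S (\sum_A g A *: h A) = \sum_A g A *: S (h A).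
Proof.
move=> SD SZ; have S0 : S 0 = 0 by rewrite -[0 in LHS](scale0r 0) SZ scale0r.
by rewrite (big_morph S SD S0); apply: eq_bigr => A _; rewrite SZ.
Qed.

(** Here S_L^-1(s, T) = a - b J is applied to (p + J q) v. *)
Lemma SL_integrand_twisted c (t : R) v : rho_plane T (c t) ->
  f (arc_point J c t) = f0 (c t).1 (c t).2 + cl_mul (pv_val J) (f1 (c t).1 (c t).2) ->
  SL_integrand J T f c t v =
  twisted_integrand T F0 F1 (fun=> id) (fun A => hm_lmul (e A)) (fun=> id)
    (fun A u => mulJ (hm_lmul (e A) u)) c t v.
Proof.
move=> hr fE; rewrite /SL_integrand fE hm_lmulM arc_dsJ_mul hm_lmulDl hm_lmulM.
rewrite /arc_point SL_res_slice; last by rewrite -surjective_pairing.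
rewrite -surjective_pairing.
set y' := (derive1 c t).2; set x' := (derive1 c t).1.
pose p A := coef_p F0 F1 c A t; pose q A := coef_q F0 F1 c A t.
have Eu : y' *: (hm_lmul (f0 (c t).1 (c t).2) v + mulJ (hm_lmul (f1 (c t).1 (c t).2) v)) -
    x' *: mulJ (hm_lmul (f0 (c t).1 (c t).2) v + mulJ (hm_lmul (f1 (c t).1 (c t).2) v)) =
    \sum_A p A *: hm_lmul (e A) v + \sum_A q A *: mulJ (hm_lmul (e A) v).
  rewrite (hm_lmulDr (pv_val J)) hm_lmul_imag_unit//.
  rewrite (hm_lmul_decomp (f0 _ _)) (hm_lmul_decomp (f1 _ _)).
  rewrite !(linear_sum _ _ (@hm_lmulDr _ _ _ (pv_val J)) (@hm_lmulZr _ _ _ (pv_val J))).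
  rewrite -big_split -sumrB !scaler_sumr -sumrB -big_split/=; apply: eq_bigr => A _.
  apply: (ip_ext hX) => w; rewrite !(ipDl hX, ipNl hX, ipZl hX) /p /q /coef_p /coef_q.
  by rewrite -/x' -/y'; ring.
rewrite Eu (hm_lmulDr (pv_val J)).
rewrite !(linear_sum _ _ (@hm_lmulDr _ _ _ (pv_val J)) (@hm_lmulZr _ _ _ (pv_val J))).
rewrite (res_aD Tcl hr) (res_bD hr) !(linear_sum _ _ (res_aD Tcl hr) (res_aZ Tcl hr)).
rewrite !(linear_sum _ _ (res_bD hr) (res_bZ hr)).
rewrite -!big_split/= -sumrB; apply: eq_bigr => A _.
have bN u : res_b T (c t) (- u) = - res_b T (c t) u.
  by rewrite -scaleN1r (res_bZ hr) scaleN1r.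
rewrite hm_lmul_imag_unit// bN -/(p A) -/(q A).
move: (res_a T (c t) _) (res_a T (c t) _) (res_b T (c t) _) (res_b T (c t) _) => a b a' b'.
by apply: (ip_ext hX) => w; rewrite !(ipDl hX, ipNl hX, ipZl hX); ring.
Qed.

(** On this side the coefficients of f stand to the left of J, and p + q J is
    applied to S_R^-1(s, T) v = (a - J b) v. *)
Lemma SR_integrand_twisted c (t : R) v :
  f (arc_point J c t) = f0 (c t).1 (c t).2 + cl_mul (f1 (c t).1 (c t).2) (pv_val J) ->
  SR_integrand J T f c t v =
  twisted_integrand T F0 F1 (fun A => hm_lmul (e A)) (fun=> id)
    (fun A u => hm_lmul (e A) (mulJ u)) (fun=> id) c t v.
Proof.
move=> fE; rewrite /SR_integrand fE hm_lmulM arc_dsJ_mul hm_lmulDl hm_lmulM.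
rewrite /arc_point SR_res_slice -surjective_pairing.
rewrite /twisted_integrand /=; move: (res_a T (c t) v) (res_b T (c t) v) => a b.
rewrite (hm_lmulDr (pv_val J)) !(hm_lmulNr, hm_lmulZr) hm_lmul_imag_unit//.
rewrite (hm_lmul_decomp (f0 _ _)) (hm_lmul_decomp (f1 _ _)) -big_split/=.
apply: eq_bigr => A _.
rewrite !(hm_lmulDr, hm_lmulNr, hm_lmulZr) !hm_lmul_imag_unit// !hm_lmulNr.
apply: (ip_ext hX) => w; rewrite !(ipDl hX, ipNl hX, ipZl hX) /coef_p /coef_q.
by ring.
Qed.

End Integrands.

(** * The functional calculus paired with vectors *)

Section Calculus.
Context {R : realType} {d : nat} {H : completeNormedModType R}.
Local Notation X := {ffun {set 'I_d} -> H}.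
Implicit Types (u v w : X) (A C : {set 'I_d}) (z : R * R).
Variables (ip : H -> H -> R) (hip : hilbert_inner ip).
Let hX : hilbert_inner (rip (d := d) ip) := hilbert_rip hip.
Local Notation "<< u , w >>" := (rip ip u w) (at level 0).
Local Notation e := (@cl_basis R d).
Local Notation sgn := (@cl_sign R d).

Variables (K : set 'rV[R]_d.+1) (cK : compact K) (sK : axially_symmetric K).
Local Notation D := (plane_set (~` K)).
Local Notation dom T := (rho_plane T `&` D).

Section OneOperator.
Variables (T : operator d H) (Tcl : op_closed T).
Variables (J : 'rV[R]_d.+1) (HJ : imag_unit J) (G : seq (seq (R -> R * R))).
Hypothesis sG : surrounds (plane_set K) (dom T) (flatten G).
Variables (f0 f1 : R -> R -> clifford R d) (Hf : slice_pair (~` K) f0 f1).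
Local Notation F0 := (fun A (z : R * R) => f0 z.1 z.2 A).
Local Notation F1 := (fun A (z : R * R) => f1 z.1 z.2 A).

Let oD : open D. Proof. exact (open_plane_setC sK HJ cK). Qed.

Let f01 : even_odd_pair D F0 F1. Proof. exact: slice_pair_even_odd. Qed.

Let KO z : plane_set K z -> ~ dom T z.
Proof. by move=> Kz [_ /(plane_setC sK HJ)]; exact. Qed.

Lemma is_cycle_integral_ext (F F' : (R -> R * R) -> R -> X -> X) I :
  (forall c (t : R), c \in flatten G -> 0 <= t <= 1 -> forall v, F c t v = F' c t v) ->
  is_cycle_integral F G I -> is_cycle_integral F' G I.
Proof.
move=> E [Ik [hI IE]]; exists Ik; split => // k kG.
apply: is_op_integral_ext (hI k kG) => t t01 v; apply: E => //; exact: mem_nth.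
Qed.

(** The values of the integrals after the terms with the imaginary unit have
    disappeared. In the left calculus e_A acts before the resolvent, in the right
    calculus after it, which becomes conj e_A on the other side of the inner
    product. *)
Definition left_value (I : X -> X) := forall v w, <<I v, w>> =
  \sum_(c <- flatten G)
     arcint (form_x ip T F0 F1 (fun A => hm_lmul (e A)) (fun=> id) v w)
            (form_y ip T F0 F1 (fun A => hm_lmul (e A)) (fun=> id) v w) c 0 1.

Definition right_value (I : X -> X) := forall v w, <<I v, w>> =
  \sum_(c <- flatten G)
     arcint (form_x ip T F0 F1 (fun=> id) (fun A => hm_lmul (cl_conj (e A))) v w)
            (form_y ip T F0 F1 (fun=> id) (fun A => hm_lmul (cl_conj (e A))) v w) c 0 1.

Let bounded_id : bounded_op (id : X -> X).
Proof. by exists 1 => // v; rewrite mul1r. Qed.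

Let bounded_lmul s : bounded_op (hm_lmul s : X -> X).
Proof. exact: hm_lmul_bounded. Qed.

Lemma left_integral f : (forall x y J, D (x, y) -> imag_unit J ->
    f (slice J x y) = f0 x y + cl_mul (pv_val J) (f1 x y)) ->
  exists2 I : X -> X, is_cycle_integral (SL_integrand J T f) G I & left_value I.
Proof.
move=> fE.
have Jb A : bounded_op (fun u : X => hm_lmul (pv_val J) (hm_lmul (e A) u)).
  exact: bounded_op_comp (bounded_lmul _) (bounded_lmul _).
have [I hI IE] := twisted_integral hip Tcl oD (plane_setC_mirror (K := K)) f01 KO
  (plane_set_mirror (K := K)) (M := fun=> id) (M' := fun=> id) (Ms := fun=> id)
  (Ms' := fun=> id) (fun _ _ _ => erefl) (fun _ _ _ => erefl) (fun=> bounded_id)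
  (fun=> bounded_id) (fun A => bounded_lmul (e A)) Jb (fun _ _ _ => erefl)
  (fun _ _ _ => erefl) sG.
exists I => //; apply: is_cycle_integral_ext hI => c t cG t01 v.
have [_ _ /(_ c t cG t01)[hr hD] _ _] := sG.
rewrite (SL_integrand_twisted hip Tcl HJ (f0 := f0) (f1 := f1))//.
by rewrite /arc_point fE// -surjective_pairing.
Qed.

Lemma right_integral f : (forall x y J, D (x, y) -> imag_unit J ->
    f (slice J x y) = f0 x y + cl_mul (f1 x y) (pv_val J)) ->
  exists2 I : X -> X, is_cycle_integral (SR_integrand J T f) G I & right_value I.
Proof.
move=> fE.
have Jb A : bounded_op (fun u : X => hm_lmul (e A) (hm_lmul (pv_val J) u)).
  exact: bounded_op_comp (bounded_lmul _) (bounded_lmul _).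
have JB A (u v : X) : hm_lmul (e A) (hm_lmul (pv_val J) (u - v)) =
    hm_lmul (e A) (hm_lmul (pv_val J) u) - hm_lmul (e A) (hm_lmul (pv_val J) v).
  by rewrite !hm_lmulBr.
have Js A (u w : X) : <<hm_lmul (e A) (hm_lmul (pv_val J) u), w>> =
    <<u, hm_lmul (cl_conj (pv_val J)) (hm_lmul (cl_conj (e A)) w)>>.
  by rewrite !(rip_lmul hip).
have [I hI IE] := twisted_integral hip Tcl oD (plane_setC_mirror (K := K)) f01 KO
  (plane_set_mirror (K := K)) (N := fun=> id) (N' := fun=> id)
  (fun A => hm_lmulBr (e A)) JB (fun A => bounded_lmul (e A)) Jb (fun=> bounded_id)
  (fun=> bounded_id) (fun A => rip_lmul hip (e A)) Js sG.
exists I => //; apply: is_cycle_integral_ext hI => c t cG t01 v.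
have [_ _ /(_ c t cG t01)[hr hD] _ _] := sG.
rewrite (SR_integrand_twisted hip T HJ (f0 := f0) (f1 := f1))//.
by rewrite /arc_point fE// -surjective_pairing.
Qed.

End OneOperator.

End Calculus.

(** * Adjoints of contour integrals *)

Section RightLinearity.
Context {R : realType} {d : nat} {H : completeNormedModType R}.
Local Notation X := {ffun {set 'I_d} -> H}.
Implicit Types (u v w : X) (A C : {set 'I_d}) (z : R * R).
Variables (ip : H -> H -> R) (hip : hilbert_inner ip).
Let hX : hilbert_inner (rip (d := d) ip) := hilbert_rip hip.
Local Notation "<< u , w >>" := (rip ip u w) (at level 0).
Local Notation e := (@cl_basis R d).
Local Notation sgn := (@cl_sign R d).
Variables (T : operator d H) (Tcl : op_closed T) (D : set (R * R)) (oD : open D).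
Local Notation O := (rho_plane T `&` D).

Lemma hm_lmul_rmul s C v : hm_lmul s (hm_rmul v (e C)) = hm_rmul (hm_lmul s v) (e C).
Proof.
rewrite (hm_lmul_decomp s (hm_rmul _ _)) (hm_lmul_decomp s v).
have r0 : hm_rmul (0 : X) (e C) = 0 by rewrite -{1}(scale0r (0 : X)) hm_rmulZl scale0r.
rewrite (big_morph (fun v => hm_rmul v (e C)) (hm_rmulDl (e C)) r0).
by apply: eq_bigr => A _; rewrite hm_lrmul hm_rmulZl.
Qed.

Variables (f0 f1 : {set 'I_d} -> R * R -> R) (f01 : even_odd_pair D f0 f1).
Variables N M : {set 'I_d} -> X -> X.
Hypothesis NC : forall A C v, N A (hm_rmul v (e C)) = hm_rmul (N A v) (e C).
Hypothesis MC : forall A C v, M A (hm_rmul v (e C)) = hm_rmul (M A v) (e C).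

Lemma form_rmul C v w z : rho_plane T z ->
  form_x ip T f0 f1 N M (hm_rmul v (e C)) w z =
    sgn C C * form_x ip T f0 f1 N M v (hm_rmul w (e C)) z /\
  form_y ip T f0 f1 N M (hm_rmul v (e C)) w z =
    sgn C C * form_y ip T f0 f1 N M v (hm_rmul w (e C)) z.
Proof.
move=> hz; rewrite /form_x /form_y !mulr_sumr.
by split; apply: eq_bigr => A _; rewrite NC MC (res_a_rmul Tcl hz) (res_b_rmul hz)
  !(rip_rmul_basis hip); ring.
Qed.

Lemma contour_integral_rmul L (I : X -> X) :
  (forall c, c \in L -> C1_arc c) ->
  (forall c (t : R), c \in L -> 0 <= t <= 1 -> O (c t)) ->
  (forall v w, <<I v, w>> = \sum_(c <- L)
    arcint (form_x ip T f0 f1 N M v w) (form_y ip T f0 f1 N M v w) c 0 1) ->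
  forall C v, I (hm_rmul v (e C)) = hm_rmul (I v) (e C).
Proof.
move=> C1 LO IE C v; apply: (ip_ext hX) => w.
rewrite (rip_rmul_basis hip) !IE mulr_sumr; apply: eq_big_seq => c cL.
have cf := form_closed hip Tcl oD N M v (hm_rmul w (e C)) (fun A => let: And3 h _ _ := f01 A in h).
rewrite -(arcintZ _ cf (C1 c cL) (fun t => LO c t cL)); apply: eq_arcint => t.
rewrite /between min_l// max_r// => t01.
by have [hr _] := LO c t cL t01; exact: form_rmul.
Qed.

End RightLinearity.

Section AdjointConclusion.
Context {R : realType} {d : nat} {H : completeNormedModType R}.
Local Notation X := {ffun {set 'I_d} -> H}.
Implicit Types (u v w : X) (A C : {set 'I_d}) (z : R * R).
Variables (ip : H -> H -> R) (hip : hilbert_inner ip).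
Let hX : hilbert_inner (rip (d := d) ip) := hilbert_rip hip.
Local Notation "<< u , w >>" := (rip ip u w) (at level 0).
Local Notation e := (@cl_basis R d).
Local Notation sgn := (@cl_sign R d).

(** The Clifford-valued adjoint relation follows from the real one by right
    linearity. *)
Lemma op_eq_adjoint (S S' : X -> X) :
  (forall C v, S' (hm_rmul v (e C)) = hm_rmul (S' v) (e C)) ->
  (forall w v, << S w, v>> = <<w, S' v>>) ->
  op_eq (op_total S) (adjoint ip (op_total S')).
Proof.
move=> S'C SS'.
have adj w : adj_at ip (op_total S') w (S w).
  by move=> v _; apply: (hm_ip_ext hip) => C; rewrite SS' S'C.
split; first by apply/seteqP; split => // w _; exists (S w).
move=> w _; rewrite /=; case: xgetP => [u _ hu|/(_ _ (adj w))//].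
apply: (ip_ext hX) => v.
by rewrite -!(hm_ip_scalar hip) (adj w v)// (hu v).
Qed.

Lemma surrounds_sub (K O O' : set (R * R)) L : O `<=` O' -> surrounds K O L -> surrounds K O' L.
Proof.
move=> OO [C1 cyc LO LK L0]; split => // [c t cL t01|p nK nO'].
  by apply: OO; exact: LO.
by apply: L0 => // /OO.
Qed.

Variables (T : operator d H) (Tcl : op_closed T) (Td : densely_defined T).
Local Notation Ts := (adjoint ip T).
Variables (D : set (R * R)) (oD : open D) (Dr : forall z, D z -> D (mirror z)).
Variable K : set (R * R).
Hypotheses (KD : forall z, K z -> ~ D z) (Kr : forall z, K z -> K (mirror z)).
Variables (f0 f1 g0 g1 : {set 'I_d} -> R * R -> R) (f01 : even_odd_pair D f0 f1).
Hypotheses (g0E : forall A z, D z -> g0 A z = sgn A A * f0 A z)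
           (g1E : forall A z, D z -> g1 A z = sgn A A * f1 A z).
Variables (L L' : seq (R -> R * R)).
Hypotheses (sL : surrounds K (rho_plane Ts `&` D) L) (sL' : surrounds K (rho_plane T `&` D) L').
Variables N M N' M' : {set 'I_d} -> X -> X.
(** Pairs of insertions of e_A that correspond to each other when the operator
    between them is replaced by its adjoint. *)
Hypothesis NM : forall A (r r' : X -> X), (forall w v, << r' w, v>> = <<w, r v>>) ->
  forall v w, << r' (N A v), M A w>> = sgn A A * << r (N' A w), M' A v>>.

(** Both cycles surround K in the plane of T^*; once L is replaced by L', the
    integrands agree pointwise. *)
Lemma contour_integral_adjoint v w :
  \sum_(c <- L) arcint (form_x ip Ts f0 f1 N M v w) (form_y ip Ts f0 f1 N M v w) c 0 1 =
  \sum_(c <- L') arcint (form_x ip T g0 g1 N' M' w v) (form_y ip T g0 g1 N' M' w v) c 0 1.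
Proof.
have Tscl := adjoint_closed hip Tcl Td.
have sub : rho_plane T `&` D `<=` rho_plane Ts `&` D.
  by move=> z [/(rho_plane_adjoint hip Tcl Td)[h _] hD].
have KO z : K z -> ~ (rho_plane Ts `&` D) z by move=> /KD h [_ /h].
rewrite (contour_independence hip Tscl oD Dr f01 KO Kr N M v w sL (surrounds_sub sub sL')).
have [_ _ LO _ _] := sL'.
apply: eq_big_seq => c cL; apply: eq_arcint => t.
rewrite /between min_l// max_r// => /(LO c t cL)[hr hD].
have radj w' v' := res_adjoint hip Tcl Td w' v' hr.
split; apply: eq_bigr => A _; rewrite g0E// g1E//.
  rewrite (NM A (fun w v => (radj w v).1)) (NM A (fun w v => (radj w v).2)).
  by ring.
rewrite (NM A (fun w v => (radj w v).1)) (NM A (fun w v => (radj w v).2)).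
by ring.
Qed.

End AdjointConclusion.

(** * Conjugate functions *)

Section SharpFunction.
Context {R : realType} {d : nat}.
Implicit Types (f : 'rV[R]_d.+1 -> clifford R d) (K : set 'rV[R]_d.+1).
Local Notation e := (@cl_basis R d).

Lemma lim_infty_sharp f c : lim_infty f c -> lim_infty (sharp f) (cl_conj c).
Proof.
move=> fc eps e0; have [M HM] := fc _ e0; exists M => s Ms.
rewrite /sharp -cl_conjN -cl_conjD cl_norm_conj; apply: HM.
suff -> : pv_norm (pv_conj s) = pv_norm s by [].
congr Num.sqrt; apply: eq_bigr => i _; rewrite mxE.
by case: ifP => // _; rewrite sqrrN.
Qed.

Lemma cl_conj_imag_unit (J : 'rV[R]_d.+1) : imag_unit J -> cl_conj (pv_val J) = - pv_val J.
Proof.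
move=> [J0 _]; rewrite /pv_val J0 scale0r add0r (big_morph _ (@cl_conjD R d) cl_conj0).
rewrite -sumrN; apply: eq_bigr => i _; apply/ffunP => A.
rewrite cl_conjE !ffunE; case: eqP => [->|_]; last by rewrite !scaler0 mulr0 oppr0.
by rewrite cl_sign1 leqnn mulN1r.
Qed.

Lemma exists_imag_unit : (1 <= d)%N -> exists J : 'rV[R]_d.+1, imag_unit J.
Proof.
case: d => // n _; pose i0 : 'I_n.+2 := lift ord0 ord0.
exists (delta_mx 0 i0); split; first by rewrite mxE.
rewrite /pv_norm (bigD1 i0)//= mxE !eqxx expr1n big1 ?addr0 ?sqrtr1// => i ne.
by rewrite mxE (negbTE ne) andbF expr0n.
Qed.

(** Conjugation reverses the product J f1 and changes the sign of J; since f1 is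
    odd, the conjugation of the argument changes the sign back. *)
Lemma SH_R_sharp K f (f0 f1 : R -> R -> clifford R d) : slice_pair (~` K) f0 f1 ->
  (forall x y J, plane_set (~` K) (x, y) -> imag_unit J ->
    f (slice J x y) = f0 x y + cl_mul (pv_val J) (f1 x y)) ->
  forall x y J, plane_set (~` K) (x, y) -> imag_unit J ->
    sharp f (slice J x y) = conj_fun f0 x y + cl_mul (conj_fun f1 x y) (pv_val J).
Proof.
move=> [_ _ e0 e1 _] fE x y J Dz HJ; rewrite /sharp pv_conj_slice// fE//; last first.
  exact: (plane_setC_mirror Dz).
rewrite e0// e1// cl_mulNr cl_conjD cl_conjN cl_conjM cl_conj_imag_unit//.
by rewrite cl_mulNr opprK.
Qed.

Lemma SH_L_sharp K f (f0 f1 : R -> R -> clifford R d) : slice_pair (~` K) f0 f1 ->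
  (forall x y J, plane_set (~` K) (x, y) -> imag_unit J ->
    f (slice J x y) = f0 x y + cl_mul (f1 x y) (pv_val J)) ->
  forall x y J, plane_set (~` K) (x, y) -> imag_unit J ->
    sharp f (slice J x y) = conj_fun f0 x y + cl_mul (pv_val J) (conj_fun f1 x y).
Proof.
move=> [_ _ e0 e1 _] fE x y J Dz HJ; rewrite /sharp pv_conj_slice// fE//; last first.
  exact: (plane_setC_mirror Dz).
rewrite e0// e1// cl_mulNl cl_conjD cl_conjN cl_conjM cl_conj_imag_unit//.
by rewrite cl_mulNl opprK.
Qed.

Lemma cl_real_conj a : cl_real a -> cl_conj a = a :> clifford R d.
Proof.
move=> ra; apply/ffunP => A; rewrite cl_conjE.
by have [->|/ra ->] := eqVneq A finset.set0; rewrite ?cl_sign0l ?mul1r ?mulr0.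
Qed.

Lemma cl_real_comm a b : cl_real a -> cl_mul a b = cl_mul b a :> clifford R d.
Proof.
move=> ra; have -> : a = a finset.set0 *: e finset.set0.
  rewrite [LHS]cl_decomp (bigD1 finset.set0)//= big1 ?addr0// => A /ra ->.
  by rewrite scale0r.
by rewrite cl_mulZl cl_mulZr cl_mul1l cl_mul1r.
Qed.

(** On the real axis f is real and f_infty is the limit along it. *)
Lemma cl_real_lim K f (J : 'rV[R]_d.+1) c : imag_unit J -> compact K ->
  axially_symmetric K -> SH_N (~` K) f -> lim_infty f c -> cl_real c.
Proof.
move=> HJ cK sK [f0 [f1 [[_ _ _ e1 _] freal fE]]] fc A A0.
apply: contrapT => /eqP cA; have cA0 : 0 < `|c A| by rewrite normr_gt0.
have [M HM] := fc _ cA0.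
have cK0 : compact ((fun s : 'rV[R]_d.+1 => s 0 0) @` K).
  apply: continuous_compact => //; apply: continuous_subspaceT.
  exact: coord_continuous.
have [N HN] : exists N : R, forall x, ((fun s : 'rV[R]_d.+1 => s 0 0) @` K) x -> `|x| <= N.
  have [N HN] := compact_bounded cK0; exists (N + 1) => y Ky.
  by apply: (HN.2 (N + 1) _ y Ky); rewrite ltrDl ltr01.
pose x := `|M| + `|N| + 1.
have xM : M < x by rewrite /x; have := ler_norm M; have := normr_ge0 N; lra.
have xN : N < x by rewrite /x; have := ler_norm N; have := normr_ge0 M; lra.
have x0 : 0 <= x by rewrite /x !addr_ge0.
have Dx : plane_set (~` K) (x, 0).
  apply/(plane_setC sK HJ) => /(_ J HJ)/= Kx.
  have /= := HN x; rewrite -{1}(slice_re x 0 HJ) => /(_ (ex_intro2 _ _ _ Kx erefl)).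
  by rewrite ger0_norm// leNgt xN.
have f10 : f1 x 0 = 0.
  have := e1 x 0 Dx; rewrite oppr0 => /eqP; rewrite -addr_eq0 -mulr2n -scaler_nat.
  by rewrite scaler_eq0 pnatr_eq0/= => /eqP.
have norm_x : pv_norm (slice J x 0) = x.
  rewrite /pv_norm big_ord_recl slice_re// big1 ?addr0 ?sqrtr_sqr ?ger0_norm// => i _.
  by rewrite !mxE/= mulr0 mul0r addr0 expr0n.
have := HM (slice J x 0); rewrite norm_x => /(_ xM).
apply/negP; rewrite -leNgt fE// f10.
have -> : cl_mul (pv_val J) 0 = 0.
  by have := cl_mulZr 0 (pv_val J) 0; rewrite !scale0r.
rewrite addr0 -sqrtr_sqr ler_wsqrtr// (bigD1 A)//= !ffunE.
have [-> // _] := freal _ _ Dx; rewrite add0r sqrrN lerDl.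
by apply: sumr_ge0 => i _; exact: sqr_ge0.
Qed.

End SharpFunction.

(** * The adjoint of the functional calculus *)

Section AdjointCalculus.
Context {R : realType} {d : nat} {H : completeNormedModType R}.
Local Notation X := {ffun {set 'I_d} -> H}.
Implicit Types (u v w : X) (A C : {set 'I_d}) (z : R * R) (S I : X -> X).
Variables (ip : H -> H -> R) (hip : hilbert_inner ip).
Let hX : hilbert_inner (rip (d := d) ip) := hilbert_rip hip.
Local Notation "<< u , w >>" := (rip ip u w) (at level 0).
Local Notation e := (@cl_basis R d).
Local Notation sgn := (@cl_sign R d).
Variables (T : operator d H) (Tcl : op_closed T) (Td : densely_defined T).
Local Notation Ts := (adjoint ip T).
Variables (K : set 'rV[R]_d.+1) (cK : compact K) (sK : axially_symmetric K).
Local Notation D := (plane_set (~` K)).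

Lemma admissible_surrounds (S : operator d H) J U G : admissible S K J U G ->
  surrounds (plane_set K) (rho_plane S `&` D) (flatten G).
Proof.
move=> [HJ [oU _ _] KU clU bG]; apply: (surrounds_cycle sK HJ HJ oU KU) bG.
by move=> x y /clU; rewrite rho_S_slice.
Qed.

Lemma calculus_op_eq c (k : R) I I' :
  (forall C v, I' (hm_rmul v (e C)) = hm_rmul (I' v) (e C)) ->
  (forall v w, <<I v, w>> = <<I' w, v>>) ->
  op_eq (op_total (fun v => hm_lmul c v - k *: I v))
    (adjoint ip (op_total (fun v => hm_lmul (cl_conj c) v - k *: I' v))).
Proof.
move=> I'C II'; apply: (op_eq_adjoint hip) => [C v|w v].
  by rewrite I'C hm_lmul_rmul hm_rmulBl hm_rmulZl.
by rewrite (ipBl hX) (ipBr hX) (ipZl hX) (ipZr hX) (rip_lmul hip) II' (ipC hX w (I' v)).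
Qed.

Variables (J : 'rV[R]_d.+1) (HJ : imag_unit J).
Variables (f0 f1 g0 g1 : R -> R -> clifford R d).
Hypotheses (Hf : slice_pair (~` K) f0 f1) (Hg : slice_pair (~` K) g0 g1).
Hypothesis gE : forall x y, D (x, y) ->
  g0 x y = cl_conj (f0 x y) /\ g1 x y = cl_conj (f1 x y).
Variables (G G' : seq (seq (R -> R * R))).
Hypotheses (sG : surrounds (plane_set K) (rho_plane Ts `&` D) (flatten G))
  (sG' : surrounds (plane_set K) (rho_plane T `&` D) (flatten G')).

Let oD : open D. Proof. exact (open_plane_setC sK HJ cK). Qed.

Let f01 := slice_pair_even_odd oD Hf.
Let g01 := slice_pair_even_odd oD Hg.

Let KD z : plane_set K z -> ~ D z.
Proof. by move=> Kz /(plane_setC sK HJ); exact. Qed.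

Let g0E A z : D z -> g0 z.1 z.2 A = sgn A A * f0 z.1 z.2 A.
Proof. by case: z => x y /gE[/= -> _]; rewrite cl_conjE. Qed.

Let g1E A z : D z -> g1 z.1 z.2 A = sgn A A * f1 z.1 z.2 A.
Proof. by case: z => x y /gE[/= _ ->]; rewrite cl_conjE. Qed.

Lemma left_value_adjoint I I' : left_value ip Ts G f0 f1 I ->
  right_value ip T G' g0 g1 I' ->
  (forall C v, I' (hm_rmul v (e C)) = hm_rmul (I' v) (e C)) /\
  forall v w, <<I v, w>> = <<I' w, v>>.
Proof.
move=> IE I'E; split.
  have [C1 _ LO _ _] := sG'.
  apply: (contour_integral_rmul hip Tcl oD g01 _ _ C1 LO I'E) => // A C v.
  exact: hm_lmul_rmul.
move=> v w; rewrite IE I'E.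
apply: (contour_integral_adjoint hip Tcl Td oD (plane_setC_mirror (K := K)) KD
  (plane_set_mirror (K := K)) f01 g0E g1E sG sG') => A r r' rr v' w'.
by rewrite rr (ipC hX) conj_basis hm_lmulZl (ipZr hX) mulrA cl_sign_sqr mul1r.
Qed.

Lemma right_value_adjoint I I' : right_value ip Ts G f0 f1 I ->
  left_value ip T G' g0 g1 I' ->
  (forall C v, I' (hm_rmul v (e C)) = hm_rmul (I' v) (e C)) /\
  forall v w, <<I v, w>> = <<I' w, v>>.
Proof.
move=> IE I'E; split.
  have [C1 _ LO _ _] := sG'.
  apply: (contour_integral_rmul hip Tcl oD g01 _ _ C1 LO I'E) => // A C v.
  exact: hm_lmul_rmul.
move=> v w; rewrite IE I'E.
apply: (contour_integral_adjoint hip Tcl Td oD (plane_setC_mirror (K := K)) KD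
  (plane_set_mirror (K := K)) f01 g0E g1E sG sG') => A r r' rr v' w'.
by rewrite conj_basis hm_lmulZl (ipZr hX) rr (ipC hX).
Qed.

End AdjointCalculus.

Section Intrinsic.
Context {R : realType} {d : nat} {H : completeNormedModType R}.
Local Notation X := {ffun {set 'I_d} -> H}.
Variables (ip : H -> H -> R) (hip : hilbert_inner ip).
Variables (T : operator d H) (D : set (R * R)) (f0 f1 : R -> R -> clifford R d).
Hypothesis freal : forall x y, D (x, y) -> cl_real (f0 x y) /\ cl_real (f1 x y).

(** Only the terms with e_A = 1 are left, and these are the same. *)
Lemma left_right_value G (I I' : X -> X) :
  (forall c (t : R), c \in flatten G -> 0 <= t <= 1 -> D (c t)) ->
  left_value ip T G f0 f1 I -> right_value ip T G f0 f1 I' -> I = I'.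
Proof.
move=> GD IE I'E; apply/funext => v; apply: (ip_ext (hilbert_rip hip)) => w.
rewrite IE I'E; apply: eq_big_seq => c cG; apply: eq_arcint => t.
rewrite /between min_l// max_r// => /(GD c t cG); rewrite {1}[c t]surjective_pairing.
move=> /freal[r0 r1].
split; apply: eq_bigr => A _.
  have [->|A0] := eqVneq A finset.set0; last by rewrite r0// r1// !mulr0.
  by rewrite conj_basis cl_sign0l scale1r !hm_lmul1.
have [->|A0] := eqVneq A finset.set0; last by rewrite r0// r1// !mulr0.
by rewrite conj_basis cl_sign0l scale1r !hm_lmul1.
Qed.

End Intrinsic.

Unset Implicit Arguments.
Theorem theorem4p6 (R : realType) (d : nat) (hd : (1 <= d)%N)
    (H : completeNormedModType R) (ip : H -> H -> R) (hip : hilbert_inner ip)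
    (T : operator d H) (hT : op_closed T) (hTd : densely_defined T)
    (K : set 'rV[R]_d.+1) (hKc : compact K) (hKs : axially_symmetric K)
    (hKT : K `<=` rho_S T)
    (f : 'rV[R]_d.+1 -> clifford R d) (hf : exists c, lim_infty f c) :
  [/\ SH_L (~` K) f ->
        SH_R (~` K) (sharp f) /\
        forall J U G J' U' G',
          admissible (adjoint ip T) K J U G -> admissible T K J' U' G' ->
          exists A B, [/\ calculus_L (adjoint ip T) f J G A,
                          calculus_R T (sharp f) J' G' B &
                          op_eq (op_total A) (adjoint ip (op_total B))],
      SH_R (~` K) f ->
        SH_L (~` K) (sharp f) /\
        forall J U G J' U' G',
          admissible (adjoint ip T) K J U G -> admissible T K J' U' G' ->
          exists A B, [/\ calculus_R (adjoint ip T) f J G A,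
                          calculus_L T (sharp f) J' G' B &
                          op_eq (op_total A) (adjoint ip (op_total B))] &
      SH_N (~` K) f ->
        forall J U G J' U' G',
          admissible (adjoint ip T) K J U G -> admissible T K J' U' G' ->
          exists A B, [/\ calculus_L (adjoint ip T) f J G A /\
                          calculus_R (adjoint ip T) f J G A,
                          calculus_L T f J' G' B /\ calculus_R T f J' G' B &
                          op_eq (op_total A) (adjoint ip (op_total B))]].
Proof.
have [c fc] := hf; have [J0 HJ0] := exists_imag_unit (R := R) hd.
have oD : open (plane_set (~` K)) by exact (open_plane_setC hKs HJ0 hKc).
have Tscl := adjoint_closed hip hT hTd.
have conjE (f0 f1 : R -> R -> clifford R d) x y : plane_set (~` K) (x, y) ->
  conj_fun f0 x y = cl_conj (f0 x y) /\ conj_fun f1 x y = cl_conj (f1 x y) by [].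
split.
- move=> [f0 [f1 [Hf fE]]].
  have Hg := slice_pair_conj oD Hf; have gE := SH_R_sharp Hf fE.
  split; first by exists (conj_fun f0), (conj_fun f1).
  move=> J U G J' U' G' aU aU'; have [HJ _ _ _ _] := aU; have [HJ' _ _ _ _] := aU'.
  have sG := admissible_surrounds hKs aU; have sG' := admissible_surrounds hKs aU'.
  have [I hI IE] := left_integral hip hKc hKs Tscl HJ sG Hf fE.
  have [I' hI' IE'] := right_integral hip hKc hKs hT HJ' sG' Hg gE.
  have [I'C II'] := left_value_adjoint hip hT hTd hKc hKs HJ0 Hf Hg (conjE f0 f1) sG sG' IE IE'.
  eexists; eexists; split; last exact: (calculus_op_eq hip c (2 * pi)^-1 I'C II').
    by exists c, I.
  by exists (cl_conj c), I'; split => //; exact: lim_infty_sharp.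
- move=> [f0 [f1 [Hf fE]]].
  have Hg := slice_pair_conj oD Hf; have gE := SH_L_sharp Hf fE.
  split; first by exists (conj_fun f0), (conj_fun f1).
  move=> J U G J' U' G' aU aU'; have [HJ _ _ _ _] := aU; have [HJ' _ _ _ _] := aU'.
  have sG := admissible_surrounds hKs aU; have sG' := admissible_surrounds hKs aU'.
  have [I hI IE] := right_integral hip hKc hKs Tscl HJ sG Hf fE.
  have [I' hI' IE'] := left_integral hip hKc hKs hT HJ' sG' Hg gE.
  have [I'C II'] := right_value_adjoint hip hT hTd hKc hKs HJ0 Hf Hg (conjE f0 f1) sG sG' IE IE'.
  eexists; eexists; split; last exact: (calculus_op_eq hip c (2 * pi)^-1 I'C II').
    by exists c, I.
  by exists (cl_conj c), I'; split => //; exact: lim_infty_sharp.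
- move=> fN; have rc := cl_real_conj (cl_real_lim HJ0 hKc hKs fN fc).
  have [f0 [f1 [Hf freal fE]]] := fN.
  have fE' x y J : plane_set (~` K) (x, y) -> imag_unit J ->
      f (slice J x y) = f0 x y + cl_mul (f1 x y) (pv_val J).
    by move=> Dz HJ; rewrite fE// (cl_real_comm (pv_val J) (freal x y Dz).2).
  have selfconj x y : plane_set (~` K) (x, y) ->
      f0 x y = cl_conj (f0 x y) /\ f1 x y = cl_conj (f1 x y).
    by move=> /freal[/cl_real_conj -> /cl_real_conj ->].
  move=> J U G J' U' G' aU aU'; have [HJ _ _ _ _] := aU; have [HJ' _ _ _ _] := aU'.
  have sG := admissible_surrounds hKs aU; have sG' := admissible_surrounds hKs aU'.
  have GD (rho : set (R * R)) L (sL : surrounds (plane_set K) (rho `&` plane_set (~` K)) (flatten L))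
      a (t : R) (aL : a \in flatten L) (t01 : 0 <= t <= 1) : plane_set (~` K) (a t).
    by have [_ _ /(_ a t aL t01)[]] := sL.
  have [I hI IE] := left_integral hip hKc hKs Tscl HJ sG Hf fE.
  have [Ir hIr IrE] := right_integral hip hKc hKs Tscl HJ sG Hf fE'.
  have [I' hI' IE'] := right_integral hip hKc hKs hT HJ' sG' Hf fE'.
  have [I'l hI'l I'lE] := left_integral hip hKc hKs hT HJ' sG' Hf fE.
  have eI := left_right_value hip freal (GD _ _ sG) IE IrE.
  have eI' := left_right_value hip freal (GD _ _ sG') I'lE IE'.
  have [I'C II'] := left_value_adjoint hip hT hTd hKc hKs HJ0 Hf Hf selfconj sG sG' IE IE'.
  eexists; eexists; split; last exact: (calculus_op_eq hip c (2 * pi)^-1 I'C II').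
    by split; exists c, I => //; rewrite eI.
  by rewrite rc; split; exists c, I' => //; rewrite -eI'.
Qed.
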